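(* Let $(w_n)_{n\ge 0}$ and $(v_k)_{k\ge 1}$ be nonnegative reals with $W(z)=\sum_{n\ge0}w_nz^n$, and assume there are $\rho_w>0$, $\alpha>-1$ and slowly varying $L_w,L_v$ with $$w_n\sim L_w(n)\,n^{-1}\rho_w^{-n},\qquad W(\rho_w)\in(0,\infty),\qquad v_n\sim L_v(n)\,n^{\alpha-1}W(\rho_w)^{-n}.$$ Let $X$ have probability generating function $W(\rho_w z)/W(\rho_w)$ and suppose that there is $\gamma\ge0$ with $\lim_{n\to\infty}\mathbb{P}(X>n^t)/\mathbb{P}(X>n)=t^{-\gamma}$ for all $0<t<1$. Let $\Lambda$ be the locally finite Borel measure on $(0,1]$ with $\Lambda([a,b])=a^{-\gamma}-b^{-\gamma}$ for $0<a<b\le1$. Let $(K_1,\dots,K_{N_n})$ follow the Gibbs partition model $\mathbb{P}_n$, with decreasing order statistics $K_{(1)}\ge K_{(2)}\ge\cdots\ge K_{(N_n)}$. Then the point process on $(0,1]$ $$\sum_{i=2}^{N_n}\delta_{\log(K_{(i)})/\log(n)}\,\mathbb{1}_{K_{(i)}>1}$$ converges in distribution (with respect to the vague topology) to a Cox process directed by the random measure $Z\Lambda$, where $Z$ is $\mathrm{Gamma}(\alpha+1,1)$-distributed.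
   Context: For $k\ge1$ set $w_n^{(k)}=\sum_{n_1+\dots+n_k=n,\ n_i\ge0}\prod_{i=1}^k w_{n_i}$ and $u_n=\sum_{k\ge1}v_k w_n^{(k)}$. For $n$ with $0<u_n<\infty$, the Gibbs partition model is the probability measure on finite sequences $(n_1,\dots,n_k)$ ($k\ge1$) of nonnegative integers summing to $n$ given by $\mathbb{P}_n(n_1,\dots,n_k)=v_k\prod_{i=1}^k w_{n_i}/u_n$. $\delta_y$ denotes the Dirac measure at $y$. (The paper states the hypothesis as existence of $\lim \mathbb{P}(X>n^t)/\mathbb{P}(X>n)$ for all $0<t<1$, which is equivalent to the power form $t^{-\gamma}$ for some $\gamma\ge0$.) *)

(* Defs.v *)
From HB Require Import structures.
From mathcomp Require Import all_boot all_order all_algebra.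
From mathcomp Require Import all_classical all_reals all_analysis.
From mathcomp Require Import measurable_realfun.
Set Implicit Arguments. Unset Strict Implicit. Unset Printing Implicit Defensive.
Import Order.TTheory GRing.Theory Num.Theory.
Import numFieldNormedType.Exports.
Local Open Scope classical_set_scope.
Local Open Scope ring_scope.

Section Defs.
Variable R : realType.

Definition slowly_varying (L : R -> R) : Prop :=
  (forall x, 0 < x -> 0 < L x) /\
  measurable_fun (`]0, +oo[ : set R) L /\
  (forall c, 0 < c -> (L (c * x) / L x) @[x --> +oo] --> (1 : R)).

Definition asym_eq (a b : R ^nat) : Prop := (fun n => a n / b n) @ \oo --> (1 : R).

Definition rseries (a : R ^nat) : R := limn (series a).

Definition Wgen (w : R ^nat) (z : R) : R := rseries (fun n => w n * z ^+ n).

Definition tailX (w : R ^nat) (rho x : R) : R :=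
  rseries (fun k => if x < k%:R then w k * rho ^+ k / Wgen w rho else 0).

Definition gibbs_sum (w v : R ^nat) (n : nat) (G : seq nat -> R) : R :=
  rseries (fun k' =>
    v k'.+1 * \sum_(t : {ffun 'I_k'.+1 -> 'I_n.+1} |
                     (\sum_(i < k'.+1) (t i : nat))%N == n)
               ((\prod_(i < k'.+1) w (t i)) * G [seq (t i : nat) | i : 'I_k'.+1])).

Definition gibbs_u (w v : R ^nat) (n : nat) : R := gibbs_sum w v n (fun _ => 1).

Definition gibbs_E (w v : R ^nat) (n : nat) (G : seq nat -> R) : R :=
  gibbs_sum w v n G / gibbs_u w v n.

Definition gibbs_points (n : nat) (s : seq nat) : seq R :=
  [seq ln (K%:R) / ln (n%:R) | K <- behead (sort geq s) & (1 < K)%N].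

Definition point_measure (s : seq R) : {measure set R -> \bar R} :=
  msum (fun i => \d_(nth 0 s i)) (size s).

(* locally finite measure on (0,1] (viewed as a measure on R vanishing off (0,1]) *)
Definition loc_fin_01 (mu : {measure set R -> \bar R}) : Prop :=
  mu (~` `]0, 1]) = 0%E /\ forall e, 0 < e -> (mu `[e, 1%R]%classic < +oo)%E.

Definition Cc01 (f : R -> R) : Prop :=
  {within `]0, 1], continuous f} /\
  exists2 e, 0 < e & forall x, ~ (`[e, 1]%classic x) -> f x = 0.

Definition vague_cvg (mu : {measure set R -> \bar R} ^nat)
    (nu : {measure set R -> \bar R}) : Prop :=
  forall f, Cc01 f ->
    (\int[mu j]_(x in `]0%R, 1%R]) (f x)%:E)%E @[j --> \oo] -->
      (\int[nu]_(x in `]0%R, 1%R]) (f x)%:E)%E.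

(* bounded, vaguely continuous functional on locally finite measures on (0,1]
   (the vague topology there is metrizable, so sequential continuity) *)
Definition bdd_vague_cont (F : {measure set R -> \bar R} -> R) : Prop :=
  (exists M, forall mu, `|F mu| <= M) /\
  forall (mu : {measure set R -> \bar R} ^nat) nu,
    (forall j, loc_fin_01 (mu j)) -> loc_fin_01 nu ->
    vague_cvg mu nu -> F (mu j) @[j --> \oo] --> F nu.

Definition pois (r : R) (k : nat) : R := r ^+ k / k`!%:R * expR (- r).

Definition gamma_const (a : R) : R :=
  fine (\int[lebesgue_measure]_(z in `]0%R, +oo[) (z `^ a * expR (- z))%:E)%E.
Definition gamma_dens (a z : R) : R := z `^ a * expR (- z) / gamma_const a.

(* xi is a Cox process on (0,1] directed by Z * Lambda, with Z ~ Gamma(a+1,1),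
   described by its joint finite-dimensional distributions with Z:
   P(Z in B, xi(A_1)=k_1,...,xi(A_m)=k_m)
     = int_B gamma_dens(z) prod_i Poisson(z Lambda(A_i))(k_i) dz
   for disjoint Borel A_i contained in some [e,1], e > 0. *)
Definition cox_gamma d (Omega : measurableType d) (P : probability Omega R)
    (xi : Omega -> {measure set R -> \bar R}) (Z : Omega -> R)
    (Lambda : {measure set R -> \bar R}) (a : R) : Prop :=
  measurable_fun setT Z /\
  (forall A, measurable A -> measurable_fun [set: Omega] ((fun w => xi w A) : Omega -> \bar R)) /\
  (forall w, loc_fin_01 (xi w)) /\
  forall (m : nat) (A : 'I_m -> set R) (k : 'I_m -> nat) (B : set R),
    measurable B -> (forall i, measurable (A i)) ->
    (exists2 e, 0 < e & forall i, A i `<=` `[e, 1]%classic) ->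
    (forall i j, i != j -> A i `&` A j = set0) ->
    P (Z @^-1` B `&` [set w | forall i, xi w (A i) = ((k i)%:R)%:E]) =
    (\int[lebesgue_measure]_(z in B `&` `]0%R, +oo[)
        (gamma_dens a z * \prod_(i < m) pois (z * fine (Lambda (A i))) (k i))%:E)%E.

End Defs.

(* Main.v *)
(** After the change of weights q_j = w_j rho^j / W(rho), V_k = v_k W(rho)^k, the Gibbs weight of n is
    the sum over k of V_k P(S_k = n), with S_k a sum of k independent copies of X ~ q. Since j q_j is
    slowly varying, j q_j = o(P(X > j)), and size bias gives the local bound
    m P(S_k = m) <= C exp(- k P(X > m) / 2) by induction on k. Summing over k on the scale
    k = z / P(X > n), the regular variation of k V_k turns the sum into a Gamma integral, so that u_n
    is at most (1 + o(1)) times the one-big-jump asymptotics. Conversely, forcing a single jump of size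
    at least 3n/4 bounds from below the contribution to u_n of the sequences whose remaining parts have
    prescribed counts of log K / log n in the cells of a grid of (0,1]; given k these counts are
    asymptotically independent Poisson variables of means z Lambda(cell), by the tail hypothesis.
    Hence the lower limit of the law of the cell counts is at least the mixed Poisson law, which has
    total mass one. Finally, measures agreeing on the cells of finer and finer grids converge vaguely,
    so a bounded nonnegative vaguely continuous F is approximated from below by functions of the cell
    counts; Fatou's lemma yields liminf E F >= E F(xi), and applying this to B + F and B - F concludes. *)
Require Import Defs.
From HB Require Import structures.
From mathcomp Require Import all_boot all_order all_algebra.
From mathcomp Require Import all_classical all_reals all_analysis.
From mathcomp Require Import measurable_realfun.
From mathcomp Require Import ring lra zify.
Import Order.TTheory GRing.Theory Num.Theory.
Import numFieldNormedType.Exports.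
Set Implicit Arguments. Unset Strict Implicit. Unset Printing Implicit Defensive.
Local Open Scope classical_set_scope.
Local Open Scope ring_scope.

(** * Slowly varying functions *)

Section UniformConvergence.
Variable R : realType.
Local Notation mu := (@lebesgue_measure R).

(** A sum of k parts reaches n essentially through one part close to n, while no other part exceeds
    n; the latter has probability about exp(- k P(X > n)), which is the exponential of the Gamma
    density. On the scale k = z / P(X > n) the product k n q_n tends to 0, so the other parts add up
    to o(n): this is what makes the largest part identifiable and lets it be replaced by the missing
    mass. The sharp constant in the upper bound takes two passes: the size bias identity first
    yields a bound with some constant, valid for all k and m, and this crude bound then controls the
    error when the identity is used once more. Two obstacles shape the end. The functional F
    composed with [xi] need not be measurable, so it is compared with measurable limits of simple
    functions. And [cox_gamma] only prescribes joint laws of counts, so that [xi] takes integer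
    values on grid cells, outside one null set, has to be derived. *)

Lemma lebesgue_measure_shift (a : R) (A : set R) : measurable A ->
  mu [set x | A (x - a)] = mu A.
Proof.
move=> mA.
have ms : measurable_fun [set: R] (fun x : R => x - a : R).
  by apply: measurable_funB.
transitivity (pushforward mu (fun x : measurableTypeR R => x - a : measurableTypeR R) A); first by [].
rewrite (@lebesgue_measure_unique R (pushforward mu (fun x : measurableTypeR R => x - a : measurableTypeR R)))//.
move=> X [[b c]] _ <- /=.
rewrite /pushforward /=.
rewrite (_ : _ @^-1` _ = `]b + a, c + a]%classic); last first.
  by apply/seteqP; split => x /=; rewrite !in_itv /= ltrBrDr lerBlDr.
rewrite -[LHS]/(mu `]b, c]%classic) -[RHS]/(mu `]b + a, c + a]%classic).
rewrite !lebesgue_measure_itv /= !lte_fin ltrD2r.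
by case: ifP => // _; congr (_%:E); ring.
Qed.

End UniformConvergence.

Section UCT.
Variable R : realType.
Local Notation mu := (@lebesgue_measure R).

(** If [U] missed the translate of [V] by [u], the two would be disjoint subsets of [0, 3] of total
    measure above 3. *)
Lemma measure_pigeonhole (U V : set R) (u : R) : measurable U -> measurable V ->
  U `<=` `[0, 2] -> V `<=` `[0, 2] -> 0 <= u <= 1 ->
  ((3 / 2)%:E < mu U)%E -> ((3 / 2)%:E < mu V)%E ->
  exists2 v, V v & U (u + v).
Proof.
move=> mU mV U2 V2 u01 hU hV; apply: contrapT => H.
pose V' := [set x | V (x - u)].
have mV' : measurable V'.
  have ms : measurable_fun [set: R] (fun x : R => x - u : R).
    by apply: measurable_funB.
  by have := ms measurableT _ mV; rewrite setTI.
have dis : U `&` V' = set0.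
  rewrite -subset0 => x [Ux Vx]; apply: H; exists (x - u) => //.
  by rewrite addrC subrK.
have : (mu (U `|` V') <= mu `[0%R, 3%R]%classic)%E.
  apply: le_measure; rewrite ?inE//; first exact: measurableU.
  move=> x [/U2|/V2] /=; rewrite !in_itv /= => /andP[? ?]; apply/andP; split; lra.
rewrite lebesgue_measure_itv /= lte_fin (_ : (0 < 3 :> R))//=.
have muV' : mu V' = mu V by exact: lebesgue_measure_shift.
have -> : mu (U `|` V') = (mu U + mu V)%E by rewrite -muV'; exact: measureU.
move=> h.
have := lt_le_trans (lteD hU hV) h.
by rewrite -!EFinD lte_fin; lra.
Qed.

(** By pointwise convergence the sets increase to [0, 2], so their measures tend to 2 by continuity
    from below. *)
Lemma eventually_small_sets (f : nat -> R -> R) (e : R) : 0 < e ->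
  (forall m, measurable_fun setT (f m)) ->
  (forall u : R, 0 <= u <= 2 -> f m u @[m --> \oo] --> (0 : R)) ->
  let U n := [set u | 0 <= u <= 2 /\ forall m, (n <= m)%N -> `|f m u| <= e] in
  (forall n, measurable (U n)) /\
  \forall n \near \oo, ((3 / 2)%:E < mu (U n))%E.
Proof.
move=> e0 mf f0 U.
have mU n : measurable (U n).
  rewrite (_ : U n = `[0, 2]%classic `&` \bigcap_m [set u | (n <= m)%N -> `|f m u| <= e]); last first.
    apply/seteqP; split => u /=; rewrite in_itv /=.
      by move=> [h1 h2]; split => // m _ /=; exact: h2.
    by move=> [h1 h2]; split => // m; exact: h2.
  apply: measurableI => //; apply: bigcap_measurable => // m _.
  case: (leqP n m) => nm; last first.
    rewrite (_ : mkset _ = setT)//; apply/seteqP; split => // u _ /=.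
  rewrite (_ : mkset _ = (fun u => `|f m u|) @^-1` `]-oo, e]%classic); last first.
    by apply/seteqP; split => u /=; rewrite in_itv /= => h //; exact: h.
  rewrite -[_ @^-1` _]setTI.
  by apply: (measurableT_comp (@normr_measurable _ _) (mf m)).
split => //.
have ndU : nondecreasing_seq U.
  move=> a b ab; apply/subsetPset => u [h1 h2]; split => // m bm.
  by apply: h2; exact: leq_trans bm.
have UT : \bigcup_n U n = `[0, 2]%classic.
  apply/seteqP; split => u /=; rewrite in_itv /=.
    by move=> [n _ []].
  move=> u02; have /cvgrPdist_le /(_ _ e0)[N _ HN] := f0 _ u02.
  exists N => //; split => // m Nm; have := HN _ Nm.
  by rewrite /= sub0r normrN.
have cv : mu (U n) @[n --> \oo] --> mu (`[0%R, 2%R]%classic).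
  rewrite -UT; apply: nondecreasing_cvg_mu => //.
  by rewrite UT.
have gt32 : ((3 / 2)%:E < mu (`[0%R, 2%R]%classic))%E.
  by rewrite lebesgue_measure_itv /= lte_fin (_ : (0 < 2 :> R))//= -EFinB lte_fin; lra.
exact: (cv _ (open_ereal_gt' gt32)).
Qed.

(* Uniform convergence theorem in additive form: along a bad sequence, both near [x] and near [x + u]
   the good increments fill more than 3/2 of [[0, 2]], so two of them combine, by measure_pigeonhole. *)
Lemma uniform_convergence (h : R -> R) : measurable_fun setT h ->
  (forall u : R, 0 <= u -> h (x + u) - h x @[x --> +oo] --> (0 : R)) ->
  forall e : R, 0 < e -> exists x0, forall x u, x0 <= x -> 0 <= u <= 1 ->
    `|h (x + u) - h x| <= e.
Proof.
move=> mh hc e e0; apply: contrapT => H.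
have H' (n : nat) : exists xu : R * R, [/\ n%:R <= xu.1, 0 <= xu.2 <= 1 &
    e < `|h (xu.1 + xu.2) - h xu.1| ].
  apply: contrapT => H2; apply: H; exists n%:R => x u nx u01.
  by rewrite leNgt; apply/negP => hlt; apply: H2; exists (x, u).
have [s Hs] := choice H'.
have e20 : 0 < e / 2 by apply: divr_gt0.
pose x n := (s n).1. pose u n := (s n).2.
have xoo : x n @[n --> \oo] --> +oo.
  apply/cvgryPge => A; near=> n.
  have [+ _ _] := Hs n; apply: le_trans; near: n; exact: nbhs_infty_ger.
have xuoo : x n + u n @[n --> \oo] --> +oo.
  apply/cvgryPge => A; near=> n.
  have [+ /andP[+ _] _] := Hs n; rewrite -/(x n) -/(u n) => h1 h2.
  suff : A <= n%:R by lra.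
  near: n; exact: nbhs_infty_ger.
have mshift a : measurable_fun setT (fun v : R => h (a + v) - h a).
  apply: measurable_funB => //.
  by apply: measurableT_comp => //; apply: measurable_funD.
have [mU U32] := eventually_small_sets e20 (fun m => mshift (x m))
  (fun v (hv : 0 <= v <= 2) => cvg_comp _ _ xoo (hc v (proj1 (andP hv)))).
have [mV V32] := eventually_small_sets e20 (fun m => mshift (x m + u m))
  (fun v (hv : 0 <= v <= 2) => cvg_comp _ _ xuoo (hc v (proj1 (andP hv)))).
have [n [hU hV]] := filter_ex (filterI U32 V32).
have [_ u01 elt] := Hs n.
have [||v [_ hv2] [_ hv1]] := measure_pigeonhole (mU n) (mV n) _ _ u01 hU hV.
- by move=> v [+ _] /=; rewrite in_itv.
- by move=> v [+ _] /=; rewrite in_itv.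
have := hv1 n (leqnn n); have := hv2 n (leqnn n); rewrite -/(x n) -/(u n) in elt *.
rewrite addrA => a1 a2.
have : `|h (x n + u n) - h (x n)| <= e / 2 + e / 2.
  rewrite (_ : _ - _ = (h (x n + u n + v) - h (x n)) - (h (x n + u n + v) - h (x n + u n))); last by ring.
  by apply: le_trans (ler_normB _ _) _; exact: lerD.
by move: elt; rewrite -splitr => e1 e2; have := lt_le_trans e1 e2; rewrite ltxx.
Unshelve. all: by end_near. Qed.

(** The substitution h = ln o L o exp makes slow variation additive. The range up to 2 x is
    admissible because 2 <= e, so that ln (y / x) lies in [0, 1]. *)
Lemma slowly_varying_uniform (L : R -> R) : slowly_varying L ->
  forall e : R, 0 < e -> exists2 x0 : R, 0 < x0 & forall x y : R, x0 <= x -> x <= y <= 2 * x ->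
    `|ln (L y) - ln (L x)| <= e.
Proof.
move=> [Lp [mL cL]] e e0.
pose h (t : R) := ln (L (expR t)).
have mh : measurable_fun setT h.
  apply: (measurableT_comp (@measurable_ln R)).
  apply: (measurable_comp _ _ mL) => //.
  by move=> _ [x _ <-] /=; rewrite in_itv /= expR_gt0.
have hc u : 0 <= u -> h (x + u) - h x @[x --> +oo] --> (0 : R).
  move=> u0.
  have -> : (fun x => h (x + u) - h x) = (fun t => ln (L (expR u * t) / L t)) \o expR.
    apply/funext => x; rewrite /h /= ln_div ?posrE ?Lp ?mulr_gt0 ?expR_gt0//.
    by rewrite expRD mulrC.
  rewrite -[X in _ --> X](@ln1 R).
  apply: (@cvg_comp _ _ _ expR _ _ (+oo : set_system R)).
    apply/cvgryPge => A; near=> x; apply: le_trans (expR_ge1Dx x).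
    suff : A <= x by lra.
    by near: x; apply: nbhs_pinfty_ge; exact: num_real.
  apply: continuous_cvg; last by apply: cL; exact: expR_gt0.
  exact: continuous_ln.
have [x0 Hx0] := uniform_convergence mh hc e0.
exists (expR x0); first exact: expR_gt0.
move=> x y xx /andP[xy y2x].
have xp : 0 < x by apply: lt_le_trans xx; exact: expR_gt0.
have yp : 0 < y by apply: lt_le_trans xy.
have := Hx0 (ln x) (ln y - ln x); rewrite /h subrKC !lnK//; apply.
  by rewrite -ler_expR lnK.
rewrite subr_ge0 ler_ln// xy /= lerBlDr -ler_expR expRD !lnK// .
rewrite (le_trans y2x)// ler_pM2r// .
by have := expR_ge1Dx (1:R); lra.
Unshelve. all: by end_near. Qed.


(** Halving y costs at most e / 2 by uniformity and lowers e ln (y / x) by e ln 2 >= e / 2, so each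
    dyadic step pays for itself; the additive e covers the last, incomplete step. *)
Lemma slowly_varying_log_potter (L : R -> R) : slowly_varying L ->
  forall e : R, 0 < e -> exists2 x0 : R, 0 < x0 & forall x y : R, x0 <= x -> x <= y ->
    `|ln (L y) - ln (L x)| <= e + e * ln (y / x).
Proof.
move=> sL e e0.
have ln2 : (1 / 2 : R) <= ln 2.
  have : ln (1 + (- (1 / 2)) : R) <= - (1 / 2) by apply: le_ln1Dx; lra.
  rewrite (_ : 1 + _ = 1 / 2); last by lra.
  by rewrite ln_div ?posrE// ln1; lra.
have e20 : 0 < e / 2 by lra.
have [x0 x00 H] := slowly_varying_uniform sL e20.
exists x0 => // x y xx xy.
have xp : 0 < x by lra.
have [k hk] : exists k : nat, y <= 2 ^+ k * x.
  have yx : 0 <= y / x by apply: divr_ge0; lra.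
  exists (Num.truncn (y / x)).+1; rewrite -ler_pdivrMr//.
  have /andP[_ h] := truncn_itv yx; apply/ltW/(lt_trans h).
  by rewrite -natrX ltr_nat; exact: ltn_expl.
elim: k y xy hk => [|k IH] y xy hk.
  have -> : y = x by move: hk; rewrite expr0 mul1r; lra.
  by rewrite subrr normr0 divff ?gt_eqF// ln1 mulr0 addr0 ltW.
have yp : 0 < y by lra.
case: (leP y (2 * x)) => hy.
  apply: (le_trans (H x y xx _)); first by rewrite xy hy.
  suff : 0 <= e * ln (y / x) by lra.
  by apply: mulr_ge0; [lra|apply: ln_ge0; rewrite ler_pdivlMr// mul1r].
have h1 := H (y / 2) y; have h2 := IH (y / 2).
have -> : ln (L y) - ln (L x) = (ln (L y) - ln (L (y / 2))) + (ln (L (y / 2)) - ln (L x)) by ring.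
apply: (le_trans (ler_normD _ _)).
have {}h1 : `|ln (L y) - ln (L (y / 2))| <= e / 2.
  by apply: h1; [lra|apply/andP; split; lra].
have {}h2 : `|ln (L (y / 2)) - ln (L x)| <= e + e * ln (y / 2 / x).
  by apply: h2; [lra|move: hk; rewrite exprS; lra].
have lnE : ln (y / 2 / x) = ln (y / x) - ln 2.
  by rewrite -ln_div ?posrE ?divr_gt0//; congr ln; field; rewrite gt_eqF.
rewrite lnE in h2.
have : e * (1 / 2) <= e * ln 2 by rewrite ler_pM2l.
lra.
Qed.

Lemma slowly_varying_potter (L : R -> R) : slowly_varying L ->
  forall e : R, 0 < e -> exists2 x0 : R, 0 < x0 & forall x y : R, x0 <= x -> x <= y ->
    L y <= (1 + e) * (y / x) `^ e * L x /\ L x <= (1 + e) * (y / x) `^ e * L y.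
Proof.
move=> sL e e0; have [Lp _] := sL.
(* After exponentiation, the bound ln (1 + e) on the additive error becomes the factor 1 + e, and
   the bound e limits the exponent. *)
have d0 : 0 < Num.min e (ln (1 + e)) by rewrite lt_min e0 ln_gt0//; lra.
have [x0 x00 H] := slowly_varying_log_potter sL d0.
exists x0 => // x y xx xy.
have xp : 0 < x by lra.
have yp : 0 < y by lra.
have lyx : 0 <= ln (y / x) by apply: ln_ge0; rewrite ler_pdivlMr// mul1r.
have {}H : `|ln (L y) - ln (L x)| <= ln ((1 + e) * (y / x) `^ e).
  rewrite lnM ?posrE ?powR_gt0 ?divr_gt0//; last lra.
  rewrite ln_powR; apply: (le_trans (H _ _ xx xy)).
  apply: lerD; first by rewrite ge_min lexx orbT.
  by rewrite ler_wpM2r// ge_min lexx.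
have P0 : 0 < (1 + e) * (y / x) `^ e by rewrite mulr_gt0 ?powR_gt0 ?divr_gt0//; lra.
have LL : forall a b : R, 0 < a -> 0 < b -> ln (L a) - ln (L b) <= ln ((1 + e) * (y / x) `^ e) ->
   L a <= (1 + e) * (y / x) `^ e * L b.
  move=> a b a0 b0 h.
  rewrite -ler_ln ?posrE; [|exact: Lp|by apply: mulr_gt0 => //; exact: Lp].
  by rewrite lnM ?posrE; [lra| |exact: Lp].
move: H; rewrite ler_norml => /andP[h1 h2].
by split; apply: LL => //; lra.
Qed.

End UCT.

(** * Sums of independent variables *)

Section IidSum.
Variable R : realType.
Implicit Types (q : nat -> R) (g h : seq nat -> R) (n k : nat).

(* [q] is truncated to [0, .., n]: enough for events on which the sum of the parts is [n]. *)
Fixpoint iidE q n k g : R :=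
  if k is k'.+1 then \sum_(x < n.+1) q x * iidE q n k' (fun s => g ((x : nat) :: s))
  else g [::].

(** Links the recursive expectation, suited to induction on k, with the sum over finite functions in
    [gibbs_sum]. *)
Lemma iidE_ffun q n k g :
  \sum_(t : {ffun 'I_k -> 'I_n.+1}) (\prod_(i < k) q (t i)) * g [seq (t i : nat) | i : 'I_k]
  = iidE q n k g.
Proof.
elim: k g => [|k IH] g /=.
  rewrite (big_pred1 [ffun i : 'I_0 => ord0]).
    by rewrite big_ord0 mul1r /image_mem enum_ord0.
  by move=> t /=; apply/esym/eqP/ffunP => -[].
pose cons (p : 'I_n.+1 * {ffun 'I_k -> 'I_n.+1}) : {ffun 'I_k.+1 -> 'I_n.+1} :=
  [ffun i => if unlift ord0 i is Some j then p.2 j else p.1].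
pose uncons (t : {ffun 'I_k.+1 -> 'I_n.+1}) :=
  (t ord0, [ffun j : 'I_k => t (lift ord0 j)]).
have consK : cancel uncons cons.
  move=> t; apply/ffunP => i; rewrite ffunE /=.
  by case: unliftP => [j ->|->] //; rewrite ffunE.
have unconsK : cancel cons uncons.
  move=> [x t]; rewrite /uncons /cons ffunE unlift_none; congr (_, _).
  by apply/ffunP => j; rewrite !ffunE liftK.
rewrite (reindex cons); last by exists uncons => p _.
rewrite -(pair_bigA _ (fun x t => (\prod_(i < k.+1) q (cons (x, t) i)) *
   g [seq (cons (x, t) i : nat) | i : 'I_k.+1])) /=.
apply: eq_bigr => x _; rewrite -IH big_distrr /=.
apply: eq_bigr => t _; rewrite big_ord_recl ffunE unlift_none -mulrA.
congr (_ * (_ * g _)).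
  by apply: eq_bigr => i _; rewrite ffunE liftK.
rewrite /image_mem enum_ordSl /= ffunE unlift_none; congr (_ :: _).
by rewrite -map_comp; apply: eq_map => i /=; rewrite ffunE liftK.
Qed.

Lemma eq_iidE q n k g h :
  (forall s, size s = k -> all (fun x => x <= n)%N s -> g s = h s) ->
  iidE q n k g = iidE q n k h.
Proof.
elim: k g h => [|k IH] g h gh /=; first exact: gh.
apply: eq_bigr => x _; congr (_ * _); apply: IH => s ss sn; apply: gh.
  by rewrite /= ss.
by rewrite /= sn andbT -ltnS.
Qed.

Lemma le_iidE q n k g h : (forall j, 0 <= q j) ->
  (forall s, size s = k -> all (fun x => x <= n)%N s -> g s <= h s) ->
  iidE q n k g <= iidE q n k h.
Proof.
move=> q0; elim: k g h => [|k IH] g h gh /=; first exact: gh.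
apply: ler_sum => x _; apply: ler_wpM2l => //; apply: IH => s ss sn; apply: gh.
  by rewrite /= ss.
by rewrite /= sn andbT -ltnS.
Qed.

Lemma iidE_ge0 q n k g : (forall j, 0 <= q j) -> (forall s, 0 <= g s) ->
  0 <= iidE q n k g.
Proof.
move=> q0; elim: k g => [|k IH] g g0 /=; first exact: g0.
by apply: sumr_ge0 => x _; apply: mulr_ge0 => //; apply: IH => s.
Qed.

Lemma iidED q n k g h : iidE q n k (fun s => g s + h s) = iidE q n k g + iidE q n k h.
Proof.
elim: k g h => [|k IH] g h //=.
by rewrite -big_split; apply: eq_bigr => x _; rewrite IH mulrDr.
Qed.

Lemma iidEZ q n k c g : iidE q n k (fun s => c * g s) = c * iidE q n k g.
Proof.
elim: k g => [|k IH] g //=.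
by rewrite big_distrr; apply: eq_bigr => x _; rewrite IH mulrCA.
Qed.

Lemma iidE_sum q n k (I : Type) (r : seq I) (P : pred I) (g : I -> seq nat -> R) :
  iidE q n k (fun s => \sum_(i <- r | P i) g i s) = \sum_(i <- r | P i) iidE q n k (g i).
Proof.
elim: k g => [|k IH] g //=.
rewrite exchange_big; apply: eq_bigr => x _.
by rewrite IH big_distrr.
Qed.

Lemma iidE_prod q n k (f : nat -> R) :
  iidE q n k (fun s => \prod_(x <- s) f x) = (\sum_(x < n.+1) q x * f x) ^+ k.
Proof.
elim: k => [|k IH] /=; first by rewrite big_nil expr0.
rewrite exprS big_distrl; apply: eq_bigr => x _ /=.
rewrite -mulrA -IH; congr (_ * _); rewrite -iidEZ.
by apply: eq_iidE => s _ _; rewrite big_cons.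
Qed.

Lemma iidE_cst q n k c : iidE q n k (fun _ => c) = c * (\sum_(x < n.+1) q x) ^+ k.
Proof.
have -> : iidE q n k (fun _ => c) = iidE q n k (fun s => c * \prod_(x <- s) 1).
  by apply: eq_iidE => s _ _; rewrite big1_eq mulr1.
by rewrite iidEZ iidE_prod; congr (_ * _ ^+ _); apply: eq_bigr => x _; rewrite mulr1.
Qed.

Lemma iidES q n k g : iidE q n k.+1 g =
  \sum_(x < n.+1) q x * iidE q n k (fun s => g ((x : nat) :: s)).
Proof. by []. Qed.

Arguments iidE : simpl never.

(* Marking a uniformly chosen coordinate, i.e. exchangeability. *)
Lemma iidE_size_bias q n k (f : nat -> R) g :
  (forall s t, perm_eq s t -> g s = g t) ->
  iidE q n k.+1 (fun s => (\sum_(x <- s) f x) * g s) =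
  k.+1%:R * \sum_(x < n.+1) f x * q x * iidE q n k (fun s => g ((x : nat) :: s)).
Proof.
elim: k g => [|k IH] g gp.
  rewrite mul1r iidES; apply: eq_bigr => x _.
  by rewrite /iidE big_seq1; ring.
pose T := \sum_(x < n.+1) f x * q x * iidE q n k.+1 (fun s => g ((x : nat) :: s)).
rewrite -/T iidES.
transitivity (\sum_(x < n.+1) (f x * q x * iidE q n k.+1 (fun s => g ((x : nat) :: s)) +
   q x * iidE q n k.+1 (fun s => (\sum_(y <- s) f y) * g ((x : nat) :: s)))).
  apply: eq_bigr => x _; rewrite [f x * _]mulrC -mulrA -mulrDr; congr (_ * _).
  rewrite -iidEZ -iidED.
  by apply: eq_iidE => s _ _; rewrite big_cons mulrDl.
rewrite big_split -/T /=.
rewrite -[k.+2]add1n natrD mulrDl mul1r; congr (_ + _).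
transitivity (\sum_(x < n.+1) q x * (k.+1%:R * \sum_(y < n.+1) f y * q y *
    iidE q n k (fun s => g ((x : nat) :: (y : nat) :: s)))).
  apply: eq_bigr => x _; congr (_ * _).
  by rewrite (IH (fun s => g ((x : nat) :: s)))// => s t st; apply: gp; rewrite perm_cons.
under eq_bigr => x _ do rewrite mulrCA big_distrr.
rewrite -big_distrr /=; congr (_ * _).
rewrite exchange_big; apply: eq_bigr => y _ /=.
rewrite big_distrr /=; apply: eq_bigr => x _.
rewrite mulrCA; congr (_ * (_ * _)); apply: eq_iidE => s _ _; apply: gp.
by rewrite (perm_catCA [:: _ : nat] [:: _ : nat] s).
Qed.

(** The k-fold convolution power at m. Truncating the parts at m loses nothing, since parts that sum
    to m are at most m. *)
Definition conv_pow q k m : R := iidE q m k (fun s => (sumn s == m)%:R).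

Lemma iidE_widen q n N k g : (n <= N)%N ->
  (forall s, ~~ all (fun x => x <= n)%N s -> g s = 0) ->
  iidE q N k g = iidE q n k g.
Proof.
move=> nN; elim: k g => [|k IH] g g0 //=.
rewrite !iidES (big_ord_widen N.+1 (fun x => q x * iidE q n k (fun s => g (x :: s))))//.
rewrite [RHS]big_mkcond; apply: eq_bigr => x _.
case: ifPn => xn.
  congr (_ * _); apply: IH => s sn; apply: g0 => /=.
  by rewrite negb_and sn orbT.
have -> : iidE q N k (fun s => g ((x : nat) :: s)) = iidE q N k (fun _ => 0).
  by apply: eq_iidE => s _ _; apply: g0; rewrite /= negb_and -ltnS xn.
by rewrite iidE_cst mul0r mulr0.
Qed.

Lemma mem_le_sumn s x : x \in s -> (x <= sumn s)%N.
Proof.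
elim: s => //= a s IH; rewrite in_cons => /orP[/eqP->|/IH h].
  exact: leq_addr.
exact: leq_trans h (leq_addl _ _).
Qed.

Lemma iidE_conv_pow q n k m : (m <= n)%N ->
  iidE q n k (fun s => (sumn s == m)%:R) = conv_pow q k m.
Proof.
move=> mn; apply: iidE_widen => // s sm.
case: eqP => // sE; case/negP: sm; apply/allP => x /mem_le_sumn.
by rewrite sE.
Qed.

Lemma conv_pow_ge0 q k m : (forall j, 0 <= q j) -> 0 <= conv_pow q k m.
Proof. by move=> q0; apply: iidE_ge0 => // s; rewrite ler0n. Qed.

Lemma conv_pow0 q m : (0 < m)%N -> conv_pow q 0 m = 0.
Proof. by case: m. Qed.

(** On the event that the sum is m, the factor m is the sum of the parts; marking one part by its
    size leaves k parts with sum m - j. The weights j q_j produced here are the slowly varying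
    ones. *)
Lemma conv_pow_size_bias q k m :
  m%:R * conv_pow q k.+1 m =
  k.+1%:R * \sum_(j < m.+1) j%:R * q j * conv_pow q k (m - j).
Proof.
rewrite /conv_pow -iidEZ.
transitivity (iidE q m k.+1 (fun s => (\sum_(x <- s) x%:R) * (sumn s == m)%:R)).
  apply: eq_iidE => s _ _; rewrite -natr_sum -sumnE.
  by case: eqP => [->//|_]; rewrite !mulr0.
rewrite iidE_size_bias; last first.
  by move=> s t st; rewrite !sumnE (perm_big _ st).
congr (_ * _); apply: eq_bigr => j _; congr (_ * _).
have jm : (j <= m)%N by rewrite -ltnS.
rewrite -/(conv_pow q k (m - j)) -(@iidE_conv_pow q m k (m - j) (leq_subr _ _)).
by apply: eq_iidE => s _ _ /=; rewrite -[X in (_ == X)%:R = _](subnKC jm) eqn_add2l.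
Qed.

Lemma sum_conv_pow q k n : (forall j, 0 <= q j) ->
  \sum_(m < n.+1) conv_pow q k m <= (\sum_(x < n.+1) q x) ^+ k.
Proof.
move=> q0; rewrite -[leRHS]mul1r -iidE_cst.
under eq_bigr => m _ do rewrite -(@iidE_conv_pow q n k m (leq_ord m)).
rewrite -iidE_sum; apply: le_iidE => // s _ _.
case: (ltnP (sumn s) n.+1) => sn.
  rewrite (bigD1 (Ordinal sn))//= eqxx big1 ?addr0// => i /eqP/= h.
  by case: eqP => // e; exfalso; apply: h; apply/val_inj.
by rewrite big1// => i _; case: eqP => // e; move: sn; rewrite e ltnNge -ltnS ltn_ord.
Qed.

End IidSum.

(** * Potter bounds for sequences *)

Section PotterSequence.
Variable R : realType.
Implicit Types (l q : nat -> R).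

(** The only form in which slow variation is used from here on, both for j q_j and for the slowly
    varying factor of the weights V. *)
Definition potter_seq l := forall e : R, 0 < e -> exists2 N : nat, (0 < N)%N &
  forall j m, (N <= j)%N -> (j <= m)%N ->
  [/\ 0 < l j, l j <= (1 + e) * (m%:R / j%:R) `^ e * l m &
      l m <= (1 + e) * (m%:R / j%:R) `^ e * l j].

Lemma slowly_varying_potter_seq (L : R -> R) l : slowly_varying L ->
  l n / L n%:R @[n --> \oo] --> (1 : R) -> potter_seq l.
Proof.
move=> sL lL e e0; have [Lp _] := sL.
(* Small enough that (1 + d)^2 <= (1 + e) (1 - d), which absorbs the replacement of [L] by [l] at
   both ends. *)
pose d := Num.min (e / 8) (1 / 8).
have d0 : 0 < d by rewrite /d lt_min; apply/andP; split; lra.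
have de : d <= e / 8 by rewrite /d ge_min lexx.
have d1 : d <= 1 / 8 by rewrite /d ge_min lexx orbT.
have [x0 x00 HP] := slowly_varying_potter sL d0.
have [M _ HM] : \forall n \near \oo, `|1 - l n / L n%:R| <= d.
  by have /cvgrPdist_le /(_ _ d0) := lL.
pose N := maxn 1 (maxn M (Num.truncn x0).+1).
have N1 : (0 < N)%N by rewrite leq_maxl.
exists N => // j m Nj jm.
have bnd i : (N <= i)%N -> [/\ 0 < (i%:R : R), x0 <= i%:R, 0 < L i%:R,
   (1 - d) * L i%:R <= l i & l i <= (1 + d) * L i%:R].
  rewrite /N !geq_max => /and3P[i1 Mi xi].
  have i0 : 0 < (i%:R : R) by rewrite ltr0n.
  have xi' : x0 <= i%:R.
    apply/ltW/(lt_le_trans (truncnS_gt x0)); by rewrite ler_nat.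
  have Li := Lp _ i0.
  have := HM i Mi; rewrite /= ler_norml => /andP[h1 h2].
  split => //.
    by rewrite -ler_pdivlMr//; lra.
  by rewrite -ler_pdivrMr//; lra.
have [j0 xj Lj ja jb] := bnd j Nj.
have [m0 xm Lm ma mb] := bnd m (leq_trans Nj jm).
have [P1 P2] := HP j%:R m%:R xj (ltac:(by rewrite ler_nat)).
have mj1 : 1 <= (m%:R / j%:R : R) by rewrite ler_pdivlMr// mul1r ler_nat.
have Y0 : 0 < (m%:R / j%:R : R) `^ d by rewrite powR_gt0// divr_gt0.
have YY : (m%:R / j%:R : R) `^ d <= (m%:R / j%:R) `^ e.
  apply: ler_powR => //; lra.
have key (La Lb la lb : R) : 0 < La -> 0 < Lb -> La <= (1 + d) * (m%:R / j%:R) `^ d * Lb ->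
   la <= (1 + d) * La -> (1 - d) * Lb <= lb -> la <= (1 + e) * (m%:R / j%:R) `^ e * lb.
  move=> La0 Lb0 h1 h2 h3.
  apply: (le_trans h2).
  set Y := (m%:R / j%:R) `^ d in Y0 YY h1; set Z := (m%:R / j%:R) `^ e in YY *.
  have lb0 : 0 < lb by apply: lt_le_trans h3; apply: mulr_gt0 => //; lra.
  have e1 : (1 + d) * ((1 + d) * Y * Lb) <= (1 + e) * Y * lb.
    have : (1 + e) * Y * ((1 - d) * Lb) <= (1 + e) * Y * lb.
      by rewrite ler_wpM2l// mulr_ge0//; lra.
    apply: le_trans.
    rewrite (_ : (1 + d) * _ = (1 + d) ^+ 2 * (Y * Lb)); last by ring.
    rewrite (_ : (1 + e) * _ * _ = (1 + e) * (1 - d) * (Y * Lb)); last by ring.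
    rewrite ler_wpM2r//; first by rewrite mulr_ge0// ltW.
    nra.
  apply: (le_trans (ler_wpM2l _ h1)); first lra.
  apply: (le_trans e1); rewrite ler_wpM2r//; first exact: ltW.
  rewrite ler_wpM2l//; lra.
split.
- by apply: lt_le_trans ja; apply: mulr_gt0 => //; lra.
- exact: key Lj Lm P2 jb ma.
- exact: key Lm Lj P1 mb ja.
Qed.

Lemma potter_seq_gt0 l : potter_seq l -> \forall n \near \oo, 0 < l n.
Proof.
move=> pl; have [N _ HN] := pl 1 ltr01.
by exists N => // n /= Nn; have [] := HN n n Nn (leqnn n).
Qed.

(** An exponent below 1 keeps the sum of (m / j)^(1/2) over j <= J of order (m J)^(1/2). The
    finitely many indices below the Potter threshold are absorbed into the constant. *)
Lemma potter_seq_sqrt l : (forall n, 0 <= l n) -> potter_seq l ->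
  exists C : R, 1 <= C /\ exists2 N : nat, (0 < N)%N & forall m j, (N <= m)%N ->
    (0 < j <= m)%N -> 0 < l m /\ l j <= C * Num.sqrt (m%:R / j%:R) * l m.
Proof.
move=> l0 pl; have [N N0 HN] := pl (2^-1) (ltac:(by lra)).
have lN : 0 < l N by have [] := HN N N (leqnn _) (leqnn _).
pose S := \sum_(j < N) l j.
have S0 : 0 <= S by apply: sumr_ge0 => j _.
pose sN := Num.sqrt (N%:R : R).
have sN1 : 1 <= sN by rewrite -(sqrtr1 R) ler_sqrt ?ler1n.
exists (2 + 2 * sN * S / l N); split.
  have : 0 <= 2 * sN * S / l N by rewrite divr_ge0 ?mulr_ge0 //; lra.
  lra.
exists N => // m j Nm /andP[j0 jm].
have [lm _ _] := HN m m Nm (leqnn m).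
split => //.
have jp : 0 < (j%:R : R) by rewrite ltr0n.
have Q1 : 1 <= Num.sqrt (m%:R / j%:R : R).
  rewrite -[leLHS](@sqrtr1 R); apply: ler_wsqrtr.
  by rewrite ler_pdivlMr// mul1r ler_nat.
have SS : 0 <= 2 * sN * S / l N by rewrite divr_ge0 ?mulr_ge0 //; lra.
case: (leqP N j) => Nj.
  have [_ + _] := HN j m Nj jm.
  rewrite powR12_sqrt ?divr_ge0 ?ler0n// => h.
  apply: (le_trans h); apply: ler_wpM2r; [exact: ltW|apply: ler_wpM2r; lra].
have [_ + _] := HN N m (leqnn _) Nm.
rewrite powR12_sqrt ?divr_ge0 ?ler0n// => h.
have lj : l j <= S.
  rewrite /S (bigD1 (Ordinal Nj))//= lerDl; apply: sumr_ge0 => i _; exact: l0.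
have h2 : Num.sqrt (m%:R / N%:R : R) <= Num.sqrt (m%:R / j%:R).
  apply: ler_wsqrtr; rewrite ler_wpM2l ?ler0n// lef_pV2 ?posrE ?ltr0n// ler_nat.
  exact: ltnW.
apply: (le_trans lj).
have : S * l N <= S * (2 * Num.sqrt (m%:R / j%:R) * l m).
  apply: ler_wpM2l => //; apply: (le_trans h); apply: ler_wpM2r; first exact: ltW.
  have : 0 <= Num.sqrt (m%:R / N%:R : R) by exact: sqrtr_ge0.
  lra.
rewrite -ler_pdivlMr// => h3; apply: (le_trans h3).
set Q := Num.sqrt (m%:R / j%:R) in Q1 h3 *; set X := S * _ / _ in h3 *.
have X0 : 0 <= X by apply: (le_trans S0).
rewrite (_ : (_ + _) * _ * _ = 2 * (Q * l m) + sN * X); last by rewrite /X; ring.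
have : X <= sN * X by apply: ler_peMl.
have : 0 <= Q * l m by apply: mulr_ge0; lra.
lra.
Qed.

Lemma sum_inv_sqrt (J : nat) : \sum_(1 <= j < J.+1) (Num.sqrt j%:R)^-1 <= 2 * Num.sqrt J%:R :> R.
Proof.
elim: J => [|J IH]; first by rewrite big_geq// sqrtr0 mulr0.
rewrite big_nat_recr//=.
set a := Num.sqrt J%:R in IH *; set b : R := Num.sqrt J.+1%:R.
have a0 : 0 <= a by exact: sqrtr_ge0.
have b0 : 0 < b by rewrite sqrtr_gt0 ltr0n.
have ab : a ^+ 2 + 1 = b ^+ 2 by rewrite !sqr_sqrtr ?ler0n// -natr1.
suff : b^-1 <= 2 * b - 2 * a by lra.
rewrite -[leLHS]mul1r ler_pdivrMr//.
(* Since b^2 - a^2 = 1, the claim 1 <= 2 b^2 - 2 a b is exactly (b - a)^2 >= 0. *)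
have := sqr_ge0 (b - a).
nra.
Qed.

End PotterSequence.

(** * The local bound for convolution powers *)

Section LocalBound.
Variable R : realType.
Implicit Types (q : nat -> R).

Definition ptail q n := 1 - \sum_(j < n.+1) q j.

Definition is_pmf q := (forall j, 0 <= q j) /\ series q n @[n --> \oo] --> (1 : R).

Lemma ptail_series q n : ptail q n = 1 - series q n.+1.
Proof. by rewrite /ptail /series /= big_mkord. Qed.

Lemma ptail_ge0 q n : is_pmf q -> 0 <= ptail q n.
Proof.
move=> [q0 qs]; rewrite ptail_series subr_ge0.
rewrite -(cvg_lim (@Rhausdorff R) qs); apply: nondecreasing_cvgn_le.
  by apply/nondecreasing_seqP => i; rewrite seriesSr lerDl.
by apply/cvg_ex; exists 1.
Qed.

Lemma ptail_sub q n m : (n <= m)%N -> ptail q n - ptail q m = \sum_(n.+1 <= j < m.+1) q j.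
Proof.
move=> nm; rewrite /ptail -!(big_mkord xpredT q) (@big_cat_nat _ _ _ n.+1 0 m.+1)//=.
by ring.
Qed.

Lemma ptail_le q n m : is_pmf q -> (n <= m)%N -> ptail q m <= ptail q n.
Proof.
move=> [q0 _] nm; rewrite -subr_ge0 ptail_sub//.
by apply: sumr_ge0 => j _.
Qed.

Lemma ptail_le1 q n : is_pmf q -> ptail q n <= 1.
Proof. by move=> [q0 _]; rewrite /ptail lerBlDr lerDl; apply: sumr_ge0. Qed.

Lemma ptail_cvg0 q : is_pmf q -> ptail q n @[n --> \oo] --> (0 : R).
Proof.
move=> [_ qs].
have -> : ptail q = (fun n => 1 - series q n.+1) by apply/funext => n; exact: ptail_series.
rewrite -[X in _ --> X](subrr 1); apply: cvgB; first exact: cvg_cst.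
by rewrite (cvg_shiftS (series q)).
Qed.

Lemma ptail_gt0 q n : is_pmf q -> (\forall m \near \oo, 0 < q m) -> 0 < ptail q n.
Proof.
move=> qp [N _ HN]; have [q0 _] := qp.
pose m := maxn N n.+1.
have nm : (n <= m)%N by apply: leq_trans (leq_maxr _ _).
have : 0 < ptail q n - ptail q m.
  rewrite ptail_sub// big_nat_recr/= ?leq_maxr//.
  apply: ltr_wpDl; first by apply: sumr_ge0.
  by apply: HN; rewrite /= leq_maxl.
by have := ptail_ge0 m qp; lra.
Qed.

(** The left side is the probability that none of k parts exceeds n; it is the origin of the
    exponential factors in the local bounds. *)
Lemma sum_pmf_exp q k n : is_pmf q -> (\sum_(j < n.+1) q j) ^+ k <= expR (- (k%:R * ptail q n)).
Proof.
move=> qp; have [q0 _] := qp.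
rewrite (_ : - (k%:R * ptail q n) = k%:R * (- ptail q n)); last by ring.
rewrite expRM_natl.
have -> : \sum_(j < n.+1) q j = 1 - ptail q n by rewrite /ptail; ring.
have := expR_ge1Dx (- ptail q n) => h.
by apply: lerXn2r => //; rewrite nnegrE ?expR_ge0//; have := ptail_le1 n qp; lra.
Qed.

Lemma conv_pow_le_exp q k m n : is_pmf q -> (m <= n)%N ->
  conv_pow q k m <= expR (- (k%:R * ptail q n)).
Proof.
move=> qp mn; have [q0 _] := qp.
apply: le_trans (sum_pmf_exp k n qp); apply: le_trans (sum_conv_pow k n q0).
rewrite (bigD1 (Ordinal (mn : (m < n.+1)%N)))//= lerDl.
by apply: sumr_ge0 => j _; exact: conv_pow_ge0.
Qed.

Lemma sum_harmonic_ge n s : (0 < n)%N ->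
  s%:R / 2 <= \sum_(n.+1 <= j < (2 ^ s * n).+1) j%:R^-1 :> R.
Proof.
move=> n0; elim: s => [|s IH]; first by rewrite mul1n big_geq// mul0r.
have h1 : (n.+1 <= (2 ^ s * n).+1)%N by rewrite ltnS leq_pmull// expn_gt0.
have h2 : ((2 ^ s * n).+1 <= (2 ^ s.+1 * n).+1)%N.
  by rewrite ltnS leq_mul// leq_exp2l.
rewrite (big_cat_nat h1 h2)/= -natr1 mulrDl; apply: lerD => //.
have M0 : (0 < 2 ^ s.+1 * n)%N by rewrite muln_gt0 expn_gt0.
apply: (@le_trans _ _ (\sum_((2 ^ s * n).+1 <= j < (2 ^ s.+1 * n).+1) (2 ^ s.+1 * n)%:R^-1)).
  rewrite sumr_const_nat subSS expnS -mulnA mul2n -addnn addnK.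
  have : 0 < ((2 ^ s * n)%:R : R) by rewrite ltr0n muln_gt0 expn_gt0.
  move: (2 ^ s * n)%N => a a0.
  have -> : (a + a)%:R^-1 *+ a = a%:R / (a%:R + a%:R) :> R by rewrite mulr_natl natrD.
  by rewrite ler_pdivlMr; lra.
rewrite !big_nat; apply: ler_sum => j /andP[j1 j2].
rewrite lef_pV2 ?posrE ?ltr0n ?ler_nat//.
exact: leq_ltn_trans j1.
Qed.

Lemma expR_half_le2 : expR (1 / 2 : R) <= 2.
Proof.
have := expR_ge1Dx (- (1 / 2) : R); rewrite expRN.
have e0 := expR_gt0 (1 / 2 : R).
rewrite -[X in _ <= X]mul1r ler_pdivlMr//; lra.
Qed.

(** Half of the exponent pays for the polynomial: with E = exp (y / 2) one has y <= 2 E and y^2 <=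
    16 E, whence the constants 4 and 256. *)
Lemma quad_exp_bound (C x y : R) : 1 <= C -> 0 < x -> x <= y ->
  C * x * (2 + 16 * C * x) * expR (- y) <= C * (4 + 256 * C) * expR (- (y / 2)).
Proof.
move=> C1 x0 xy; set E := expR (y / 2).
have E0 : 0 < E by exact: expR_gt0.
have Ey : expR (- (y / 2)) = E^-1 by rewrite expRN.
have Ey2 : expR (- y) = E^-1 * E^-1.
  by rewrite -!expRN -expRD; congr expR; field.
have yE1 : y <= 2 * E by have := expR_ge1Dx (y / 2); rewrite -/E; lra.
have y0 : 0 < y by apply: lt_le_trans xy.
have yE4 : y ^+ 2 <= 16 * E.
  have -> : E = expR (y / 4) ^+ 2 by rewrite /E -expRM_natl; congr expR; field.
  have -> : 16 * expR (y / 4) ^+ 2 = (4 * expR (y / 4)) ^+ 2 by ring.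
  have := expR_ge1Dx (y / 4) => h.
  by apply: lerXn2r; rewrite ?nnegrE; lra.
rewrite Ey Ey2 mulrA; apply: ler_wpM2r; first by rewrite invr_ge0 ltW.
rewrite ler_pdivrMr//.
have x2 : x ^+ 2 <= y ^+ 2 by apply: lerXn2r; rewrite ?nnegrE; lra.
have -> : C * x * (2 + 16 * C * x) = C * (2 * x + 16 * C * x ^+ 2) by ring.
rewrite -[leRHS]mulrA ler_pM2l; last lra.
have : 16 * C * x ^+ 2 <= 16 * C * (16 * E) by apply: ler_wpM2l; lra.
lra.
Qed.

Section Local.
Variable q : nat -> R.
Hypothesis qp : is_pmf q.
Local Notation l := (fun j : nat => j%:R * q j).
Hypothesis pl : potter_seq l.

Let q0 j : 0 <= q j. Proof. by case: qp. Qed.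

Lemma pmf_near_gt0 : \forall n \near \oo, 0 < q n.
Proof.
have [N N0 HN] := pl ltr01; exists N => // n /= Nn.
have [+ _ _] := HN n n Nn (leqnn n).
by rewrite pmulr_rgt0// ltr0n (leq_trans N0).
Qed.

Lemma pmf_tail_gt0 n : 0 < ptail q n.
Proof. exact: ptail_gt0 pmf_near_gt0. Qed.

(** Over s dyadic blocks above n, j q_j stays at least n q_n / 4 while the sum of 1 / j is at least
    s / 2. The tail is therefore at least s / 8 times n q_n, and s is arbitrary. *)
Lemma pmf_small_tail (e : R) : 0 < e -> \forall n \near \oo, n%:R * q n <= e * ptail q n.
Proof.
move=> e0.
pose s := (Num.truncn (8 / e)).+1.
have s0 : 0 < (s%:R : R) by rewrite ltr0n.
have se : 8 / e <= s%:R by apply/ltW/truncnS_gt.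
have es0 : 0 < (s%:R : R)^-1 by rewrite invr_gt0.
have es1 : (s%:R : R)^-1 <= 1 by rewrite invf_le1// ler1n.
(* The exponent 1 / s is matched to the s blocks: (j / n)^(1/s) <= 2 for every j up to 2^s n. *)
have [N N0 HN] := pl es0.
exists N => // n /= Nn.
have n0 : (0 < n)%N by apply: leq_trans Nn.
have nS : (n <= 2 ^ s * n)%N by rewrite leq_pmull// expn_gt0.
have key j : (n < j)%N -> (j <= 2 ^ s * n)%N -> (n%:R * q n / 4) * j%:R^-1 <= q j.
  move=> nj js; have j0 : 0 < (j%:R : R) by rewrite ltr0n (leq_ltn_trans _ nj).
  rewrite ler_pdivrMr// mulrC.
  have [ln h _] := HN n j Nn (ltnW nj).
  have p2 : (j%:R / n%:R : R) `^ s%:R^-1 <= 2.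
    apply: (@le_trans _ _ ((2 ^+ s) `^ s%:R^-1)).
      apply: (ge0_ler_powR (ltW es0)); rewrite ?nnegrE; [exact: divr_ge0|exact: exprn_ge0|].
      by rewrite ler_pdivrMr ?ltr0n// -natrX -natrM ler_nat.
    by rewrite -powR_mulrn// -powRrM divff ?gt_eqF// powRr1.
  rewrite [q j * _]mulrC.
  have p0 : 0 <= (j%:R / n%:R : R) `^ s%:R^-1 by exact: powR_ge0.
  have b0 : 0 <= j%:R * q j by rewrite mulr_ge0.
  have : (1 + s%:R^-1) * (j%:R / n%:R) `^ s%:R^-1 * (j%:R * q j) <= 4 * (j%:R * q j).
    by apply: ler_wpM2r => //; nra.
  lra.
have tl : \sum_(n.+1 <= j < (2 ^ s * n).+1) q j <= ptail q n.
  by rewrite -ptail_sub// lerBlDr lerDl ptail_ge0.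
have : (n%:R * q n / 4) * (s%:R / 2) <= ptail q n.
  apply: le_trans tl.
  apply: (@le_trans _ _ (\sum_(n.+1 <= j < (2 ^ s * n).+1) (n%:R * q n / 4) * j%:R^-1)).
    rewrite -big_distrr /=; apply: ler_wpM2l; last exact: sum_harmonic_ge.
    by rewrite divr_ge0 ?mulr_ge0.
  by rewrite !big_nat; apply: ler_sum => j /andP[j1 j2]; exact: key.
set a := n%:R * q n; set t := ptail q n => h.
have a0 : 0 <= a by rewrite mulr_ge0.
have : 8 <= s%:R * e by rewrite -ler_pdivrMr.
have : 0 <= t by exact: ptail_ge0.
nra.
Qed.

(** Writing the cut as s^2 m makes the square-root Potter bound linear in s on both sides: the
    weights above the cut cost 1 / s, the mass below it gains s. *)
Lemma pmf_sum_id : exists C : R, 1 <= C /\ exists2 N : nat, (0 < N)%N & forall m, (N <= m)%N ->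
  [/\ 0 < q m,
   forall j, (j <= m)%N -> forall s : R, 0 < s -> s ^+ 2 * m%:R <= j%:R -> l j <= C / s * l m &
   forall s : R, 0 < s -> \sum_(j < m.+1 | (j%:R : R) <= s ^+ 2 * m%:R) l j <= 2 * C * s * m%:R * l m].
Proof.
have [C [C1 [N N0 HN]]] := potter_seq_sqrt (fun n => mulr_ge0 (ler0n R n) (q0 n)) pl.
exists C; split => //; exists N => // m Nm.
have m0 : (0 < m)%N by apply: leq_trans Nm.
have m0' : 0 < (m%:R : R) by rewrite ltr0n.
have [lm _] := HN m m Nm (ltac:(by rewrite m0 /=)).
have qm : 0 < q m by move: lm; rewrite pmulr_rgt0.
split => //.
  move=> j jm s s0 sj.
  have j0 : 0 < (j%:R : R) by apply: lt_le_trans sj; rewrite mulr_gt0// exprn_gt0.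
  have [_ h] := HN m j Nm (ltac:(by rewrite jm andbT -(ltr0n R))).
  apply: (le_trans h); apply: ler_wpM2r; first exact: ltW.
  apply: ler_wpM2l; first lra.
  have -> : s^-1 = Num.sqrt (s^-1 ^+ 2) by rewrite sqrtr_sqr ger0_norm// invr_ge0 ltW.
  apply: ler_wsqrtr; rewrite ler_pdivrMr// exprVn mulrC ler_pdivlMr ?exprn_gt0//.
  by rewrite mulrC.
move=> s s0.
pose J := Num.truncn (s ^+ 2 * m%:R).
have sm0 : 0 <= s ^+ 2 * m%:R by rewrite mulr_ge0 ?sqr_ge0.
have Jle : J%:R <= s ^+ 2 * m%:R by rewrite truncn_le.
pose K := minn J m.
apply: (@le_trans _ _ (\sum_(1 <= j < K.+1) C * Num.sqrt (m%:R / j%:R) * l m)).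
  rewrite -(big_mkord (fun j => (j%:R : R) <= s ^+ 2 * m%:R) l) big_ltn_cond//=.
  rewrite mul0r add0r if_same.
  have Km : (K.+1 <= m.+1)%N by rewrite ltnS geq_minr.
  rewrite (@big_cat_nat _ _ _ K.+1 1 m.+1)//= [X in _ + X]big_nat_cond [X in _ + X]big_pred0 ?addr0.
    rewrite big_nat_cond [leRHS]big_nat big_mkcondr /=.
    apply: ler_sum => j /andP[j1 jK].
    have jm : (j <= m)%N by apply: leq_trans (ltnSE jK) (geq_minr _ _).
    have [_ h] := HN m j Nm (ltac:(by rewrite j1 jm)).
    case: ifP => // _; rewrite !mulr_ge0 ?sqrtr_ge0//; lra.
  move=> j; apply/negP => /andP[/andP[Kj jm]] h.
  have : (j <= K)%N by rewrite leq_min -[(j <= m)%N]ltnS jm andbT truncn_ge_nat.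
  by rewrite leqNgt Kj.
have -> : \sum_(1 <= j < K.+1) C * Num.sqrt (m%:R / j%:R) * l m =
    C * Num.sqrt m%:R * l m * \sum_(1 <= j < K.+1) (Num.sqrt j%:R)^-1.
  rewrite big_distrr /=; apply: eq_bigr => j _.
  by rewrite sqrtrM ?ler0n// sqrtrV ?ler0n//; ring.
apply: (@le_trans _ _ (C * Num.sqrt m%:R * l m * (2 * (s * Num.sqrt m%:R)))).
  apply: ler_wpM2l; first by rewrite !mulr_ge0 ?sqrtr_ge0//; lra.
  apply: (le_trans (sum_inv_sqrt R K)); apply: ler_wpM2l => //.
  have -> : s * Num.sqrt m%:R = Num.sqrt (s ^+ 2 * m%:R).
    by rewrite sqrtrM ?sqr_ge0// sqrtr_sqr ger0_norm// ltW.
  apply: ler_wsqrtr; apply: le_trans Jle; rewrite ler_nat; exact: geq_minl.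
rewrite (_ : _ * (2 * _) = 2 * C * s * (Num.sqrt m%:R * Num.sqrt m%:R) * l m); last by ring.
by rewrite -expr2 sqr_sqrtr ?ler0n.
Qed.

(* Induction on [k] through the size bias identity, splitting the size-biased part at [s^2 m], where
   [s] is inversely proportional to [(k + 1) m q_m]. *)
Lemma conv_pow_local_bound : exists2 C : R, 0 < C & forall k m,
  m%:R * conv_pow q k m <= C * expR (- (k%:R * ptail q m / 2)).
Proof.
have [C1 [C11 [N1 N10 HN1]]] := pmf_sum_id.
have [N2 _ HN2] := pmf_small_tail ltr01.
pose N := maxn N1 N2.
pose C3 := C1 * (4 + 256 * C1) * 4.
have C30 : 0 < C3 by rewrite /C3; nra.
(* The term [N] covers m < N. For larger m the parts below the cut return at most C / 2 from the
   induction hypothesis and those above it at most [C3], so C >= 2 C3 closes the induction. *)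
pose C := N%:R + 2 * C3.
have NN0 : 0 <= (N%:R : R) by exact: ler0n.
have C0 : 0 < C by rewrite /C; lra.
exists C => // k; elim: k => [|k IH] m.
  case: m => [|m]; last by rewrite conv_pow0// mulr0 mulr_ge0 ?expR_ge0// ltW.
  by rewrite mul0r mulr_ge0 ?expR_ge0// ltW.
set T := ptail q m.
have T0 : 0 <= T by exact: ptail_ge0.
have T1 : T <= 1 by exact: ptail_le1.
case: (ltnP m N) => Nm.
  apply: (@le_trans _ _ (N%:R * expR (- (k.+1%:R * T)))).
    apply: ler_pM; rewrite ?ler0n ?conv_pow_ge0 ?ler_nat//; first exact: ltnW.
    exact: conv_pow_le_exp.
  apply: ler_pM; rewrite ?ler0n ?expR_ge0//; first by rewrite /C; lra.
  rewrite ler_expR lerN2 ler_pdivrMr//.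
  have : 0 <= k.+1%:R * T by rewrite mulr_ge0.
  lra.
have N1m : (N1 <= m)%N by apply: leq_trans Nm; exact: leq_maxl.
have m0 : 0 < (m%:R : R) by rewrite ltr0n (leq_trans N10).
have [qm Hj Hs] := HN1 m N1m.
have lmT : l m <= T by have := HN2 m (leq_trans (leq_maxr _ _) Nm); rewrite /= mul1r.
have lm0 : 0 < l m by rewrite mulr_gt0.
pose x := k.+1%:R * l m.
pose y := k.+1%:R * T.
have k0 : 0 < (k.+1%:R : R) by rewrite ltr0n.
have x0 : 0 < x by rewrite mulr_gt0.
have xy : x <= y by rewrite ler_pM2l.
have D0 : 0 < 2 + 16 * C1 * x by nra.
(* The 2 gives s <= 1 / 2, hence m - i >= m / 2 below the cut; the other term gives 16 C1 x s <= 1,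
   which makes the recursion a contraction. *)
pose s := (2 + 16 * C1 * x)^-1.
have s0 : 0 < s by rewrite invr_gt0.
have s12 : s <= 1 / 2.
  by rewrite /s mul1r lef_pV2 ?posrE//; nra.
have xs : 16 * C1 * x * s <= 1 by rewrite /s ler_pdivrMr//; lra.
rewrite conv_pow_size_bias.
rewrite (bigID (fun j : 'I_m.+1 => (j%:R : R) <= s ^+ 2 * m%:R))/= mulrDr.
have yE : expR (- (k%:R * T)) = expR T * expR (- y).
  by rewrite -expRD; congr expR; rewrite /y -natr1; ring.
have yE2 : expR (- (k%:R * T / 2)) = expR (T / 2) * expR (- (y / 2)).
  by rewrite -expRD; congr expR; rewrite /y -natr1; field.
have eT2 : expR (T / 2) <= 2 by apply: le_trans expR_half_le2; rewrite ler_expR; lra.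
have eT : expR T <= 4.
  have -> : expR T = expR (T / 2) * expR (T / 2) by rewrite -expRD; congr expR; field.
  have := expR_gt0 (T / 2); nra.
have B1 : k.+1%:R * \sum_(i < m.+1 | (i%:R : R) <= s ^+ 2 * m%:R) i%:R * q i * conv_pow q k (m - i)
   <= C / 2 * expR (- (y / 2)).
  apply: (@le_trans _ _ (k.+1%:R * ((2 * C1 * s * m%:R * l m) * (2 * C / m%:R * expR (- (k%:R * T / 2)))))).
    apply: ler_wpM2l; first exact: ltW.
    apply: (@le_trans _ _ ((\sum_(i < m.+1 | (i%:R : R) <= s ^+ 2 * m%:R) i%:R * q i) *
       (2 * C / m%:R * expR (- (k%:R * T / 2))))); last first.
      apply: ler_wpM2r; last exact: Hs.
      by rewrite mulr_ge0 ?expR_ge0// divr_ge0 ?mulr_ge0//; exact: ltW.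
    rewrite big_distrl /=; apply: ler_sum => i hi.
    apply: ler_wpM2l; first by rewrite mulr_ge0.
    have im : (i <= m)%N by rewrite -ltnS.
    have mi : (m - i)%:R = m%:R - i%:R :> R by rewrite natrB.
    have mi2 : m%:R / 2 <= (m - i)%:R :> R.
      rewrite mi; suff : s ^+ 2 * m%:R <= 1 / 2 * m%:R by lra.
      by rewrite ler_pM2r//; nra.
    have mi0 : 0 < ((m - i)%:R : R) by lra.
    have e0 : 0 < expR (- (k%:R * T / 2)) by exact: expR_gt0.
    have : (m - i)%:R * conv_pow q k (m - i) <= C * expR (- (k%:R * T / 2)).
      apply: (le_trans (IH _)); rewrite ler_pM2l// ler_expR lerN2 ler_pM2r ?invr_gt0//.
      by apply: ler_wpM2l => //; apply: ptail_le => //; exact: leq_subr.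
    rewrite mulrC -ler_pdivlMr// => h; apply: (le_trans h).
    rewrite (_ : 2 * C / m%:R * _ = C * expR (- (k%:R * T / 2)) * (2 / m%:R)); last by ring.
    apply: ler_wpM2l; first by rewrite mulr_ge0 // ltW.
    rewrite -[leRHS]invf_div lef_pV2 ?posrE//; lra.
  rewrite (_ : k.+1%:R * _ = (4 * C1 * x * s * C) * expR (- (k%:R * T / 2))); last first.
    by rewrite /x; field; rewrite gt_eqF.
  rewrite yE2 mulrA; apply: ler_wpM2r; first exact: expR_ge0.
  have h4 : 4 * C1 * x * s * C <= C / 4.
    rewrite (_ : 4 * C1 * x * s * C = (16 * C1 * x * s) * (C / 4)); last by field.
    by rewrite ger_pMl//; lra.
  have : 0 < expR (T / 2) by exact: expR_gt0.
  nra.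
have B2 : k.+1%:R * \sum_(i < m.+1 | ~~ ((i%:R : R) <= s ^+ 2 * m%:R)) i%:R * q i * conv_pow q k (m - i)
   <= C3 * expR (- (y / 2)).
  apply: (@le_trans _ _ (k.+1%:R * (C1 / s * l m * expR (- (k%:R * T))))).
    apply: ler_wpM2l; first exact: ltW.
    apply: (@le_trans _ _ (\sum_(i < m.+1) C1 / s * l m * conv_pow q k (m - i))).
      rewrite big_mkcond /=; apply: ler_sum => i _; case: ifPn => hi; last first.
        by rewrite !mulr_ge0 ?conv_pow_ge0// ?invr_ge0; lra.
      apply: ler_wpM2r; first exact: conv_pow_ge0.
      apply: Hj => //; first by rewrite -ltnS.
      by apply/ltW; rewrite ltNge.
    rewrite -big_distrr /=; apply: ler_wpM2l.
      by rewrite !mulr_ge0// ?invr_ge0; lra.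
    apply: le_trans (sum_pmf_exp k m qp); apply: le_trans (sum_conv_pow k m q0).
    rewrite (reindex_inj rev_ord_inj) /=.
    by under eq_bigr => i _ do rewrite subSS (subKn (leq_ord i)).
  rewrite yE (_ : k.+1%:R * _ = C1 * x * (2 + 16 * C1 * x) * expR T * expR (- y)); last first.
    by rewrite /s invrK /x; ring.
  rewrite -mulrA [expR T * _]mulrC mulrA.
  apply: (@le_trans _ _ (C1 * (4 + 256 * C1) * expR (- (y / 2)) * 4)); last first.
    by rewrite le_eqVlt; apply/orP; left; apply/eqP; rewrite /C3; ring.
  apply: ler_pM => //; rewrite ?expR_ge0//.
    by rewrite !mulr_ge0 ?expR_ge0//; lra.
  exact: quad_exp_bound.
apply: (le_trans (lerD B1 B2)); rewrite -mulrDl -/T -/y.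
rewrite -[X in expR (- X)]/(y / 2); apply: ler_wpM2r; first exact: expR_ge0.
rewrite /C; lra.
Qed.

End Local.
End LocalBound.

(** * Riemann sums of Gamma integrals *)

Section StepIntegral.
Variable R : realType.
Local Notation mu := (@lebesgue_measure R).

Lemma bigcup_steps (lam : R) : 0 < lam ->
  \bigcup_(k : nat) `[k%:R * lam, k.+1%:R * lam[%classic = `[0, +oo[%classic.
Proof.
move=> l0; apply/seteqP; split => z /=.
  move=> [k _] /=; rewrite !in_itv /= andbT => /andP[h _]; apply: le_trans h.
  by rewrite mulr_ge0// ltW.
rewrite in_itv /= andbT => z0; exists (Num.truncn (z / lam)) => //=.
have zl : 0 <= z / lam by rewrite divr_ge0// ltW.
have := truncn_itv zl; rewrite in_itv /= => /andP[a b].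
by rewrite -ler_pdivlMr// a /= -ltr_pdivrMr.
Qed.

Lemma truncn_step (lam z : R) k : 0 < lam -> `[k%:R * lam, k.+1%:R * lam[%classic z ->
  Num.truncn (z / lam) = k.
Proof.
move=> l0 /=; rewrite in_itv /= => /andP[a b]; apply: truncn_def.
by rewrite ler_pdivlMr// a ltr_pdivrMr.
Qed.

Lemma measurable_step (h : nat -> R) (lam : R) : 0 < lam ->
  measurable_fun (`[0%R, +oo[ : set R) (fun z : R => h (Num.truncn (z / lam))).
Proof.
move=> l0; rewrite -(bigcup_steps l0); apply/measurable_fun_bigcup => //= k.
apply: (eq_measurable_fun (cst (h k))) => // z /set_mem zk.
by rewrite (truncn_step l0 zk).
Qed.

Lemma emeasurable_step (h : nat -> R) (lam : R) : 0 < lam ->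
  measurable_fun (`]0%R, +oo[ : set R) (fun z : R => (h (Num.truncn (z / lam)))%:E).
Proof.
move=> l0; apply/measurable_EFinP; apply: measurable_funS (measurable_step h l0) => //.
by move=> z /=; rewrite !in_itv /= !andbT; exact: ltW.
Qed.

Lemma integral_step (h : nat -> R) (lam : R) : 0 < lam -> (forall k, 0 <= h k) ->
  (\int[mu]_(z in `]0%R, +oo[) (h (Num.truncn (z / lam)))%:E =
   lam%:E * \sum_(k <oo) (h k)%:E)%E.
Proof.
move=> l0 h0.
have ms := measurable_step h l0.
rewrite integral_itv_obnd_cbnd; last exact: emeasurable_step.
rewrite -(bigcup_steps l0) ge0_integral_bigcup//; last 3 first.
- by rewrite (bigcup_steps l0); apply/measurable_EFinP.
- by move=> z _; rewrite lee_fin.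
- move=> i j _ _ [z [zi zj]].
  by rewrite -(truncn_step l0 zi) -(truncn_step l0 zj).
rewrite -nneseriesZl//; last by move=> i _; rewrite lee_fin.
apply: eq_eseriesr => k _.
rewrite (eq_integral (cst (h k)%:E)); last first.
  by move=> z /set_mem zk /=; rewrite (truncn_step l0 zk).
rewrite integral_cst//= lebesgue_measure_itv /= lte_fin.
have -> : (k%:R * lam < k.+1%:R * lam) by rewrite ltr_pM2r// ltr_nat.
by rewrite -EFinB muleC; congr (_%:E * _)%E; rewrite -natr1; ring.
Qed.

Lemma is_derive_continuous (f : R -> R) (z d : R) :
  is_derive z 1 f d -> {for z, continuous f}.
Proof.
move=> h; apply: (@differentiable_continuous R R R); apply/derivable1_diffP.
exact: ex_derive.
Qed.

Lemma cvg_powR (x : nat -> R) (z a : R) : 0 < z -> x n @[n --> \oo] --> z ->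
  x n `^ a @[n --> \oo] --> z `^ a.
Proof.
move=> z0 xz; apply: (@cvg_comp _ _ _ x (fun y : R => y `^ a) \oo (nbhs z) _ xz).
exact: is_derive_continuous (is_derive1_powR a z0).
Qed.

(** Scaling y by d + 1 and using ln t <= t - 1 <= t gives d ln (y / (d + 1)) <= y; scaling by d + 1
    instead of d also covers d = 0. *)
Lemma powR_le_expR (d : R) : 0 <= d -> exists2 C : R, 0 < C & forall y : R, 0 < y ->
  y `^ d <= C * expR y.
Proof.
move=> d0; exists ((d + 1) `^ d); first by rewrite powR_gt0//; lra.
move=> y y0.
have c0 : 0 < d + 1 by lra.
have -> : y `^ d = (d + 1) `^ d * (y / (d + 1)) `^ d.
  by rewrite -powRM ?divr_ge0 ?ltW//; congr powR; field; rewrite gt_eqF.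
rewrite ler_pM2l ?powR_gt0//.
have y1 : 0 < y / (d + 1) by rewrite divr_gt0.
rewrite /powR gt_eqF// ler_expR.
have : ln (1 + (y / (d + 1) - 1)) <= y / (d + 1) - 1 by apply: le_ln1Dx; lra.
rewrite subrKC => h.
apply: (@le_trans _ _ (d * (y / (d + 1)))).
  by apply: ler_wpM2l => //; lra.
rewrite mulrCA -[leRHS]mulr1; apply: ler_wpM2l; first exact: ltW.
by rewrite ler_pdivrMr//; lra.
Qed.

Lemma powR_expR_compare (a b t : R) : a <= b -> 0 < t -> exists2 C : R, 0 < C &
  forall y : R, 0 < y -> y `^ b <= C * (y `^ a * expR (t * y)).
Proof.
move=> ab t0; have [C C0 HC] := powR_le_expR (ltac:(by rewrite subr_ge0; exact: ab) : 0 <= b - a).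
exists (C * (t `^ (b - a))^-1); first by rewrite mulr_gt0// invr_gt0 powR_gt0.
move=> y y0.
have h := HC (t * y) (mulr_gt0 t0 y0).
have -> : y `^ b = y `^ a * (t `^ (b - a))^-1 * (t * y) `^ (b - a).
  have p0 : t `^ (b - a) != 0 by rewrite gt_eqF// powR_gt0.
  rewrite powRM ?ltW// -mulrA [_^-1 * _]mulrA mulVf// mul1r -powRD; last first.
    by rewrite (gt_eqF y0) implybT.
  by congr powR; ring.
apply: (@le_trans _ _ (y `^ a * (t `^ (b - a))^-1 * (C * expR (t * y)))).
  by apply: ler_wpM2l => //; rewrite mulr_ge0 ?invr_ge0 ?powR_ge0.
by rewrite le_eqVlt; apply/orP; left; apply/eqP; ring.
Qed.

(** The integrand may blow up at 0, so the fundamental theorem of calculus is applied on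
    [1 / (i + 1), 1] and the bound passes to the increasing union. *)
Lemma integral_powR_01 (a : R) : -1 < a ->
  (\int[mu]_(z in `]0%R, 1%R]) (z `^ a)%:E <= (1 / (a + 1))%:E)%E.
Proof.
move=> a1; pose F (i : nat) : set R := `[i.+1%:R^-1, 1%R]%classic.
have FU : \bigcup_i F i = `]0, 1]%classic.
  apply/seteqP; split => z /=.
    move=> [i _]; rewrite /F /= !in_itv /= => /andP[h ->].
    by rewrite andbT; apply: lt_le_trans h; rewrite invr_gt0.
  rewrite in_itv /= => /andP[z0 z1]; exists (Num.truncn z^-1) => //.
  rewrite /F /= in_itv /= z1 andbT invf_ple ?posrE//.
  exact/ltW/truncnS_gt.
have mp : measurable_fun setT (fun z : R => (z `^ a)%:E).
  by apply/measurable_EFinP; exact: measurable_powR.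
have cv : (\int[mu]_(z in F i) (z `^ a)%:E)%E @[i --> \oo] -->
   (\int[mu]_(z in `]0%R, 1%R]) (z `^ a)%:E)%E.
  rewrite -FU; apply: ge0_nondecreasing_set_cvg_integral => //.
  - apply/nondecreasing_seqP => i; apply/subsetPset => z; rewrite /F /= !in_itv /=.
    move=> /andP[h ->]; rewrite andbT; apply: le_trans h.
    by rewrite lef_pV2 ?posrE// ler_nat.
  - by move=> i; exact: measurable_itv.
  - by move=> i; apply: measurable_funS mp.
  - by move=> i z _; rewrite lee_fin powR_ge0.
apply: (cvge_to_le cv); apply: nearW => i.
have a10 : 0 < a + 1 by lra.
case: i => [|i].
  rewrite /F invr1 set_itv1 integral_set1 lee_fin divr_ge0//; lra.
have i1 : i.+2%:R^-1 < 1 :> R by rewrite invf_lt1// ltr1n.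
pose G (z : R) : R := (a + 1)^-1 * z `^ (a + 1).
have dG (z : R) : 0 < z -> is_derive z 1 G (z `^ a).
  move=> z0; have d := is_derive1_powR (a + 1) z0.
  rewrite /G; apply: is_derive_eq.
  rewrite addrK /GRing.scale /= mulrA mulVf ?gt_eqF// mul1r.
  by [].
have zpos (z : R) : i.+2%:R^-1 <= z -> 0 < z.
  by move=> h; apply: lt_le_trans h; rewrite invr_gt0.
rewrite /F (@continuous_FTC2 R _ G)//.
- rewrite -EFinB lee_fin /G powR1 mulr1 div1r lerBlDr lerDl.
  by rewrite mulr_ge0 ?powR_ge0// invr_ge0 ltW.
- apply: continuous_in_subspaceT => z; rewrite inE /= in_itv /= => /andP[/zpos z0 _].
  exact: is_derive_continuous (is_derive1_powR a z0).
- split.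
  + by move=> z; rewrite in_itv /= => /andP[/ltW/zpos/dG h _]; exact: ex_derive.
  + apply: cvg_at_right_filter; exact: is_derive_continuous (dG _ (zpos _ (lexx _))).
  + apply: cvg_at_left_filter; exact: is_derive_continuous (dG _ (zpos _ (ltW i1))).
- move=> z; rewrite in_itv /= => /andP[/ltW/zpos/dG h _].
  by rewrite derive1E; exact: derive_val.
Qed.

(** Near 0 the power dominates; beyond 1 the power is at most 1 because a <= 0, and what remains is
    a multiple of the exponential density. *)
Lemma integrable_powR_expR (a t : R) : -1 < a -> a <= 0 -> 0 < t ->
  mu.-integrable `]0, +oo[ (fun z : R => (z `^ a * expR (- (t * z)))%:E).
Proof.
move=> a1 a0 t0; have mf : measurable_fun setT (fun z : R => z `^ a * expR (- (t * z))).
  apply: measurable_funM; first exact: measurable_powR.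
  by apply: measurableT_comp => //; apply: measurableT_comp => //.
apply/integrableP; split; first by apply/measurable_EFinP; apply: measurable_funS mf.
have f0 (z : R) : 0 <= z `^ a * expR (- (t * z)) by rewrite mulr_ge0 ?powR_ge0 ?expR_ge0.
under eq_integral => z _ do rewrite gee0_abs ?lee_fin//.
have -> : `]0%R, +oo[%classic = `]0%R, 1%R]%classic `|` `]1%R, +oo[%classic :> set R.
  by rewrite (@itv_bndbnd_setU _ _ _ (BRight (1%R : R)))// bnd_simp.
rewrite ge0_integral_setU//; last 3 first.
- by apply/measurable_EFinP; apply: measurable_funS mf.
- by move=> z _; rewrite lee_fin.
- apply/disj_setPS => z [/=]; rewrite !in_itv /= andbT => /andP[_ h1] h2; lra.
apply: lte_add_pinfty.
  apply: (@le_lt_trans _ _ (\int[mu]_(z in `]0%R, 1%R]) (z `^ a)%:E)%E); last first.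
    by apply: (le_lt_trans (integral_powR_01 a1)); rewrite ltry.
  apply: ge0_le_integral => //.
  - by move=> z _; rewrite lee_fin.
  - by apply/measurable_EFinP; apply: measurable_funS mf.
  - by apply/measurable_EFinP; apply: measurable_funTS; exact: measurable_powR.
  - move=> z /=; rewrite in_itv /= => /andP[z0 _]; rewrite lee_fin.
    apply: ler_piMr; first exact: powR_ge0.
    by rewrite -expR0 ler_expR lerNl oppr0 mulr_ge0// ltW.
apply: (@le_lt_trans _ _ (\int[mu]_(z in `]1%R, +oo[) (t^-1 * exponential_pdf t z)%:E)%E).
  apply: ge0_le_integral => //.
  - by move=> z _; rewrite lee_fin.
  - by apply/measurable_EFinP; apply: measurable_funS mf.
  - apply/measurable_EFinP; apply: measurable_funTS; apply: measurable_funM => //.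
    exact: measurable_exponential_pdf.
  - move=> z /=; rewrite in_itv /= andbT => z1; rewrite lee_fin.
    rewrite /exponential_pdf patchE mem_set /=; last by rewrite in_itv /= andbT; lra.
    rewrite mulrA mulVf ?gt_eqF// mul1r mulNr; apply: ler_piMl; first exact: expR_ge0.
    apply: (@le_trans _ _ (z `^ 0)); last by rewrite powRr0.
    by apply: ler_powR => //; exact: ltW.
apply: (@le_lt_trans _ _ (\int[mu]_z (t^-1 * exponential_pdf t z)%:E)%E).
  apply: ge0_subset_integral => //.
  - apply/measurable_EFinP; apply: measurable_funM => //.
    exact: measurable_exponential_pdf.
  - by move=> z _; rewrite lee_fin mulr_ge0 ?invr_ge0 ?exponential_pdf_ge0// ltW.
under eq_integral => z _ do rewrite EFinM.
rewrite ge0_integralZl//; last 3 first.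
- by apply/measurable_EFinP; exact: measurable_exponential_pdf.
- by move=> z _; rewrite lee_fin exponential_pdf_ge0// ltW.
- by rewrite lee_fin invr_ge0 ltW.
by rewrite integral_exponential_pdf// mule1 ltry.
Qed.

End StepIntegral.

Section GammaSums.
Variable R : realType.
Local Notation mu := (@lebesgue_measure R).

Lemma ler_of_eq (x y : R) : x = y -> x <= y.
Proof. by move=> ->. Qed.

(** Adding the two powers gives a single bound for k on either side of T; indices below the Potter
    threshold are compared with the value at the threshold. *)
Lemma potter_seq_all (l : nat -> R) (e : R) : (forall n, 0 <= l n) -> potter_seq l -> 0 < e ->
  exists2 C : R, 0 < C & exists N : nat, forall T k, (N <= T)%N -> (0 < k)%N ->
    0 < l T /\ l k <= C * ((T%:R / k%:R) `^ e + (k%:R / T%:R) `^ e) * l T.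
Proof.
move=> l0 pl e0; have [N N0 HN] := pl e e0.
have lN : 0 < l N by have [] := HN N N (leqnn _) (leqnn _).
pose S := \sum_(j < N) l j.
have S0 : 0 <= S by apply: sumr_ge0 => j _.
pose C := (1 + e) * (1 + S / l N).
have SlN : 0 <= S / l N by rewrite divr_ge0// ltW.
have C1 : 1 + e <= C by rewrite /C ler_peMr//; lra.
have C0 : 0 < C by lra.
exists C => //; exists N => T k NT k0.
have [lT _ _] := HN T T NT (leqnn T); split => //.
have A0 : 0 <= (T%:R / k%:R : R) `^ e by exact: powR_ge0.
have B0 : 0 <= (k%:R / T%:R : R) `^ e by exact: powR_ge0.
have fin (u v : R) : 0 <= v -> u <= (1 + e) * v * l T -> v <= (T%:R / k%:R) `^ e + (k%:R / T%:R) `^ e ->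
   u <= C * ((T%:R / k%:R) `^ e + (k%:R / T%:R) `^ e) * l T.
  move=> v0 h1 h2; apply: (le_trans h1); apply: ler_wpM2r; first exact: ltW.
  by apply: ler_pM => //; lra.
case: (leqP T k) => Tk.
  have [_ _ h] := HN T k NT Tk.
  apply: fin h _ => //; lra.
case: (leqP N k) => Nk.
  have [_ h _] := HN k T Nk (ltnW Tk).
  apply: fin h _ => //; lra.
have [_ h _] := HN N T (leqnn _) NT.
have lk : l k <= S.
  by rewrite /S (bigD1 (Ordinal Nk))//= lerDl; apply: sumr_ge0.
have h2 : (T%:R / N%:R : R) `^ e <= (T%:R / k%:R) `^ e.
  apply: (ge0_ler_powR (ltW e0)); rewrite ?nnegrE ?divr_ge0//.
  rewrite ler_wpM2l ?ler0n// lef_pV2 ?posrE ?ltr0n// ler_nat.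
  exact: ltnW.
set P := (T%:R / k%:R) `^ e in A0 h2 *; set Q := (k%:R / T%:R) `^ e in B0 *.
have h3 : l N <= (1 + e) * P * l T.
  apply: (le_trans h); apply: ler_wpM2r; first exact: ltW.
  by apply: ler_wpM2l => //; lra.
have h4 : S <= S / l N * ((1 + e) * P * l T).
  rewrite -mulrA ler_peMr// mulrC ler_pdivlMr// mul1r //.
apply: (le_trans lk); apply: (le_trans h4).
have X0 : 0 <= (1 + e) * P * l T by rewrite !mulr_ge0//; lra.
have Y0 : 0 <= (1 + e) * Q * l T by rewrite !mulr_ge0//; lra.
rewrite (_ : C * (P + Q) * l T = S / l N * ((1 + e) * P * l T) + ((1 + e) * P * l T +
  (1 + e) * Q * l T + S / l N * ((1 + e) * Q * l T))); last by rewrite /C; ring.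
by rewrite lerDl; apply: addr_ge0; [exact: addr_ge0|exact: mulr_ge0].
Qed.

(** The choice d = ln (1 + e) / (1 + ln M) works because (1 + d) M^d <= exp (d (1 + ln M)). *)
Lemma one_add_powR_small (M e : R) : 1 <= M -> 0 < e ->
  exists2 d : R, 0 < d & (1 + d) * M `^ d <= 1 + e.
Proof.
move=> M1 e0; have lM : 0 <= ln M by exact: ln_ge0.
have l1 : 0 < ln (1 + e) by apply: ln_gt0; lra.
exists (ln (1 + e) / (1 + ln M)); first by rewrite divr_gt0//; lra.
set d := _ / _.
have d0 : 0 <= d by rewrite /d divr_ge0//; lra.
have -> : 1 + e = expR d * M `^ d.
  rewrite /powR gt_eqF; last lra.
  rewrite -expRD -[LHS]lnK ?posrE; last lra.
  by congr expR; rewrite /d; field; lra.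
by apply: ler_wpM2r; [exact: powR_ge0|exact: expR_ge1Dx].
Qed.

Lemma potter_seq_ratio (l : nat -> R) (a b : nat -> nat) (z : R) : potter_seq l -> 0 < z ->
  (b n)%:R @[n --> \oo] --> (+oo : set_system R) ->
  (a n)%:R / (b n)%:R @[n --> \oo] --> z ->
  l (a n) / l (b n) @[n --> \oo] --> (1 : R).
Proof.
move=> pl z0 boo abz; apply/cvgrPdist_le => e e0.
(* Eventually a n / b n lies in [z / 2, 2 z], so [M] bounds both this ratio and its inverse. *)
pose M := Num.max (2 * z) (2 / z).
have M1 : 1 <= M.
  rewrite /M le_max; case: (leP 1 z) => z1; apply/orP; [left; lra|right].
  by rewrite ler_pdivlMr//; lra.
have [d d0 Hd] := one_add_powR_small M1 e0.
have [N N0 HN] := pl d d0.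
have z20 : 0 < z / 2 by lra.
have near1 : \forall n \near \oo, `|z - (a n)%:R / (b n)%:R| <= z / 2.
  by move/cvgrPdist_le : abz; apply.
have near2 : \forall n \near \oo, (N%:R + 2 * N%:R / z : R) <= (b n)%:R.
  by move/cvgryPge : boo; apply.
near=> n.
have : `|z - (a n)%:R / (b n)%:R| <= z / 2 by near: n.
rewrite ler_norml => /andP[ab1 ab2].
have bN' : (N%:R + 2 * N%:R / z : R) <= (b n)%:R by near: n.
have N0' : 0 < (N%:R : R) by rewrite ltr0n.
have NZ : 0 <= 2 * N%:R / z by rewrite divr_ge0 ?mulr_ge0//; lra.
have bp : 0 < ((b n)%:R : R) by lra.
have bN : (N <= b n)%N by rewrite -(ler_nat R); lra.
have r1 : z / 2 <= (a n)%:R / (b n)%:R by lra.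
have r2 : (a n)%:R / (b n)%:R <= 2 * z by lra.
have aN' : N%:R <= ((a n)%:R : R).
  have : 2 * N%:R / z <= (b n)%:R by lra.
  rewrite ler_pdivrMr// => h; move: r1; rewrite ler_pdivlMr// => h2; nra.
have aN : (N <= a n)%N by rewrite -(ler_nat R).
have ap : 0 < ((a n)%:R : R) by lra.
have [la _ _] := HN _ _ aN (leqnn _).
have [lb _ _] := HN _ _ bN (leqnn _).
have key (x : R) : 0 <= x -> x <= M -> (1 + d) * x `^ d <= 1 + e.
  move=> x0 xM; apply: le_trans Hd; apply: ler_wpM2l; first lra.
  by apply: (ge0_ler_powR (ltW d0)); rewrite ?nnegrE //; lra.
have rM : (a n)%:R / (b n)%:R <= M by rewrite /M le_max r2.
have rM' : (b n)%:R / (a n)%:R <= M.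
  rewrite /M le_max; apply/orP; right; rewrite ler_pdivrMr//.
  by move: r1; rewrite ler_pdivlMr// => h; rewrite mulrAC ler_pdivlMr//; nra.
have [k1 k2] : l (a n) <= (1 + e) * l (b n) /\ l (b n) <= (1 + e) * l (a n).
  have K1 := key _ (divr_ge0 (ltW ap) (ltW bp)) rM.
  have K2 := key _ (divr_ge0 (ltW bp) (ltW ap)) rM'.
  case: (leqP (a n) (b n)) => ab.
    have [_ h1 h2] := HN _ _ aN ab.
    by split; [apply: (le_trans h1)|apply: (le_trans h2)]; apply: ler_wpM2r => //; exact: ltW.
  have [_ h1 h2] := HN _ _ bN (ltnW ab).
  by split; [apply: (le_trans h2)|apply: (le_trans h1)]; apply: ler_wpM2r => //; exact: ltW.
rewrite ler_norml; apply/andP; split.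
  suff : l (a n) / l (b n) <= 1 + e by lra.
  by rewrite ler_pdivrMr.
suff : 1 - e <= l (a n) / l (b n) by lra.
rewrite ler_pdivlMr//; nra.
Unshelve. all: by end_near. Qed.

Section Scaled.
Variables (alpha : R) (L : nat -> R).
Hypothesis alpha1 : -1 < alpha.
Hypothesis L0 : forall n, 0 <= L n.
Hypothesis pL : potter_seq L.

(* Sums over [k] are read as integrals over [z] with [k] the integer part of [z / x]. *)
Definition inv_trunc (x : R) : nat := Num.truncn x^-1.
Definition reg_weight (k : nat) : R := k.+1%:R `^ alpha * L k.+1.
(** Here [inv_trunc x] stands for 1 / x; the normalization is such that the value at k = z / x tends
    to z^alpha as x tends to 0. *)
Definition scaled_weight (x : R) k : R := reg_weight k * x `^ alpha / L (inv_trunc x).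

Lemma inv_truncP (x : R) : 0 < x -> 1 - x < (inv_trunc x)%:R * x <= 1.
Proof.
move=> x0; have xi : 0 <= x^-1 by rewrite invr_ge0 ltW.
have := truncn_itv xi; rewrite -/(inv_trunc x) => /andP[a b].
apply/andP; split.
  have : 1 < (inv_trunc x).+1%:R * x by rewrite -ltr_pdivrMr// div1r.
  by rewrite -natr1; lra.
by rewrite -ler_pdivlMr// div1r.
Qed.

Lemma reg_weight_ge0 k : 0 <= reg_weight k.
Proof. by rewrite mulr_ge0 ?powR_ge0. Qed.

Lemma scaled_weight_ge0 x k : 0 <= scaled_weight x k.
Proof. by rewrite divr_ge0// mulr_ge0 ?reg_weight_ge0 ?powR_ge0. Qed.

Lemma scaled_weightE x k : 0 < x ->
  scaled_weight x k = (k.+1%:R * x) `^ alpha * (L k.+1 / L (inv_trunc x)).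
Proof. by move=> x0; rewrite /scaled_weight /reg_weight powRM ?ler0n ?(ltW x0)//; ring. Qed.

Lemma truncnS_mul (x z : R) : 0 < x -> 0 < z ->
  z < (Num.truncn (z / x)).+1%:R * x <= z + x.
Proof.
move=> x0 z0; have zx : 0 <= z / x by apply: divr_ge0; exact: ltW.
have /andP[a b] := truncn_itv zx; apply/andP; split.
  by rewrite -ltr_pdivrMr.
by rewrite -natr1 mulrDl mul1r lerD2r -ler_pdivlMr.
Qed.

(** With y = (k + 1) x, Potter bounds control the weight by y^(alpha - e) + y^(alpha + e); both
    powers are dominated by one integrable power y^a at the price of exp (t y / 2). *)
Lemma scaled_weight_dom (t : R) : 0 < t ->
  exists a C x0 : R, [/\ -1 < a, a <= 0, 0 < C, 0 < x0 & forall x k, 0 < x -> x <= x0 ->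
    scaled_weight x k * expR (- (t * (k.+1%:R * x))) <=
    C * ((k.+1%:R * x) `^ a * expR (- (t / 2 * (k.+1%:R * x))))].
Proof.
(* Half the distance from alpha to -1, so that alpha - e is still above -1. *)
move=> t0; pose e := (alpha + 1) / 2.
have e0 : 0 < e by have := alpha1; rewrite /e; lra.
have [C1 C10 [N HN]] := potter_seq_all L0 pL e0.
(* A nonpositive exponent makes the dominating power nonincreasing, so that [scaled_weight_dom_step]
   can replace (k + 1) x by the smaller z. *)
pose a := Num.min (alpha - e) 0.
have a1 : -1 < a by have := alpha1; rewrite /a lt_min => ?; apply/andP; split; rewrite /e; lra.
have aa : a <= alpha - e by rewrite /a ge_min lexx.
have a00 : a <= 0 by rewrite /a ge_min lexx orbT.
have t20 : 0 < t / 2 by lra.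
have [D1 D10 HD1] := powR_expR_compare aa t20.
have [D2 D20 HD2] := powR_expR_compare (ltac:(lra) : a <= alpha + e) t20.
pose C := C1 * (D1 + 2 `^ e * D2).
have C0 : 0 < C by rewrite mulr_gt0// addr_gt0// mulr_gt0// powR_gt0.
(* With T the integer part of 1 / x, the first bound gives T x >= 1 / 2 and the second puts T beyond
   the Potter threshold. *)
pose x0 : R := Num.min (1 / 2) (N.+1%:R^-1).
have x00 : 0 < x0 by rewrite /x0 lt_min; apply/andP; split; [lra|rewrite invr_gt0].
exists a, C, x0; split => // x k xp xx0.
set T := inv_trunc x; have /andP[T1 T2] := inv_truncP xp; rewrite -/T in T1 T2.
have x12 : x <= 1 / 2 by apply: (le_trans xx0); rewrite /x0 ge_min lexx.
have xN : x <= N.+1%:R^-1 by apply: (le_trans xx0); rewrite /x0 ge_min lexx orbT.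
have NT : (N <= T)%N.
  rewrite /T /inv_trunc truncn_ge_nat ?invr_ge0 ?(ltW xp)//.
  apply: (@le_trans _ _ N.+1%:R); first by rewrite ler_nat.
  by rewrite -[leLHS]invrK lef_pV2 ?posrE ?invr_gt0.
have [LT h] := HN T k.+1 NT (ltn0Sn k).
rewrite scaled_weightE//; set y := k.+1%:R * x.
have y0 : 0 < y by rewrite mulr_gt0.
have T0 : 0 < (T%:R : R) by rewrite -(pmulr_lgt0 _ xp); lra.
have k0 : 0 < (k.+1%:R : R) by [].
have h1 : (T%:R / k.+1%:R) `^ e <= y `^ (- e).
  rewrite powRN -[leRHS]mul1r ler_pdivlMr ?powR_gt0// -powRM ?divr_ge0 ?(ltW y0)//.
  have -> : T%:R / k.+1%:R * y = T%:R * x by rewrite /y; field; rewrite gt_eqF.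
  apply: (@le_trans _ _ (1 `^ e)); last by rewrite powR1.
  apply: (ge0_ler_powR (ltW e0)); rewrite ?nnegrE//.
  by rewrite mulr_ge0// ltW.
have h2 : (k.+1%:R / T%:R) `^ e <= 2 `^ e * y `^ e.
  have kT : k.+1%:R / T%:R <= 2 * y.
    rewrite ler_pdivrMr// (_ : 2 * y * T%:R = k.+1%:R * (2 * (T%:R * x))); last by rewrite /y; ring.
    by rewrite ler_peMr//; lra.
  rewrite -powRM ?(ltW y0)//; apply: (ge0_ler_powR (ltW e0)) => //; rewrite nnegrE.
    exact: divr_ge0.
  by rewrite mulr_ge0// ltW.
have h3 : L k.+1 / L T <= C1 * (y `^ (- e) + 2 `^ e * y `^ e).
  rewrite ler_pdivrMr//; apply: (le_trans h); apply: ler_wpM2r; first exact: ltW.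
  by apply: ler_wpM2l; [exact: ltW|exact: lerD].
have yn0 (b : R) : (alpha + b == 0) ==> (y != 0) by rewrite (gt_eqF y0) implybT.
apply: (@le_trans _ _ (C1 * (y `^ (alpha - e) + 2 `^ e * y `^ (alpha + e)) * expR (- (t * y)))).
  apply: ler_wpM2r; first exact: expR_ge0.
  apply: (le_trans (ler_wpM2l (powR_ge0 _ _) h3)).
  by rewrite !powRD//; apply: ler_of_eq; ring.
have h4 : y `^ (alpha - e) + 2 `^ e * y `^ (alpha + e) <=
    (D1 + 2 `^ e * D2) * (y `^ a * expR (t / 2 * y)).
  rewrite mulrDl -[X in _ <= _ + X]mulrA; apply: lerD; first exact: HD1.
  by apply: ler_wpM2l; [exact: powR_ge0|exact: HD2].
apply: (@le_trans _ _ (C1 * ((D1 + 2 `^ e * D2) * (y `^ a * expR (t / 2 * y))) * expR (- (t * y)))).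
  by apply: ler_wpM2r; [exact: expR_ge0|apply: ler_wpM2l => //; exact: ltW].
have -> : expR (- (t / 2 * y)) = expR (t / 2 * y) * expR (- (t * y)).
  by rewrite -expRD; congr expR; field.
by rewrite /C; apply: ler_of_eq; ring.
Qed.

Lemma scaled_weight_dom_step (t : R) : 0 < t ->
  exists a C x0 : R, [/\ -1 < a, a <= 0, 0 < C, 0 < x0 & forall x z, 0 < x -> x <= x0 -> 0 < z ->
    scaled_weight x (Num.truncn (z / x)) * expR (- (t * ((Num.truncn (z / x)).+1%:R * x))) <=
    C * (z `^ a * expR (- (t / 2 * z)))].
Proof.
move=> t0; have [a [C [x0 [a1 a0 C0 x00 H]]]] := scaled_weight_dom t0.
exists a, C, x0; split => // x z xp xx0 z0.
apply: (le_trans (H _ _ xp xx0)); rewrite ler_pM2l//.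
have /andP[zk _] := truncnS_mul xp z0.
apply: ler_pM; rewrite ?powR_ge0 ?expR_ge0//.
  rewrite -[a]opprK !(powRN _ (- a)) lef_pV2 ?posrE ?powR_gt0//; last lra.
  by apply: ge0_ler_powR; rewrite ?nnegrE; lra.
by rewrite ler_expR lerN2 ler_wpM2l//; [lra|exact: ltW].
Qed.

Lemma scaled_sum_bound (t : R) : 0 < t -> exists B x0 : R, 0 < x0 /\ forall x, 0 < x -> x <= x0 ->
  (x%:E * \sum_(k <oo) (scaled_weight x k * expR (- (t * (k.+1%:R * x))))%:E <= B%:E)%E.
Proof.
move=> t0; have [a [C [x0 [a1 a0 C0 x00 H]]]] := scaled_weight_dom_step t0.
have t20 : 0 < t / 2 by lra.
have ig := integrable_powR_expR a1 a0 t20.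
pose B := (\int[mu]_(z in `]0%R, +oo[) (C * (z `^ a * expR (- (t / 2 * z))))%:E)%E.
have igC : mu.-integrable `]0, +oo[ (fun z : R => (C * (z `^ a * expR (- (t / 2 * z))))%:E).
  exact: (integrableZl _ C ig).
have Bfin : B \is a fin_num by exact: integrable_fin_num.
exists (fine B), x0; split => // x xp xx0.
rewrite fineK// -(integral_step (h := fun k => scaled_weight x k * expR (- (t * (k.+1%:R * x)))))//; last first.
  by move=> k; rewrite mulr_ge0 ?scaled_weight_ge0 ?expR_ge0.
apply: ge0_le_integral => //.
- by move=> z _; rewrite lee_fin mulr_ge0 ?scaled_weight_ge0 ?expR_ge0.
- exact: (emeasurable_step (fun k => scaled_weight x k * expR (- (t * (k.+1%:R * x))))).
- exact: (measurable_int mu igC).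
- move=> z /=; rewrite in_itv /= andbT => z0; rewrite lee_fin; exact: H.
Qed.

Section Limits.
Variable lam : nat -> R.
Hypothesis lam0 : forall n, 0 < lam n.
Hypothesis lamc : lam n @[n --> \oo] --> (0 : R).

Lemma truncnS_cvg (z : R) : 0 < z ->
  (Num.truncn (z / lam n)).+1%:R * lam n @[n --> \oo] --> z.
Proof.
move=> z0; apply: (@squeeze_cvgr _ _ _ _ (fun=> z) (fun n => z + lam n)).
- by apply: nearW => n; have /andP[a b] := truncnS_mul (lam0 n) z0; rewrite ltW.
- exact: cvg_cst.
- by rewrite -[X in _ --> X]addr0; apply: cvgD => //; exact: cvg_cst.
Qed.

Lemma inv_trunc_cvg1 : (inv_trunc (lam n))%:R * lam n @[n --> \oo] --> (1 : R).
Proof.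
apply: (@squeeze_cvgr _ _ _ _ (fun n => 1 - lam n) (fun=> 1)).
- by apply: nearW => n; have /andP[a b] := inv_truncP (lam0 n); rewrite ltW.
- by rewrite -[X in _ --> X]subr0; apply: cvgB => //; exact: cvg_cst.
- exact: cvg_cst.
Qed.

Lemma inv_trunc_cvgy : (inv_trunc (lam n))%:R @[n --> \oo] --> (+oo : set_system R).
Proof.
apply/cvgryPge => A.
have d0 : 0 < (`|A| + 1)^-1 by rewrite invr_gt0; have := normr_ge0 A; lra.
have : \forall n \near \oo, `|0 - lam n| <= (`|A| + 1)^-1.
  by move/cvgrPdist_le : lamc; apply.
apply: filterS => n; rewrite sub0r normrN gtr0_norm// => h.
have := truncnS_gt (lam n)^-1; rewrite -/(inv_trunc _) -natr1.
have : `|A| + 1 <= (lam n)^-1 by rewrite -[leLHS]invrK lef_pV2 ?posrE.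
have := ler_norm A; lra.
Qed.

Lemma scaled_weight_cvg (z : R) : 0 < z ->
  scaled_weight (lam n) (Num.truncn (z / lam n)) @[n --> \oo] --> z `^ alpha.
Proof.
move=> z0.
have -> : (fun n => scaled_weight (lam n) (Num.truncn (z / lam n))) =
  (fun n => ((Num.truncn (z / lam n)).+1%:R * lam n) `^ alpha *
     (L (Num.truncn (z / lam n)).+1 / L (inv_trunc (lam n)))).
  by apply/funext => n; exact: scaled_weightE.
rewrite -[X in _ --> X]mulr1; apply: cvgM.
  by apply: cvg_powR => //; exact: truncnS_cvg.
apply: (potter_seq_ratio pL z0); first exact: inv_trunc_cvgy.
have -> : (fun n => (Num.truncn (z / lam n)).+1%:R / (inv_trunc (lam n))%:R) =
   (fun n => ((Num.truncn (z / lam n)).+1%:R * lam n) / ((inv_trunc (lam n))%:R * lam n)).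
  by apply/funext => n; rewrite -mulf_div divff ?mulr1// gt_eqF.
rewrite -[X in _ --> X]divr1; apply: cvgM; first exact: truncnS_cvg.
by apply: cvgV; [exact: oner_neq0|exact: inv_trunc_cvg1].
Qed.

(** Fatou's lemma instead of dominated convergence: only a lower bound is wanted, and then pointwise
    convergence of nonnegative [G] is enough. *)
Lemma scaled_sum_fatou (G : nat -> nat -> R) (g : R -> R) :
  (forall n k, 0 <= G n k) ->
  (forall z, 0 < z -> G n (Num.truncn (z / lam n)) @[n --> \oo] --> g z) ->
  (\int[mu]_(z in `]0%R, +oo[) (z `^ alpha * g z)%:E <=
   limn_einf (fun n => (lam n)%:E * \sum_(k <oo) (scaled_weight (lam n) k * G n k)%:E))%E.
Proof.
move=> G0 Gg.
have E n : ((lam n)%:E * \sum_(k <oo) (scaled_weight (lam n) k * G n k)%:E =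
   \int[mu]_(z in `]0%R, +oo[) (scaled_weight (lam n) (Num.truncn (z / lam n)) *
      G n (Num.truncn (z / lam n)))%:E)%E.
  rewrite -(integral_step (h := fun k => scaled_weight (lam n) k * G n k))//.
  by move=> k; rewrite mulr_ge0 ?scaled_weight_ge0.
under [X in (_ <= limn_einf X)%E]eq_fun => n do rewrite E.
apply: le_trans (fatou mu _ _ _) => //.
- rewrite le_eqVlt; apply/orP; left; apply/eqP; apply: eq_integral => z.
  move=> /set_mem /=; rewrite in_itv /= andbT => z0.
  apply/esym/(fun u => fst (cvg_limn_einf_sup u)).
  apply: cvg_EFin; first exact: nearW.
  by apply: cvgM; [exact: scaled_weight_cvg|exact: Gg].
- by move=> n; exact: (emeasurable_step (fun k => scaled_weight (lam n) k * G n k)).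
- by move=> n z _; rewrite lee_fin mulr_ge0 ?scaled_weight_ge0.
Qed.

Lemma scaled_sum_gamma :
  ((lam n)%:E * \sum_(k <oo) (scaled_weight (lam n) k * expR (- (k.+1%:R * lam n)))%:E)%E @[n --> \oo] -->
  (\int[mu]_(z in `]0%R, +oo[) (z `^ alpha * expR (- z))%:E)%E.
Proof.
have [a [C [x0 [a1 a0 C0 x00 H]]]] := scaled_weight_dom_step ltr01.
have [N _ HN] : \forall n \near \oo, lam n <= x0.
  have : \forall n \near \oo, `|0 - lam n| <= x0 by move/cvgrPdist_le : lamc; apply.
  by apply: filterS => n; rewrite sub0r normrN gtr0_norm.
(* The domination holds only for [lam n <= x0]; after the shift it holds at every index. *)
rewrite -(cvg_shiftn N).
pose f n z := (scaled_weight (lam (n + N)%N) (Num.truncn (z / lam (n + N)%N)) *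
      expR (- ((Num.truncn (z / lam (n + N)%N)).+1%:R * lam (n + N)%N)))%:E.
have E n : ((lam (n + N)%N)%:E * \sum_(k <oo) (scaled_weight (lam (n + N)%N) k * expR (- (k.+1%:R * lam (n + N)%N)))%:E =
   \int[mu]_(z in `]0%R, +oo[) f n z)%E.
  rewrite -(integral_step (h := fun k => scaled_weight (lam (n + N)%N) k * expR (- (k.+1%:R * lam (n + N)%N))))//.
  by move=> k; rewrite mulr_ge0 ?scaled_weight_ge0 ?expR_ge0.
rewrite (eq_cvg _ _ E).
have mexp : measurable_fun setT (fun z : R => z `^ alpha * expR (- z)).
  apply: measurable_funM; first exact: measurable_powR.
  by apply: measurableT_comp.
have [|||||_ _ h] := @dominated_convergence _ _ _ mu `]0%R, +oo[%classic (measurable_itv _)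
   f (fun z => (z `^ alpha * expR (- z))%:E) (fun z => (C * (z `^ a * expR (- (1 / 2 * z))))%:E); last exact: h.
- move=> n; exact: (emeasurable_step (fun k => scaled_weight (lam (n + N)%N) k *
    expR (- (k.+1%:R * lam (n + N)%N)))).
- by apply/measurable_EFinP; apply: measurable_funS mexp.
- apply/aeW => z /=; rewrite in_itv /= andbT => z0.
  apply: cvg_EFin; first exact: nearW.
  have c1 : scaled_weight (lam n) (Num.truncn (z / lam n)) *
      expR (- ((Num.truncn (z / lam n)).+1%:R * lam n)) @[n --> \oo] --> z `^ alpha * expR (- z).
    apply: cvgM; first exact: scaled_weight_cvg.
    apply: continuous_cvg; first exact: continuous_expR.
    by apply: cvgN; exact: truncnS_cvg.
  by move: c1; rewrite -(cvg_shiftn N).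
- apply: (integrableZl _ C (integrable_powR_expR a1 a0 _)) => //; lra.
- apply/aeW => z n /=; rewrite in_itv /= andbT => z0.
  rewrite /f /= lee_fin ger0_norm; last by rewrite mulr_ge0 ?scaled_weight_ge0 ?expR_ge0.
  have := H (lam (n + N)%N) z (lam0 _) (HN _ (leq_addl _ _)) z0.
  by rewrite (mul1r (_.+1%:R * _)).
Qed.

End Limits.
End Scaled.
End GammaSums.

(** * Poisson limit of the cell counts *)

Section PoissonLimit.
Variable R : realType.

(** Sandwich by exp (- x / (1 - x)) <= 1 - x <= exp (- x), raised to the power k n. *)
Lemma cvg_expN (x : nat -> R) (k : nat -> nat) (y : R) :
  (forall n, 0 <= x n <= 1) -> x n @[n --> \oo] --> (0 : R) ->
  (k n)%:R * x n @[n --> \oo] --> y ->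
  (1 - x n) ^+ k n @[n --> \oo] --> expR (- y).
Proof.
move=> x01 x0 kx.
have c2 : expR (- ((k n)%:R * x n)) @[n --> \oo] --> expR (- y).
  by apply: continuous_cvg; [exact: continuous_expR|exact: cvgN].
have c1 : expR (- ((k n)%:R * x n / (1 - x n))) @[n --> \oo] --> expR (- y).
  apply: continuous_cvg; first exact: continuous_expR.
  apply: cvgN; rewrite -[X in _ --> X]divr1; apply: cvgM => //.
  apply: cvgV; first exact: oner_neq0.
  by rewrite -[X in _ --> X]subr0; apply: cvgB => //; exact: cvg_cst.
apply: (squeeze_cvgr _ c1 c2).
have : \forall n \near \oo, `|0 - x n| <= 1 / 2 by move/cvgrPdist_le : x0; apply; lra.
apply: filterS => n; have /andP[xn0 xn1] := x01 n.
rewrite sub0r normrN ger0_norm// => x12.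
have p0 : 0 < 1 - x n by lra.
apply/andP; split.
  rewrite (_ : - (_ / _) = (k n)%:R * (- (x n / (1 - x n)))); last by ring.
  rewrite expRM_natl; apply: lerXn2r; rewrite ?nnegrE ?expR_ge0 ?(ltW p0)//.
  have h := expR_ge1Dx (x n / (1 - x n)).
  have e0 := expR_gt0 (x n / (1 - x n)).
  rewrite expRN -[leLHS]mul1r ler_pdivrMr//.
  apply: (@le_trans _ _ ((1 - x n) * (1 + x n / (1 - x n)))).
    by apply: ler_of_eq; field; lra.
  by rewrite ler_pM2l.
rewrite (_ : - (_ * _) = (k n)%:R * (- x n)); last by ring.
rewrite expRM_natl; apply: lerXn2r; rewrite ?nnegrE ?expR_ge0 ?(ltW p0)//.
by have := expR_ge1Dx (- x n); lra.
Qed.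

Section Cells.
Variables (q : nat -> R) (m : nat) (c : nat -> 'I_m -> pred nat).
Hypothesis qp : is_pmf q.
Hypothesis c_disj : forall n i j x, c n i x -> c n j x -> i = j.
Hypothesis tail_gt0 : forall n, 0 < ptail q n.

Let q0 j : 0 <= q j. Proof. by case: qp. Qed.

Definition cell_mass n i := \sum_(x < n.+1) (c n i x)%:R * q x.
Definition cell_count n (K : 'I_m -> nat) s := [forall i, count (c n i) s == K i].
(** Because [iidE] truncates at n, this is the probability of the prescribed counts together with no
    part exceeding n; hence the factor exp (- z) in the limit below. *)
Definition cell_prob n k (K : 'I_m -> nat) := iidE q n k (fun s => (cell_count n K s)%:R).

Lemma cell_count_perm n K s t : perm_eq s t -> cell_count n K s = cell_count n K t.
Proof. by move=> /permP st; apply: eq_forallb => i; rewrite st. Qed.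

Lemma cell_prob0 n k (K : 'I_m -> nat) : (forall i, K i = 0%N) ->
  cell_prob n k K = (1 - (ptail q n + \sum_i cell_mass n i)) ^+ k.
Proof.
move=> K0.
have -> : cell_prob n k K = iidE q n k (fun s => \prod_(x <- s) ([forall i, ~~ c n i x])%:R).
  apply: eq_iidE => s _ _; elim: s => [|x s IH].
    by rewrite big_nil /cell_count; case: forallP => // -[] i /=; rewrite K0.
  rewrite big_cons -IH -natrM mulnb; congr (_%:R); congr nat_of_bool.
  apply/idP/idP => [/forallP h|/andP[/forallP h1 /forallP h2]].
    apply/andP; split; apply/forallP => i; have := h i => /=; rewrite K0 addn_eq0 => /andP[] //.
    by rewrite eqb0.
  by apply/forallP => i /=; rewrite (negbTE (h1 i)) add0n.
rewrite iidE_prod; congr (_ ^+ _).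
suff : \sum_(x < n.+1) q x = \sum_(x < n.+1) q x * [forall i, ~~ c n i x]%:R + \sum_i cell_mass n i.
  by rewrite /ptail => ->; ring.
rewrite /cell_mass exchange_big -big_split /=; apply: eq_bigr => x _.
case: forallP => h.
  by rewrite mulr1 big1 ?addr0// => i _; rewrite (negbTE (h i)) mul0r.
rewrite mulr0 add0r.
have [i ci] : exists i, c n i x.
  by apply: contrapT => h2; apply: h => i; apply/negP => ci; apply: h2; exists i.
rewrite (bigD1 i)//= ci mul1r big1 ?addr0// => j ji.
by case: (boolP (c n j x)) => [cj|_]; rewrite ?mul0r//; rewrite (c_disj cj ci) eqxx in ji.
Qed.

(* Marking one of the [K r] parts that lie in cell [r]; this gives the Poisson limit by induction on
   the total count. *)
Lemma cell_prob_mark n k (K : 'I_m -> nat) (r : 'I_m) : (0 < K r)%N ->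
  (K r)%:R * cell_prob n k.+1 K =
  k.+1%:R * cell_mass n r * cell_prob n k (fun i => (K i - (i == r))%N).
Proof.
move=> Kr; rewrite /cell_prob -iidEZ.
transitivity (iidE q n k.+1 (fun s => (\sum_(x <- s) (c n r x)%:R) * (cell_count n K s)%:R)).
  apply: eq_iidE => s _ _; case: (boolP (cell_count n K s)) => [/forallP h|_]; last by rewrite !mulr0.
  rewrite !mulr1 -(eqP (h r)) -sum1_count big_mkcond natr_sum.
  by apply: eq_bigr => x _; case: ifP.
rewrite iidE_size_bias; last by move=> s t /(cell_count_perm n K) ->.
rewrite -mulrA; congr (_ * _); rewrite /cell_mass big_distrl /=; apply: eq_bigr => x _.
case: (boolP (c n r x)) => cx; last by rewrite !mul0r.
congr (_ * _); apply: eq_iidE => s _ _; congr (_%:R); congr nat_of_bool.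
apply: eq_forallb => i /=.
have -> : c n i x = (i == r).
  by apply/idP/eqP => [ci|->//]; exact: c_disj ci cx.
case: (eqVneq i r) => [->|_]; last by rewrite subn0.
by rewrite -{1}(subnKC Kr) eqn_add2l.
Qed.

Lemma cell_prob_ge0 n k K : 0 <= cell_prob n k K.
Proof. by apply: iidE_ge0 => // s; rewrite ler0n. Qed.

Lemma cell_mass_ge0 n i : 0 <= cell_mass n i.
Proof. by apply: sumr_ge0 => x _; rewrite mulr_ge0. Qed.

Lemma cell_mass_sum_le n : ptail q n + \sum_i cell_mass n i <= 1.
Proof.
have := cell_prob0 n 1 (fun=> erefl); rewrite expr1.
by have := cell_prob_ge0 n 1 (fun=> 0%N) => /[swap] ->; lra.
Qed.

Lemma cell_prob_cvg (Lam : 'I_m -> R) (K : 'I_m -> nat) (kn : nat -> nat) (z : R) :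
  (forall i, cell_mass n i / ptail q n @[n --> \oo] --> Lam i) -> 0 < z ->
  (kn n)%:R * ptail q n @[n --> \oo] --> z ->
  cell_prob n (kn n) K @[n --> \oo] --> expR (- z) * \prod_i pois (z * Lam i) (K i).
Proof.
move=> cL z0.
have [N KN] : exists N, (\sum_i K i <= N)%N by exists (\sum_i K i)%N.
elim: N K KN kn => [|N IH] K KN kn kz.
  have K0 i : K i = 0%N.
    apply/eqP; rewrite -leqn0; apply: leq_trans KN.
    by rewrite (bigD1 i)//= leq_addr.
  have -> : (fun n => cell_prob n (kn n) K) =
      (fun n => (1 - (ptail q n + \sum_i cell_mass n i)) ^+ kn n).
    by apply/funext => n; exact: cell_prob0.
  have -> : expR (- z) * \prod_i pois (z * Lam i) (K i) = expR (- (z * (1 + \sum_i Lam i))).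
    have -> : \prod_i pois (z * Lam i) (K i) = \prod_i expR (- (z * Lam i)).
      by apply: eq_bigr => i _; rewrite K0 /pois expr0 fact0 divr1 mul1r.
    rewrite -expR_sum -expRD; congr expR; rewrite sumrN -big_distrr /=; ring.
  have tE : (fun n => ptail q n + \sum_i cell_mass n i) =
     (fun n => ptail q n * (1 + \sum_i cell_mass n i / ptail q n)).
    apply/funext => n; rewrite mulrDr mulr1 big_distrr /=; congr (_ + _).
    by apply: eq_bigr => i _; field; rewrite gt_eqF.
  have sc : 1 + \sum_i cell_mass n i / ptail q n @[n --> \oo] --> 1 + \sum_i Lam i.
    apply: cvgD; first exact: cvg_cst.
    by apply: cvg_big => //; exact: add_continuous.
  apply: cvg_expN.
  - move=> n; rewrite cell_mass_sum_le andbT addr_ge0 ?ptail_ge0//.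
    by apply: sumr_ge0 => i _; exact: cell_mass_ge0.
  - rewrite tE -[X in _ --> X](mul0r (1 + \sum_i Lam i)).
    by apply: cvgM => //; exact: ptail_cvg0.
  - rewrite [X in X @ _](_ : _ = fun n => (kn n)%:R * ptail q n * (1 + \sum_i cell_mass n i / ptail q n)).
      exact: cvgM.
    by apply/funext => n; rewrite -mulrA; congr (_ * _); exact: (congr1 (fun f => f n) tE).
case: (boolP [forall i, K i == 0%N]) => [/forallP K0|].
  by apply: IH => //; rewrite big1// => i _; apply/eqP.
rewrite negb_forall => /existsP[r]; rewrite -lt0n => Kr.
pose K' := fun i => (K i - (i == r))%N.
have K'N : (\sum_i K' i <= N)%N.
  rewrite -ltnS; apply: leq_trans KN; rewrite (bigD1 r)//= [leqRHS](bigD1 r)//= /K' eqxx.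
  rewrite -addSn subn1 prednK//; apply: eq_leq; congr (_ + _)%N.
  by apply: eq_bigr => i /negbTE ->; rewrite subn0.
have kz' : ((kn n).-1)%:R * ptail q n @[n --> \oo] --> z.
  apply: (squeeze_cvgr (f := fun n => (kn n)%:R * ptail q n - ptail q n)
     (h := fun n => (kn n)%:R * ptail q n)) => //.
    apply: nearW => n; have t0 := tail_gt0 n.
    case: (kn n) => [|k] /=; first by rewrite mul0r lexx andbT sub0r; lra.
    by rewrite -natr1; apply/andP; split; nra.
  by rewrite -[X in _ --> X]subr0; apply: cvgB => //; exact: ptail_cvg0.
have cIH := IH K' K'N _ kz'.
have Kr0 : ((K r)%:R : R) != 0 by rewrite pnatr_eq0 -lt0n.
(* The Poisson recursion K pois(r, K) = r pois(r, K - 1), the limiting form of [cell_prob_mark]. *)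
have -> : expR (- z) * \prod_i pois (z * Lam i) (K i) =
    (K r)%:R^-1 * (z * Lam r * (expR (- z) * \prod_i pois (z * Lam i) (K' i))).
  rewrite (bigD1 r)//= [in RHS](bigD1 r)//= {1}/K' eqxx.
  have -> : \prod_(i < m | i != r) pois (z * Lam i) (K' i) =
            \prod_(i < m | i != r) pois (z * Lam i) (K i).
    by apply: eq_bigr => i /negbTE ir; rewrite /K' ir subn0.
  rewrite -(prednK Kr) subn1 /= /pois factS exprS natrM invfM; ring.
have cR : (K r)%:R^-1 * ((kn n)%:R * ptail q n * (cell_mass n r / ptail q n) * cell_prob n (kn n).-1 K')
    @[n --> \oo] --> (K r)%:R^-1 * (z * Lam r * (expR (- z) * \prod_i pois (z * Lam i) (K' i))).
  by apply: cvgM; [exact: cvg_cst|apply: cvgM => //; apply: cvgM].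
move: cR; apply: cvg_trans; apply: near_eq_cvg.
(* Excludes [kn n = 0], where no part can be marked. *)
have : \forall n \near \oo, z / 2 <= (kn n)%:R * ptail q n.
  by apply: (cvgr_ge z) => //; lra.
apply: filterS => n hn.
case E : (kn n) hn => [|k] /= hn; first by move: hn; rewrite mul0r; lra.
apply: (mulfI Kr0); rewrite mulrA mulfV// mul1r cell_prob_mark//.
congr (_ * _); have := tail_gt0 n => t0; field; rewrite gt_eqF//.
Qed.

End Cells.
End PoissonLimit.

(** * The Gibbs weights and one big jump *)

Section GibbsUpper.
Variable R : realType.
Local Notation mu := (@lebesgue_measure R).
Variable q : nat -> R.
Hypothesis qp : is_pmf q.
Hypothesis pl : potter_seq (fun j => j%:R * q j).

Let q0 j : 0 <= q j. Proof. by case: qp. Qed.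

(** Size bias once more, now with leading constant 1 + e: above s^2 n the weight j q_j is at most (1
    + e) n q_n, and below it the local bound applies to n - j >= n / 2 and gains the factor s. *)
Lemma conv_pow_step_upper : exists2 C : R, 0 < C & forall e s : R, 0 < e -> 0 < s -> s <= 1 / 2 ->
  \forall n \near \oo, forall k,
  n%:R * conv_pow q k.+1 n <= k.+1%:R * (n%:R * q n) *
    ((1 + e) * expR (- (k%:R * ptail q n)) + C * s * expR (- (k%:R * ptail q n / 2))).
Proof.
have [C1 [C11 [N1 N10 HN1]]] := pmf_sum_id qp pl.
have [C C0 HC] := conv_pow_local_bound qp pl.
exists (4 * C1 * C); first by rewrite !mulr_gt0//; lra.
move=> e s e0 s0 s12.
have s1 : 1 <= s^-1 ^+ 2 by rewrite exprn_ege1// invf_ge1//; lra.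
have [d d0 Hd] := one_add_powR_small s1 e0.
have [N N0 HN] := pl d0.
have s20 : 0 < s ^+ 2 by rewrite exprn_gt0.
near=> n => k.
have N1n : (N1 <= n)%N by near: n; exists N1.
have n0 : 0 < (n%:R : R) by rewrite ltr0n (leq_trans N10).
have nN : N%:R / s ^+ 2 <= n%:R by near: n; exact: nbhs_infty_ger.
have [qn Hj Hs] := HN1 n N1n.
set T := ptail q n.
have T0 : 0 <= T by exact: ptail_ge0.
set l := n%:R * q n.
have l0 : 0 < l by rewrite mulr_gt0.
rewrite conv_pow_size_bias -mulrA ler_pM2l//.
rewrite (bigID (fun j : 'I_n.+1 => (j%:R : R) <= s ^+ 2 * n%:R))/= addrC mulrDr; apply: lerD.
  apply: (@le_trans _ _ (\sum_(i < n.+1) l * (1 + e) * conv_pow q k (n - i))).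
    rewrite big_mkcond /=; apply: ler_sum => i _; case: ifPn => hi; last first.
      by rewrite !mulr_ge0 ?conv_pow_ge0//; lra.
    apply: ler_wpM2r; first exact: conv_pow_ge0.
    have iN : (N <= i)%N.
      rewrite -(ler_nat R); move: hi; rewrite -ltNge => /ltW; apply: le_trans.
      by rewrite mulrC -ler_pdivrMr.
    have iN0 : 0 < (i%:R : R) by rewrite ltr0n (leq_trans N0).
    have [_ h _] := HN i n iN (leq_ord i).
    apply: (le_trans h); rewrite -/l [leRHS]mulrC; apply: ler_wpM2r; first exact: ltW.
    apply: le_trans Hd; apply: ler_wpM2l; first lra.
    apply: (ge0_ler_powR (ltW d0)); rewrite ?nnegrE ?divr_ge0 ?exprn_ge0 ?invr_ge0 ?(ltW s0)//.
    rewrite ler_pdivrMr// exprVn mulrC ler_pdivlMr// mulrC.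
    by move: hi; rewrite -ltNge => /ltW.
  rewrite -big_distrr /= mulrA; apply: ler_wpM2l; first by rewrite mulr_ge0//; lra.
  apply: le_trans (sum_pmf_exp k n qp); apply: le_trans (sum_conv_pow k n q0).
  rewrite (reindex_inj rev_ord_inj) /=.
  by under eq_bigr => i _ do rewrite subSS (subKn (leq_ord i)).
apply: (@le_trans _ _ ((\sum_(i < n.+1 | (i%:R : R) <= s ^+ 2 * n%:R) i%:R * q i) *
     (2 * C / n%:R * expR (- (k%:R * T / 2))))).
  rewrite big_distrl /=; apply: ler_sum => i hi.
  apply: ler_wpM2l; first by rewrite mulr_ge0.
  have im : (i <= n)%N by exact: leq_ord.
  have mi2 : n%:R / 2 <= (n - i)%:R :> R.
    rewrite natrB//; suff : s ^+ 2 * n%:R <= 1 / 2 * n%:R by lra.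
    by rewrite ler_pM2r//; nra.
  have mi0 : 0 < ((n - i)%:R : R) by lra.
  have e1 : 0 < expR (- (k%:R * T / 2)) by exact: expR_gt0.
  have : (n - i)%:R * conv_pow q k (n - i) <= C * expR (- (k%:R * T / 2)).
    apply: (le_trans (HC _ _)); rewrite ler_pM2l// ler_expR lerN2 ler_pM2r ?invr_gt0//.
    by apply: ler_wpM2l => //; apply: ptail_le => //; exact: leq_subr.
  rewrite mulrC -ler_pdivlMr// => h; apply: (le_trans h).
  rewrite (_ : 2 * C / n%:R * _ = C * expR (- (k%:R * T / 2)) * (2 / n%:R)); last by ring.
  apply: ler_wpM2l; first by rewrite mulr_ge0 // ltW.
  rewrite -[leRHS]invf_div lef_pV2 ?posrE//; lra.
apply: (@le_trans _ _ ((2 * C1 * s * n%:R * l) * (2 * C / n%:R * expR (- (k%:R * T / 2))))).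
  apply: ler_wpM2r; last exact: Hs.
  by rewrite mulr_ge0 ?expR_ge0// divr_ge0 ?mulr_ge0//; exact: ltW.
by apply: ler_of_eq; field; rewrite gt_eqF.
Unshelve. all: by end_near. Qed.

Variables (alpha : R) (V : nat -> R).
Hypothesis alpha1 : -1 < alpha.
Hypothesis V0 : forall k, 0 <= V k.
Definition sv_part (a : R) (v : nat -> R) k := v k * k%:R `^ (1 - a).
Local Notation L := (sv_part alpha V).
Hypothesis pV : potter_seq L.

Lemma sv_part_ge0 k : 0 <= L k.
Proof. by rewrite mulr_ge0 ?powR_ge0. Qed.

Lemma reg_weight_sv k : reg_weight alpha L k = k.+1%:R * V k.+1.
Proof.
rewrite /reg_weight /sv_part mulrCA -powRD; last by rewrite pnatr_eq0 implybT.
by rewrite subrKC powRr1 ?ler0n// mulrC.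
Qed.

(** The order of the sum of k V_k exp (- k P(X > n)), divided by its Gamma integral; times q_n and
    that integral it is the one-big-jump asymptotics of the total weight. *)
Definition gibbs_scale n : R :=
  L (inv_trunc (ptail q n)) / (ptail q n `^ alpha * ptail q n).

Lemma reg_weight_scaled n k : 0 < L (inv_trunc (ptail q n)) ->
  k.+1%:R * V k.+1 = gibbs_scale n * (ptail q n * scaled_weight alpha L (ptail q n) k).
Proof.
move=> LT; rewrite -reg_weight_sv /gibbs_scale /scaled_weight.
have t0 := pmf_tail_gt0 qp pl n.
have p0 : ptail q n `^ alpha != 0 by rewrite gt_eqF// powR_gt0.
by field; rewrite p0 !gt_eqF.
Qed.

Lemma near_gibbs_scale_gt0 : \forall n \near \oo, 0 < L (inv_trunc (ptail q n)) /\ 0 < gibbs_scale n.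
Proof.
have [N _ HN] := potter_seq_gt0 pV.
have t0 := pmf_tail_gt0 qp pl.
have /cvgryPge /(_ N%:R) := inv_trunc_cvgy t0 (ptail_cvg0 qp).
apply: filterS => n; rewrite ler_nat => Nn.
have LT := HN _ Nn; split => //.
by rewrite /gibbs_scale divr_gt0// mulr_gt0// powR_gt0.
Qed.

Lemma partial_sum_scaled_le (x X : R) (G : nat -> R) K : 0 < x -> (forall k, 0 <= G k) ->
  (x%:E * \sum_(k <oo) (scaled_weight alpha L x k * G k)%:E <= X%:E)%E ->
  \sum_(k < K) x * scaled_weight alpha L x k * G k <= X.
Proof.
move=> x0 G0 h; rewrite -lee_fin; apply: le_trans h.
have -> : \sum_(k < K) x * scaled_weight alpha L x k * G k =
   x * \sum_(k < K) scaled_weight alpha L x k * G k.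
  by rewrite big_distrr /=; apply: eq_bigr => k _; rewrite mulrA.
rewrite EFinM; apply: lee_wpmul2l; first by rewrite lee_fin ltW.
rewrite -sumEFin -(big_mkord xpredT (fun k => (scaled_weight alpha L x k * G k)%:E)).
apply: nneseries_lim_ge => k _ _.
by rewrite lee_fin mulr_ge0 ?scaled_weight_ge0//; exact: sv_part_ge0.
Qed.

Variable Gam : R.
Hypothesis Gam0 : 0 < Gam.
Hypothesis GamE : (\int[mu]_(z in `]0%R, +oo[) (z `^ alpha * expR (- z))%:E = Gam%:E)%E.

(** Uniform over partial sums, because convergence of the full series is deduced from it. Half of e
    goes to the main term and half to the error of [conv_pow_step_upper]. *)
Lemma gibbs_partial_upper (e : R) : 0 < e -> \forall n \near \oo, forall K : nat,
  \sum_(k < K) V k.+1 * conv_pow q k.+1 n <= (1 + e) * Gam * (q n * gibbs_scale n).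
Proof.
move=> e0; have t0 := pmf_tail_gt0 qp pl.
have [C C0 HC] := conv_pow_step_upper.
have h12 : 0 < (1 / 2 : R) by lra.
have [B [x0 [x00 HB]]] := scaled_sum_bound alpha1 sv_part_ge0 pV h12.
pose B1 := `|B| + 1.
have B10 : 0 < B1 by rewrite /B1; have := normr_ge0 B; lra.
have BB : B <= B1 by rewrite /B1; have := ler_norm B; lra.
(* Factors 1 + h arise from the local estimate, from exp P(X > n) and from the Gamma limit; this h
   gives (1 + h)^3 <= 1 + e / 2. *)
pose h : R := Num.min 1 (e / 16).
have h0 : 0 < h by rewrite /h lt_min; apply/andP; split; lra.
have h1 : h <= 1 by rewrite /h ge_min lexx.
have he : h <= e / 16 by rewrite /h ge_min lexx orbT.
have D0 : 0 < 4 * C * B1 by rewrite !mulr_gt0.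
pose s : R := Num.min (1 / 2) (e * Gam / (4 * C * B1)).
have s0 : 0 < s by rewrite /s lt_min h12 divr_gt0// mulr_gt0.
have s12 : s <= 1 / 2 by rewrite /s ge_min lexx.
have sD : 2 * C * s * B1 <= e / 2 * Gam.
  have : s <= e * Gam / (4 * C * B1) by rewrite /s ge_min lexx orbT.
  by rewrite ler_pdivlMr//; lra.
have near1 := HC h s h0 s0 s12.
have near2 : \forall n \near \oo, ptail q n <= x0.
  by apply: (cvgr_le 0) => //; exact: ptail_cvg0.
have near3 : \forall n \near \oo, expR (ptail q n) <= 1 + h.
  apply: (cvgr_le 1); last lra.
  by rewrite -(expR0); apply: continuous_cvg; [exact: continuous_expR|exact: ptail_cvg0].
have near4 : \forall n \near \oo, ((ptail q n)%:E * \sum_(k <oo) (scaled_weight alpha L (ptail q n) k *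
     expR (- (k.+1%:R * ptail q n)))%:E <= ((1 + h) * Gam)%:E)%E.
  have cg := scaled_sum_gamma alpha1 sv_part_ge0 pV t0 (ptail_cvg0 qp).
  rewrite GamE in cg.
  have lt : (Gam%:E < ((1 + h) * Gam)%:E)%E by rewrite lte_fin ltr_pMl//; lra.
  have [N _ HN] := cg _ (open_ereal_lt' lt).
  by exists N => // n Nn; apply/ltW; exact: HN.
have near5 := near_gibbs_scale_gt0.
near=> n => K.
have n0 : 0 < (n%:R : R) by rewrite ltr0n; near: n; exists 1%N.
have [LT Th] : 0 < L (inv_trunc (ptail q n)) /\ 0 < gibbs_scale n by near: n.
have N1 : forall j, n%:R * conv_pow q j.+1 n <= j.+1%:R * (n%:R * q n) *
    ((1 + h) * expR (- (j%:R * ptail q n)) + C * s * expR (- (j%:R * ptail q n / 2))) by near: n.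
have N2 : ptail q n <= x0 by near: n.
have N3 : expR (ptail q n) <= 1 + h by near: n.
have N4 : ((ptail q n)%:E * \sum_(k <oo) (scaled_weight alpha L (ptail q n) k *
     expR (- (k.+1%:R * ptail q n)))%:E <= ((1 + h) * Gam)%:E)%E by near: n.
set T := ptail q n in LT N1 N2 N3 N4 *; set Q := gibbs_scale n in Th *.
have T0 : 0 < T by exact: t0.
have E1 : \sum_(k < K) T * scaled_weight alpha L T k * expR (- (k.+1%:R * T)) <= (1 + h) * Gam.
  by apply: (@partial_sum_scaled_le T _ (fun k => expR (- (k.+1%:R * T)))) => //.
have E2 : \sum_(k < K) T * scaled_weight alpha L T k * expR (- (1 / 2 * (k.+1%:R * T))) <= B1.
  apply: (@partial_sum_scaled_le T _ (fun k => expR (- (1 / 2 * (k.+1%:R * T))))) => //.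
  apply: (@le_trans _ _ B%:E); last by rewrite lee_fin.
  exact: HB.
have eT2 : expR (T / 2) <= 2.
  by apply: (@le_trans _ _ (expR T)); [rewrite ler_expR; lra|lra].
rewrite -(ler_pM2l n0) big_distrr /=.
apply: (@le_trans _ _ (\sum_(k < K) n%:R * q n * Q *
   ((1 + h) * expR T * (T * scaled_weight alpha L T k * expR (- (k.+1%:R * T))) +
    C * s * expR (T / 2) * (T * scaled_weight alpha L T k * expR (- (1 / 2 * (k.+1%:R * T))))))).
  apply: ler_sum => k _; rewrite mulrCA.
  have hk := N1 k; apply: (le_trans (ler_wpM2l (V0 _) hk)); apply: ler_of_eq.
  rewrite -/T (_ : V k.+1 * _ = n%:R * q n * (k.+1%:R * V k.+1) *
     ((1 + h) * expR (- (k%:R * T)) + C * s * expR (- (k%:R * T / 2)))); last by ring.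
  rewrite (reg_weight_scaled k LT) -/T -/Q.
  have -> : expR (- (k%:R * T)) = expR T * expR (- (k.+1%:R * T)).
    by rewrite -expRD; congr expR; rewrite -natr1; ring.
  have -> : expR (- (k%:R * T / 2)) = expR (T / 2) * expR (- (1 / 2 * (k.+1%:R * T))).
    by rewrite -expRD; congr expR; rewrite -natr1; field.
  by ring.
rewrite -big_distrr /= big_split /= -!big_distrr /=.
rewrite (_ : n%:R * (_ * _) = n%:R * q n * Q * ((1 + e) * Gam)); last by ring.
apply: ler_wpM2l; first by apply: mulr_ge0; [exact: mulr_ge0|exact: ltW].
have X1 : (1 + h) * expR T * \sum_(k < K) T * scaled_weight alpha L T k * expR (- (k.+1%:R * T)) <=
   (1 + h) * (1 + h) * ((1 + h) * Gam).
  apply: ler_pM => //.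
  - by rewrite mulr_ge0 ?expR_ge0//; lra.
  - apply: sumr_ge0 => k _; apply: mulr_ge0; last exact: expR_ge0.
    apply: mulr_ge0; first exact: ltW.
    by apply: scaled_weight_ge0; exact: sv_part_ge0.
  - by apply: ler_wpM2l; lra.
have X2 : C * s * expR (T / 2) * \sum_(k < K) T * scaled_weight alpha L T k *
    expR (- (1 / 2 * (k.+1%:R * T))) <= C * s * 2 * B1.
  apply: ler_pM => //.
  - by apply: mulr_ge0; [apply: mulr_ge0; exact: ltW|exact: expR_ge0].
  - apply: sumr_ge0 => k _; apply: mulr_ge0; last exact: expR_ge0.
    apply: mulr_ge0; first exact: ltW.
    by apply: scaled_weight_ge0; exact: sv_part_ge0.
  - by apply: ler_wpM2l => //; apply: mulr_ge0; exact: ltW.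
apply: (le_trans (lerD X1 X2)).
have : (1 + h) * (1 + h) * (1 + h) <= 1 + e / 2 by nra.
move=> h3; have : (1 + h) * (1 + h) * (1 + h) * Gam <= (1 + e / 2) * Gam by rewrite ler_pM2r.
lra.
Unshelve. all: by end_near. Qed.

End GibbsUpper.

(** * The lower bound from one big jump *)

Section OneBigJump.
Variable R : realType.
Local Notation mu := (@lebesgue_measure R).

Lemma limn_einf_gt (u : (\bar R)^nat) (y : \bar R) : (y < limn_einf u)%E ->
  \forall n \near \oo, (y < u n)%E.
Proof.
move=> yu; rewrite limn_einf_lim in yu.
have cv := @is_cvg_einfs _ u.
have [N _ HN] := cv _ (open_ereal_gt' yu).
exists N => // n Nn; apply: lt_le_trans (HN n Nn) _.
by apply: ereal_inf_lbound; exists n => //=.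
Qed.

Lemma behead_sort_max (x : nat) s : all (fun y => y <= x)%N s ->
  perm_eq (behead (sort geq (x :: s))) s.
Proof.
move=> sx; have ps : perm_eq (sort geq (x :: s)) (x :: s) by rewrite perm_sort.
have so : sorted geq (sort geq (x :: s)).
  by apply: sort_sorted => a b; exact: leq_total.
case E : (sort geq (x :: s)) ps so => [|h t] ps so; first by have := perm_size ps.
have hx : h = x.
  apply/eqP; rewrite eqn_leq; apply/andP; split.
    have : h \in x :: s by rewrite -(perm_mem ps) mem_head.
    by rewrite in_cons => /predU1P[->//|hs]; exact: (allP sx).
  have : x \in h :: t by rewrite (perm_mem ps) mem_head.
  rewrite in_cons => /predU1P[->//|xt].
  have tr : transitive geq by move=> a b c ba ac; exact: leq_trans ac ba.
  by have /allP/(_ x xt) := order_path_min tr so.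
by rewrite /= -(perm_cons h) [X in perm_eq _ (X :: _)]hx.
Qed.

Section Jump.
Variable q : nat -> R.
Hypothesis qp : is_pmf q.
Hypothesis pl : potter_seq (fun j => j%:R * q j).

Let q0 j : 0 <= q j. Proof. by case: qp. Qed.

Lemma iidE_sumn_le n k : iidE q n k (fun s => (sumn s)%:R) <= k%:R * \sum_(j < n.+1) j%:R * q j.
Proof.
case: k => [|k]; first by rewrite /iidE mul0r.
have -> : iidE q n k.+1 (fun s => (sumn s)%:R) = iidE q n k.+1 (fun s => (\sum_(x <- s) x%:R) * 1).
  by apply: eq_iidE => s _ _; rewrite mulr1 -natr_sum -sumnE.
rewrite iidE_size_bias//; apply: ler_wpM2l => //; apply: ler_sum => j _.
apply: ler_piMr; first by rewrite mulr_ge0.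
rewrite iidE_cst mul1r; apply: exprn_ile1; first exact: sumr_ge0.
by have := ptail_ge0 n qp; rewrite /ptail; lra.
Qed.

(** Potter on a bounded ratio gives n q_n <= (1 + e) j q_j, and j <= n then allows division by n.
    The ratio n / j is bounded by 2, which the range of j allows with room to spare. *)
Lemma pmf_near_le (e : R) : 0 < e -> \forall n \near \oo, forall j, (3 * n <= 4 * j)%N -> (j <= n)%N ->
  q n <= (1 + e) * q j.
Proof.
move=> e0; have M1 : 1 <= (2 : R) by lra.
have [d d0 Hd] := one_add_powR_small M1 e0.
have [N N0 HN] := pl d0.
near=> n => j jn jn2.
have nN : (2 * N <= n)%N by near: n; exists (2 * N)%N.
have jN : (N <= j)%N by clear -jn nN; lia.
have nj : (n <= 2 * j)%N by clear -jn; lia.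
have j0 : 0 < (j%:R : R) by rewrite ltr0n (leq_trans N0).
have [lj _ h] := HN j n jN jn2.
have qj : 0 < q j by move: lj; rewrite pmulr_rgt0.
have jn' : (j%:R : R) <= n%:R by rewrite ler_nat.
have n0 : 0 < (n%:R : R) by lra.
have nj2 : (n%:R / j%:R : R) <= 2.
  by rewrite ler_pdivrMr// -natrM ler_nat.
have h2 : n%:R * q n <= (1 + e) * (j%:R * q j).
  apply: (le_trans h); apply: ler_wpM2r; first exact: ltW.
  apply: le_trans Hd; apply: ler_wpM2l; first lra.
  by apply: (ge0_ler_powR (ltW d0)); rewrite ?nnegrE ?divr_ge0.
rewrite -(ler_pM2l n0); apply: (le_trans h2).
rewrite [leRHS]mulrCA; apply: ler_wpM2l; first lra.
exact: ler_wpM2r.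
Unshelve. all: by end_near. Qed.

Section JumpCells.
Variables (m : nat) (c : nat -> 'I_m -> pred nat).

(* On [4 * sumn s <= n] the extra part [n - sumn s] is the unique maximum, so it is the one removed by
   [behead (sort geq _)], and the [k + 1] positions of it are disjoint events. *)
Lemma one_jump_lower (e : R) (K : 'I_m -> nat) : 0 < e -> \forall n \near \oo, forall k,
  k.+1%:R * (q n / (1 + e)) *
    iidE q n k (fun s => (4 * sumn s <= n)%N%:R * (cell_count c n K s)%:R) <=
  iidE q n k.+1 (fun s => (sumn s == n)%:R * (cell_count c n K (behead (sort geq s)))%:R).
Proof.
move=> e0; have ne := pmf_near_le e0.
near=> n => k.
have n1 : (0 < n)%N by near: n; exists 1%N.
have Hq : forall j, (3 * n <= 4 * j)%N -> (j <= n)%N -> q n <= (1 + e) * q j by near: n.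
pose G s : R := (sumn s == n)%:R * (cell_count c n K (behead (sort geq s)))%:R.
have G0 s : 0 <= G s by rewrite mulr_ge0.
have Gp s t : perm_eq s t -> G s = G t.
  move=> st; rewrite /G !sumnE (perm_big _ st); congr (_ * (cell_count c n K (behead _))%:R).
  apply/perm_sortP => //; [by move=> a b; exact: leq_total| |].
    by move=> a b x ba ax; exact: leq_trans ax ba.
  by move=> a b /andP[ab ba]; apply/eqP; rewrite eqn_leq; apply/andP; split.
(* Marks the parts above n / 2. When the sum is n there is at most one, so inserting the number of
   marks can only lower the expectation. *)
pose f x : R := (n < 2 * x)%N%:R.
have E1 : iidE q n k.+1 (fun s => (\sum_(x <- s) f x) * G s) <= iidE q n k.+1 G.
  apply: le_iidE => // s _ _; rewrite /G.
  case: eqP => sn; last by rewrite !mul0r mulr0.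
  rewrite mul1r; apply: ler_piMl => //.
  rewrite /f -natr_sum -[leRHS]/(1%:R) ler_nat.
  have : (\sum_(x <- s) (n < 2 * x) * n.+1 <= 2 * sumn s)%N.
    rewrite sumnE big_distrr /=; apply: leq_sum => x _.
    by case: (ltnP n (2 * x)) => h; rewrite ?mul1n ?mul0n.
  rewrite sn -big_distrl /=; set X := (\sum_(x <- s) (n < 2 * x))%N => h.
  by rewrite leqNgt; apply/negP => X2; nia.
apply: le_trans E1; rewrite iidE_size_bias// -mulrA; apply: ler_wpM2l => //.
rewrite -iidEZ; under [leRHS]eq_bigr => x _ do rewrite -iidEZ.
rewrite -iidE_sum; apply: le_iidE => // s _ _.
have F0 (x : 'I_n.+1) : 0 <= f x * q x * G ((x : nat) :: s).
  by rewrite !mulr_ge0.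
case: (leqP (4 * sumn s) n) => sn; last by rewrite mul0r mulr0; apply: sumr_ge0.
have xn : (n - sumn s < n.+1)%N by rewrite ltnS leq_subr.
rewrite (bigD1 (Ordinal xn))//=; apply: ler_wpDr; first by apply: sumr_ge0.
have sx : (sumn s <= n)%N by lia.
have -> : f (n - sumn s)%N = 1 by rewrite /f (_ : (n < _)%N)//; lia.
rewrite /G /= subnK// eqxx !mul1r.
rewrite (@cell_count_perm _ c n K _ s); last first.
  apply: behead_sort_max; apply/allP => y /mem_le_sumn ys; lia.
apply: ler_wpM2r => //; rewrite ler_pdivrMr; last lra.
rewrite mulrC; apply: Hq; lia.
Unshelve. all: by end_near. Qed.

(** Markov's inequality for the sum of the truncated parts, whose mean is at most 2 C1 k n (n q_n).
    The error is uniform in k and in the counts. *)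
Lemma cell_prob_small_sum : exists2 C : R, 0 < C & \forall n \near \oo, forall k (K : 'I_m -> nat),
  cell_prob q c n k K - C * (k%:R * (n%:R * q n)) <=
  iidE q n k (fun s => (4 * sumn s <= n)%N%:R * (cell_count c n K s)%:R).
Proof.
have [C1 [C11 [N1 N10 HN1]]] := pmf_sum_id qp pl.
exists (8 * C1); first lra.
exists N1 => // n /= Nn k K.
have n0 : 0 < (n%:R : R) by rewrite ltr0n (leq_trans N10).
have [_ _ /(_ 1 ltr01)] := HN1 n Nn; rewrite expr1n mul1r mulr1 => Hs.
have {}Hs : \sum_(j < n.+1) j%:R * q j <= 2 * C1 * n%:R * (n%:R * q n).
  apply: le_trans Hs; apply: ler_of_eq; apply: eq_bigl => j.
  by rewrite ler_nat leq_ord.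
rewrite lerBlDr.
apply: (@le_trans _ _ (iidE q n k (fun s => (4 * sumn s <= n)%N%:R * (cell_count c n K s)%:R) +
   4 / n%:R * iidE q n k (fun s => (sumn s)%:R))).
  rewrite -iidEZ -iidED; apply: le_iidE => // s _ _.
  have P0 : 0 <= 4 / n%:R * (sumn s)%:R :> R by rewrite mulr_ge0// divr_ge0.
  case: (leqP (4 * sumn s) n) => sn; first by rewrite mul1r lerDl.
  rewrite mul0r add0r; apply: (@le_trans _ _ 1); first by case: cell_count.
  rewrite mulrAC ler_pdivlMr// mul1r -natrM ler_nat; exact: ltnW.
rewrite lerD2l; apply: (@le_trans _ _ (4 / n%:R * (k%:R * (2 * C1 * n%:R * (n%:R * q n))))).
  apply: ler_wpM2l; first by rewrite divr_ge0.
  apply: (le_trans (iidE_sumn_le n k)); exact: ler_wpM2l.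
by apply: ler_of_eq; field; rewrite gt_eqF.
Qed.

End JumpCells.

Variables (alpha : R) (V : nat -> R).
Hypothesis V0 : forall k, 0 <= V k.
Local Notation L := (sv_part alpha V).
Hypothesis pV : potter_seq L.

Lemma gibbs_series_lower (m : nat) (c : nat -> 'I_m -> pred nat) (Lam : 'I_m -> R)
    (K : 'I_m -> nat) (y e : R) :
  (forall n i j x, c n i x -> c n j x -> i = j) ->
  (forall i, cell_mass q c n i / ptail q n @[n --> \oo] --> Lam i) ->
  0 < e ->
  (y%:E < \int[mu]_(z in `]0%R, +oo[) (z `^ alpha * (expR (- z) * \prod_i pois (z * Lam i) (K i)))%:E)%E ->
  \forall n \near \oo, ((y * (q n / (1 + e) * gibbs_scale q alpha V n))%:E <=
    \sum_(k <oo) (V k.+1 * iidE q n k.+1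
      (fun s => (sumn s == n)%:R * (cell_count c n K (behead (sort geq s)))%:R))%:E)%E.
Proof.
move=> cd cL e0 yint; have t0 := pmf_tail_gt0 qp pl.
have [C C0 HC] := @cell_prob_small_sum m c.
(* The positive part is there for Fatou's lemma, which needs nonnegative terms; the limit is
   nonnegative, so it is unaffected. *)
pose G n k : R := Num.max 0 (cell_prob q c n k K - C * (k%:R * (n%:R * q n))).
have G0 n k : 0 <= G n k by rewrite /G le_max lexx.
have Gc z : 0 < z -> G n (Num.truncn (z / ptail q n)) @[n --> \oo] -->
    expR (- z) * \prod_i pois (z * Lam i) (K i).
  move=> z0; pose g := expR (- z) * \prod_i pois (z * Lam i) (K i).
  have L0 i : 0 <= Lam i.
    apply: (cvgr_to_ge (cL i)); apply: nearW => n.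
    by rewrite divr_ge0 ?ptail_ge0// sumr_ge0// => x _; rewrite mulr_ge0.
  have g0 : 0 <= g.
    rewrite /g mulr_ge0 ?expR_ge0// prodr_ge0// => i _.
    by rewrite /pois !mulr_ge0 ?expR_ge0 ?exprn_ge0 ?invr_ge0// mulr_ge0 ?(ltW z0).
  have kc : (Num.truncn (z / ptail q n))%:R * ptail q n @[n --> \oo] --> z.
    rewrite [X in X @ _](_ : _ = fun n => (Num.truncn (z / ptail q n)).+1%:R * ptail q n - ptail q n).
      rewrite -[X in _ --> X]subr0; apply: cvgB; last exact: ptail_cvg0.
      exact: (truncnS_cvg t0 (ptail_cvg0 qp)).
    by apply/funext => n; rewrite -natr1; ring.
  have h1 := @cell_prob_cvg _ _ _ _ qp cd t0 _ K _ z cL z0 kc.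
  (* The Markov error vanishes on this scale, since n q_n is negligible against P(X > n). *)
  have h2 : C * ((Num.truncn (z / ptail q n))%:R * (n%:R * q n)) @[n --> \oo] --> (0 : R).
    rewrite -[X in _ --> X](mulr0 C); apply: cvgM; first exact: cvg_cst.
    rewrite [X in X @ _](_ : _ = fun n => (Num.truncn (z / ptail q n))%:R * ptail q n *
        (n%:R * q n / ptail q n)); last first.
      by apply/funext => n; field; rewrite gt_eqF.
    rewrite -[X in _ --> X](mulr0 z); apply: cvgM => //.
    apply/cvgrPdist_le => d d0; have := pmf_small_tail qp pl d0.
    apply: filterS => n hn; rewrite sub0r normrN ger0_norm ?divr_ge0 ?mulr_ge0 ?ptail_ge0//.
    by rewrite ler_pdivrMr.
  have h3 : cell_prob q c n (Num.truncn (z / ptail q n)) K -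
     C * ((Num.truncn (z / ptail q n))%:R * (n%:R * q n)) @[n --> \oo] --> g.
    by rewrite -[X in _ --> X]subr0; apply: cvgB.
  rewrite -/g -(max_r g0) /G; apply: (@cvg_comp _ _ _ _ (fun x : R => Num.max 0 x) \oo (nbhs g) _ h3).
  apply: (@continuous_max R R (fun=> 0) id g); [exact: cst_continuous|exact: cvg_id].
have fat := scaled_sum_fatou alpha (sv_part_ge0 alpha V0) pV t0 (ptail_cvg0 qp) G0 Gc.
have near1 := limn_einf_gt (lt_le_trans yint fat).
have near2 := one_jump_lower c K e0.
have near3 := near_gibbs_scale_gt0 qp pl pV.
near=> n.
have N1 : (y%:E < (ptail q n)%:E * \sum_(k <oo) (scaled_weight alpha L (ptail q n) k * G n k)%:E)%E by near: n.
have N2 : forall k, k.+1%:R * (q n / (1 + e)) *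
    iidE q n k (fun s => (4 * sumn s <= n)%N%:R * (cell_count c n K s)%:R) <=
  iidE q n k.+1 (fun s => (sumn s == n)%:R * (cell_count c n K (behead (sort geq s)))%:R) by near: n.
have [N3 Q0] : 0 < L (inv_trunc (ptail q n)) /\ 0 < gibbs_scale q alpha V n by near: n.
have N4 : forall k (K : 'I_m -> nat),
  cell_prob q c n k K - C * (k%:R * (n%:R * q n)) <=
  iidE q n k (fun s => (4 * sumn s <= n)%N%:R * (cell_count c n K s)%:R) by near: n.
set Q := gibbs_scale q alpha V n in Q0 *.
have e10 : 0 < 1 + e by lra.
have qe0 : 0 <= q n / (1 + e) by rewrite divr_ge0// ltW.
have sw0 k : 0 <= scaled_weight alpha L (ptail q n) k.
  by apply: scaled_weight_ge0; exact: (sv_part_ge0 alpha V0).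
apply: (@le_trans _ _ (\sum_(k <oo) (q n / (1 + e) * Q * ptail q n * (scaled_weight alpha L (ptail q n) k * G n k))%:E)%E).
  under eq_eseriesr => k _ do rewrite EFinM.
  rewrite nneseriesZl; last by move=> k _; rewrite lee_fin mulr_ge0.
  rewrite [X in (_ <= X * _)%E]EFinM -muleA mulrC EFinM; apply: lee_wpmul2l; last exact: ltW.
  by rewrite lee_fin mulr_ge0// ltW.
apply: lee_nneseries => [k _ _|k _].
  rewrite lee_fin; apply: mulr_ge0; last exact: mulr_ge0.
  by apply: mulr_ge0; [apply: mulr_ge0 => //; exact: ltW|exact: ltW].
rewrite lee_fin.
rewrite (_ : _ * _ = V k.+1 * (k.+1%:R * (q n / (1 + e)) * G n k)); last first.
  have := reg_weight_scaled qp pl k N3; rewrite -/Q => h.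
  transitivity (q n / (1 + e) * (Q * (ptail q n * scaled_weight alpha L (ptail q n) k)) * G n k).
    by ring.
  by rewrite -h; ring.
apply: ler_wpM2l => //; apply: le_trans (N2 k); apply: ler_wpM2l.
  by rewrite mulr_ge0.
rewrite /G ge_max N4 andbT; apply: iidE_ge0.
Unshelve. all: by end_near. Qed.

End Jump.
End OneBigJump.

(** * Expectations in the Gibbs model *)

Section GibbsExpectation.
Variable R : realType.
Local Notation mu := (@lebesgue_measure R).

Definition gibbs_term (q V : nat -> R) n (G : seq nat -> R) k : R :=
  V k.+1 * iidE q n k.+1 (fun s => (sumn s == n)%:R * G s).

Lemma gibbs_sumE (w v : nat -> R) n G : gibbs_sum w v n G = rseries (gibbs_term w v n G).
Proof.
rewrite /gibbs_sum; congr rseries; apply/funext => k; rewrite /gibbs_term -iidE_ffun.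
congr (_ * _); rewrite big_mkcond /=; apply: eq_bigr => t _.
have -> : sumn [seq (t i : nat) | i : 'I_k.+1] = (\sum_(i < k.+1) (t i : nat))%N.
  by rewrite sumnE big_image.
by case: eqP => _; rewrite ?mul1r// mul0r mulr0.
Qed.

(** Exponential tilting: each part x contributes W rho^(-x), and on the event of sum n the product
    of these factors is constant. The induction carries rho^(- sumn s) inside the expectation, where
    it still varies. *)
Lemma iidE_rescale (w : nat -> R) (rho W : R) n k (G : seq nat -> R) : rho != 0 -> W != 0 ->
  iidE w n k (fun s => (sumn s == n)%:R * G s) =
  rho ^- n * W ^+ k * iidE (fun j => w j * rho ^+ j / W) n k (fun s => (sumn s == n)%:R * G s).
Proof.
move=> r0 W0.
have gen (H : seq nat -> R) : iidE w n k (fun s => H s) =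
   W ^+ k * iidE (fun j => w j * rho ^+ j / W) n k (fun s => rho ^- sumn s * H s).
  elim: k H => [|k IH] H; first by rewrite /iidE /= expr0 invr1 !mul1r.
  rewrite !iidES big_distrr; apply: eq_bigr => x _ /=.
  rewrite (IH (fun s => H ((x : nat) :: s))).
  have -> : iidE (fun j => w j * rho ^+ j / W) n k (fun s => rho ^- sumn ((x : nat) :: s) * H ((x : nat) :: s)) =
    rho ^- x * iidE (fun j => w j * rho ^+ j / W) n k (fun s => rho ^- sumn s * H ((x : nat) :: s)).
    rewrite -iidEZ; apply: eq_iidE => s _ _ /=.
    by rewrite exprD invfM mulrA.
  by rewrite exprS; field; rewrite W0 expf_neq0.
rewrite gen [_ ^- n * _]mulrC -[RHS]mulrA; congr (_ * _).
rewrite -iidEZ; apply: eq_iidE => s _ _; case: eqP => [->|_]; first by rewrite mul1r mulrC.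
by rewrite !mul0r !mulr0.
Qed.

Lemma gibbs_term_rescale (w v : nat -> R) (rho W : R) n G k : rho != 0 -> W != 0 ->
  gibbs_term w v n G k =
  rho ^- n * gibbs_term (fun j => w j * rho ^+ j / W) (fun j => v j * W ^+ j) n G k.
Proof. by move=> r0 W0; rewrite /gibbs_term (iidE_rescale _ _ _ _ r0 W0); ring. Qed.

Lemma nneseries_EFin (t : nat -> R) : cvgn (series t) ->
  (\sum_(k <oo) (t k)%:E = (limn (series t))%:E)%E.
Proof.
move=> ct; rewrite -EFin_lim//; congr (limn _); apply/funext => n.
by rewrite /= /series /= sumEFin.
Qed.

Section Fixed.
Variables (q V : nat -> R) (n : nat).
Hypothesis q0 : forall j, 0 <= q j.
Hypothesis V0 : forall j, 0 <= V j.
Local Notation U := (gibbs_term q V n (fun=> 1)).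
Hypothesis cU : cvgn (series U).
Hypothesis U0 : 0 < limn (series U).

Definition gexp G : R := limn (series (gibbs_term q V n G)) / limn (series U).

Definition gbounded (G : seq nat -> R) := exists B, forall s, `|G s| <= B.

Lemma le_gibbs_term G H k : (forall s, sumn s = n -> G s <= H s) ->
  gibbs_term q V n G k <= gibbs_term q V n H k.
Proof.
move=> GH; apply: ler_wpM2l => //; apply: le_iidE => // s _ _.
by case: eqP => [sn|_]; rewrite ?mul0r// !mul1r; exact: GH.
Qed.

Lemma gibbs_termZ c G k : gibbs_term q V n (fun s => c * G s) k = c * gibbs_term q V n G k.
Proof.
rewrite /gibbs_term [RHS]mulrCA; congr (_ * _); rewrite -iidEZ.
by apply: eq_iidE => s _ _; ring.
Qed.

Lemma gibbs_termD G H k : gibbs_term q V n (fun s => G s + H s) k =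
  gibbs_term q V n G k + gibbs_term q V n H k.
Proof.
rewrite /gibbs_term -mulrDr; congr (_ * _); rewrite -iidED.
by apply: eq_iidE => s _ _; ring.
Qed.

Lemma gibbs_term_cvg G : gbounded G -> cvgn (series (gibbs_term q V n G)).
Proof.
move=> [B HB]; apply: normed_cvg.
have B0 : 0 <= B by apply: le_trans (HB [::]).
apply: (@series_le_cvg _ _ (fun k => B * U k)) => [k|k|k|].
- exact: normr_ge0.
- by rewrite mulr_ge0// mulr_ge0//; apply: iidE_ge0 => // s; rewrite mulr1.
- rewrite /= -gibbs_termZ ler_norml; apply/andP; split.
    rewrite -mulN1r -gibbs_termZ; apply: le_gibbs_term => s _.
    by have := HB s; rewrite ler_norml mulr1 mulN1r => /andP[].
  apply: le_gibbs_term => s _.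
  by have := HB s; rewrite ler_norml mulr1 => /andP[].
- have -> : series (fun k => B * U k) = B *: series U.
    by rewrite seriesZ.
  exact: is_cvgZr.
Qed.

Lemma gexp_le G H : gbounded G -> gbounded H -> (forall s, sumn s = n -> G s <= H s) ->
  gexp G <= gexp H.
Proof.
move=> bG bH GH; rewrite ler_pM2r ?invr_gt0//; apply: ler_lim.
- exact: gibbs_term_cvg.
- exact: gibbs_term_cvg.
- apply: nearW => m; apply: ler_sum => k _; exact: le_gibbs_term.
Qed.

Lemma gexpZ c G : gbounded G -> gexp (fun s => c * G s) = c * gexp G.
Proof.
move=> bG; rewrite /gexp mulrA; congr (_ / _).
have -> : series (gibbs_term q V n (fun s => c * G s)) = c *: series (gibbs_term q V n G).
  by rewrite -seriesZ; congr series; apply/funext => k; exact: gibbs_termZ.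
by rewrite limZr//; exact: gibbs_term_cvg.
Qed.

Lemma gexpD G H : gbounded G -> gbounded H -> gexp (fun s => G s + H s) = gexp G + gexp H.
Proof.
move=> bG bH; rewrite /gexp -mulrDl; congr (_ / _).
have -> : series (gibbs_term q V n (fun s => G s + H s)) =
   series (gibbs_term q V n G) + series (gibbs_term q V n H).
  by rewrite -seriesD; congr series; apply/funext => k; exact: gibbs_termD.
by apply: limD; exact: gibbs_term_cvg.
Qed.

Lemma gexp1 : gexp (fun=> 1) = 1.
Proof. by rewrite /gexp divff// gt_eqF. Qed.

Lemma gbounded_cst c : gbounded (fun=> c).
Proof. by exists `|c|. Qed.

Lemma gboundedZ c G : gbounded G -> gbounded (fun s => c * G s).
Proof.
by move=> [B HB]; exists (`|c| * B) => s; rewrite normrM ler_wpM2l.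
Qed.

Lemma gboundedD G H : gbounded G -> gbounded H -> gbounded (fun s => G s + H s).
Proof.
move=> [B HB] [D HD]; exists (B + D) => s.
by apply: le_trans (ler_normD _ _) _; exact: lerD.
Qed.

Lemma gexp_sum (I : Type) (r : seq I) (P : pred I) (G : I -> seq nat -> R) : (forall i, gbounded (G i)) ->
  gbounded (fun s => \sum_(i <- r | P i) G i s) /\
  gexp (fun s => \sum_(i <- r | P i) G i s) = \sum_(i <- r | P i) gexp (G i).
Proof.
move=> bG; elim: r => [|i r [IH1 IH2]].
  under [X in gbounded X]eq_fun => s do rewrite big_nil.
  under [X in gexp X]eq_fun => s do rewrite big_nil.
  rewrite big_nil; split; first exact: gbounded_cst.
  rewrite -[RHS](mul0r (gexp (fun=> 1))) -gexpZ; last exact: gbounded_cst.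
  by congr gexp; apply/funext => s; rewrite mul0r.
rewrite big_cons; case Pi : (P i); last first.
  by rewrite (_ : (fun s => _) = fun s => \sum_(i <- r | P i) G i s)//; apply/funext => s; rewrite big_cons Pi.
rewrite (_ : (fun s => _) = fun s => G i s + \sum_(i <- r | P i) G i s); last first.
  by apply/funext => s; rewrite big_cons Pi.
by split; [exact: gboundedD|rewrite gexpD// IH2].
Qed.

End Fixed.

Section Limit.
Variables (q V : nat -> R) (alpha Gam : R).
Hypothesis qp : is_pmf q.
Hypothesis pl : potter_seq (fun j => j%:R * q j).
Hypothesis alpha1 : -1 < alpha.
Hypothesis V0 : forall k, 0 <= V k.
Hypothesis pV : potter_seq (sv_part alpha V).
Hypothesis Gam0 : 0 < Gam.
Hypothesis GamE : (\int[mu]_(z in `]0%R, +oo[) (z `^ alpha * expR (- z))%:E = Gam%:E)%E.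
Local Notation U n := (gibbs_term q V n (fun=> 1)).

Let q0 j : 0 <= q j. Proof. by case: qp. Qed.

Lemma gibbs_term1 n k : U n k = V k.+1 * conv_pow q k.+1 n.
Proof.
by rewrite /gibbs_term /conv_pow; congr (_ * _); apply: eq_iidE => s _ _; rewrite mulr1.
Qed.

Lemma gibbs_normalizer_upper (e : R) : 0 < e -> \forall n \near \oo,
  cvgn (series (U n)) /\
  limn (series (U n)) <= (1 + e) * Gam * (q n * gibbs_scale q alpha V n).
Proof.
move=> e0; have := gibbs_partial_upper qp pl alpha1 V0 pV Gam0 GamE e0.
apply: filterS => n Hn.
have ub m : series (U n) m <= (1 + e) * Gam * (q n * gibbs_scale q alpha V n).
  rewrite /series /= big_mkord; apply: le_trans (Hn m); apply: ler_of_eq.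
  by apply: eq_bigr => k _; exact: gibbs_term1.
have nd : nondecreasing_seq (series (U n)).
  apply/nondecreasing_seqP => i; rewrite seriesSr lerDl gibbs_term1 mulr_ge0//.
  exact: conv_pow_ge0.
have c : cvgn (series (U n)).
  apply: nondecreasing_is_cvgn => //; exists ((1 + e) * Gam * (q n * gibbs_scale q alpha V n)).
  by move=> _ [m _ <-].
split=> //; apply: limr_le => //; exact: nearW.
Qed.

Lemma gibbs_normalizer_gt0 : \forall n \near \oo, cvgn (series (U n)) /\ 0 < limn (series (U n)).
Proof.
(* With no cells the lower bound concerns the whole weight and its integral is [Gam]. *)
pose c (n : nat) (i : 'I_0) : pred nat := xpred0.
have H : ((Gam / 2)%:E < \int[mu]_(z in `]0%R, +oo[)
    (z `^ alpha * (expR (- z) * \prod_(i < 0) pois (z * 0) 0))%:E)%E.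
  under eq_integral => z _ do rewrite big_ord0 mulr1.
  by rewrite GamE lte_fin; have := Gam0; lra.
have cd n i j x : c n i x -> c n j x -> i = j by [].
have cL (i : 'I_0) : cell_mass q c n i / ptail q n @[n --> \oo] --> (0 : R) by case: i.
have near1 := gibbs_series_lower qp pl V0 pV cd cL ltr01 H.
have near2 := gibbs_normalizer_upper ltr01.
have near3 := near_gibbs_scale_gt0 qp pl pV.
have near4 := pmf_near_gt0 pl.
near=> n.
have [cU _] : cvgn (series (U n)) /\
  limn (series (U n)) <= (1 + 1) * Gam * (q n * gibbs_scale q alpha V n) by near: n.
have [_ Q0] : 0 < sv_part alpha V (inv_trunc (ptail q n)) /\ 0 < gibbs_scale q alpha V n by near: n.
have qn0 : 0 < q n by near: n.
split => //; rewrite -lte_fin -nneseries_EFin//.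
have : ((Gam / 2 * (q n / (1 + 1) * gibbs_scale q alpha V n))%:E <=
    \sum_(k <oo) (V k.+1 * iidE q n k.+1
      (fun s => (sumn s == n)%:R * (cell_count c n (fun=> 0%N) (behead (sort geq s)))%:R))%:E)%E by near: n.
move=> h; apply: (@lt_le_trans _ _ (Gam / 2 * (q n / (1 + 1) * gibbs_scale q alpha V n))%:E).
  by rewrite lte_fin; apply: mulr_gt0; [exact: divr_gt0|apply: mulr_gt0 => //; exact: divr_gt0].
apply: (le_trans h); apply: lee_nneseries => [k _ _|k _].
  by rewrite lee_fin mulr_ge0// iidE_ge0// => s; rewrite mulr_ge0.
rewrite lee_fin; apply: ler_wpM2l => //; apply: le_iidE => // s _ _.
by rewrite ler_wpM2l//; case: cell_count.
Unshelve. all: by end_near. Qed.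

Lemma gexp_cells_lower (m : nat) (c : nat -> 'I_m -> pred nat) (Lam : 'I_m -> R)
    (K : 'I_m -> nat) (p y : R) :
  (forall n i j x, c n i x -> c n j x -> i = j) ->
  (forall i, cell_mass q c n i / ptail q n @[n --> \oo] --> Lam i) ->
  (\int[mu]_(z in `]0%R, +oo[) (z `^ alpha * (expR (- z) * \prod_i pois (z * Lam i) (K i)))%:E =
   (Gam * p)%:E)%E -> y < p ->
  \forall n \near \oo, y <= gexp q V n (fun s => (cell_count c n K (behead (sort geq s)))%:R).
Proof.
move=> cd cL pE yp.
pose G n s : R := (cell_count c n K (behead (sort geq s)))%:R.
have bG n : gbounded (G n) by exists 1 => s; rewrite /G; case: cell_count; rewrite ?normr1 ?normr0.
case: (leP y 0) => y0.
  have := gibbs_normalizer_gt0; apply: filterS => n [cU Up]; apply: (le_trans y0).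
  rewrite -(mul0r (gexp q V n (fun=> 1))) -gexpZ//; last exact: gbounded_cst.
  apply: gexp_le => //; [by apply: gboundedZ; exact: gbounded_cst|exact: bG|].
  by move=> s _; rewrite mul0r.
(* The numerator and the normalizer each lose a factor 1 + e; since (1 + e)^2 <= 1 + 3 e, this
   choice gives y (1 + e)^2 <= (y + p) / 2. *)
pose e : R := Num.min 1 ((p - y) / (6 * y)).
have e0 : 0 < e by rewrite /e lt_min ltr01 divr_gt0//; lra.
have e1 : e <= 1 by rewrite /e ge_min lexx.
have ey : 6 * y * e <= p - y.
  have : e <= (p - y) / (6 * y) by rewrite /e ge_min lexx orbT.
  by rewrite ler_pdivlMr; lra.
pose y' := Gam * ((y + p) / 2).
have H : (y'%:E < \int[mu]_(z in `]0%R, +oo[)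
    (z `^ alpha * (expR (- z) * \prod_i pois (z * Lam i) (K i)))%:E)%E.
  by rewrite pE lte_fin ltr_pM2l//; lra.
have near1 := gibbs_series_lower qp pl V0 pV cd cL e0 H.
have near2 := gibbs_normalizer_upper e0.
have near3 := near_gibbs_scale_gt0 qp pl pV.
have near4 := pmf_near_gt0 pl.
have near5 := gibbs_normalizer_gt0.
near=> n.
have [cU Ub] : cvgn (series (U n)) /\
  limn (series (U n)) <= (1 + e) * Gam * (q n * gibbs_scale q alpha V n) by near: n.
have [_ Q0] : 0 < sv_part alpha V (inv_trunc (ptail q n)) /\ 0 < gibbs_scale q alpha V n by near: n.
have qn0 : 0 < q n by near: n.
have [_ Up] : cvgn (series (U n)) /\ 0 < limn (series (U n)) by near: n.
have h : ((y' * (q n / (1 + e) * gibbs_scale q alpha V n))%:E <=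
    \sum_(k <oo) (V k.+1 * iidE q n k.+1
      (fun s => (sumn s == n)%:R * (cell_count c n K (behead (sort geq s)))%:R))%:E)%E by near: n.
rewrite (nneseries_EFin (t := gibbs_term q V n (G n))) ?lee_fin in h; last exact: gibbs_term_cvg.
rewrite /gexp ler_pdivlMr//; apply: le_trans h.
apply: (le_trans (ler_wpM2l (ltW y0) Ub)).
have g0 : 0 < q n * gibbs_scale q alpha V n by exact: mulr_gt0.
rewrite (_ : y * _ = y * (1 + e) * (Gam * (q n * gibbs_scale q alpha V n))); last by ring.
rewrite (_ : y' * _ = (y + p) / 2 / (1 + e) * (Gam * (q n * gibbs_scale q alpha V n))); last by rewrite /y'; ring.
apply: ler_wpM2r; first by rewrite mulr_ge0// ltW.
by rewrite ler_pdivlMr; [nra|lra].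
Unshelve. all: by end_near. Qed.

End Limit.
End GibbsExpectation.

(** * Point measures and grids *)

Section VagueGrid.
Variable R : realType.

(** The cell touching 0 is left out, as a locally finite measure on (0, 1] may have infinite mass
    there; the denominator M + 2 leaves at least one cell for every M. *)
Definition grid_cell (M : nat) (i : nat) : set R :=
  `]i.+1%:R / M.+2%:R, i.+2%:R / M.+2%:R]%classic.

Lemma grid_cell_disj M i j (x : R) : grid_cell M i x -> grid_cell M j x -> i = j.
Proof.
have M0 : 0 < (M.+2%:R : R) by [].
rewrite /grid_cell /= !in_itv /= !ltr_pdivrMr// !ler_pdivlMr// => /andP[a b] /andP[c d].
have h1 := lt_le_trans a d; have h2 := lt_le_trans c b.
move: h1 h2; rewrite !ltr_nat !ltnS => h1 h2.
by apply/eqP; rewrite eqn_leq h1 h2.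
Qed.

Lemma grid_cell_ex M (x : R) : 1 / M.+2%:R < x -> x <= 1 -> exists i : 'I_M.+1, grid_cell M i x.
Proof.
have M0 : 0 < (M.+2%:R : R) by [].
rewrite ltr_pdivrMr// => x1 x2.
pose c := (absz (Num.ceil (x * M.+2%:R))).
have xM : 0 < x * M.+2%:R by lra.
have cE : (c%:R : R) = (Num.ceil (x * M.+2%:R))%:~R.
  rewrite /c natr_absz ger0_norm// -(ler_int R); apply: le_trans (ceil_ge _); exact: ltW.
have c1 : x * M.+2%:R <= c%:R by rewrite cE; exact: ceil_ge.
have c2 : (c%:R : R) < x * M.+2%:R + 1.
  by rewrite cE; have := gt_pred_ceil (x * M.+2%:R); rewrite intrD; lra.
have c3 : (1 < c)%N by rewrite -(ltr_nat R); exact: lt_le_trans c1.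
have c4 : (c < M.+3)%N.
  rewrite -(ltr_nat R); apply: (lt_le_trans c2).
  rewrite -[leRHS]natr1 lerD2r -[leRHS]mul1r; exact: ler_wpM2r.
have iM : (c.-2 < M.+1)%N by move: c3 c4; case: (c) => [|[|n]].
exists (Ordinal iM); rewrite /grid_cell /= in_itv /= ltr_pdivrMr// ler_pdivlMr//.
have cc : c = c.-2.+2 by move: c3; case: (c) => [|[|n]].
rewrite -cc c1 andbT.
have : (c.-2.+1%:R : R) = c%:R - 1 by rewrite {2}cc -natr1; ring.
by move=> ->; lra.
Qed.

Lemma grid_cell_sub M (i : 'I_M.+1) : grid_cell M i `<=` `]0, 1].
Proof.
move=> x; rewrite /grid_cell /= !in_itv /= => /andP[a b]; apply/andP; split.
  by apply: le_lt_trans a; rewrite divr_ge0.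
by apply: (le_trans b); rewrite ler_pdivrMr// mul1r ler_nat !ltnS -ltnS.
Qed.

Lemma measurable_grid_cell M i : measurable (grid_cell M i).
Proof. exact: measurable_itv. Qed.

Lemma integral_step_comb d (T : measurableType d) (nu : {measure set T -> \bar R}) (D : set T)
    (I : finType) (A : I -> set T) (a : I -> R) : measurable D ->
  (forall i, measurable (A i)) -> (forall i, A i `<=` D) -> (forall i, (nu (A i) < +oo)%E) ->
  nu.-integrable D (fun x => (\sum_i a i * \1_(A i) x)%:E) /\
  (\int[nu]_(x in D) (\sum_i a i * \1_(A i) x)%:E)%E = (\sum_i a i * fine (nu (A i)))%:E.
Proof.
move=> mD mA AD fA.
have ii i : nu.-integrable D (fun x => (\1_(A i) x : R)%:E).
  apply/integrableP; split; first by apply/measurable_EFinP; exact: measurable_indic.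
  under eq_integral => x _ do rewrite gee0_abs ?lee_fin//.
  by rewrite integral_indic// setIidl.
have iz i : nu.-integrable D (fun x => (a i)%:E * (\1_(A i) x : R)%:E)%E.
  exact: integrableZl.
have E : (fun x => (\sum_i a i * \1_(A i) x)%:E) = (fun x => \sum_i (a i)%:E * (\1_(A i) x : R)%:E)%E.
  by apply/funext => x; rewrite -sumEFin.
rewrite E; split; first exact: integrable_sum.
rewrite integral_sum// -sumEFin; apply: eq_bigr => i _.
rewrite integralZl// integral_indic// setIidl// EFinM; congr (_ * _)%E.
by rewrite fineK// ge0_fin_numE.
Qed.

(** Heine-Cantor on [r, 1], with compactness used through its near-covering form. *)
Lemma cc01_uniform (f : R -> R) (r : R) : {within `]0, 1], continuous f} -> 0 < r ->
  forall e : R, 0 < e -> exists2 d : R, 0 < d & forall x y, r <= x <= 1 -> r <= y <= 1 ->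
    `|x - y| <= d -> `|f x - f y| <= e.
Proof.
move=> cf r0 e e0.
have cK : compact (`[r, 1]%classic : set R) by exact: segment_compact.
pose P (d x : R) := r <= x <= 1 -> forall y, r <= y <= 1 -> `|x - y| < d -> `|f x - f y| <= e.
have H : \forall d \near 0^'+, `[r, 1]%classic `<=` P d.
  move/compact_near_coveringP : cK; apply.
  move=> x /= xr; rewrite in_itv /= in xr.
  have x01 : `]0%R, 1%R]%classic x by rewrite /= in_itv /=; move/andP: xr => [? ?]; apply/andP; split; lra.
  move/subspace_continuousP : cf => /(_ x x01).
  have e20 : 0 < e / 2 by lra.
  move=> /cvgrPdist_lt /(_ _ e20); rewrite near_withinE => /nbhs_ballP[s /= s0 Hs].
  have s20 : 0 < s / 2 by lra.
  exists (ball x (s / 2), [set d | d < s / 2]).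
    split; first exact: nbhsx_ballx.
    exact: nbhs_right_lt.
  move=> [x' d] /= [xx' ds] x'r y yr x'y.
  have B z : r <= z <= 1 -> `|x - z| < s -> `|f x - f z| < e / 2.
    by move=> zr xz; apply: Hs => //=; rewrite in_itv /=; move/andP: zr => [? ?]; apply/andP; split; lra.
  have h1 := B x' x'r (ltac:(by apply: lt_trans xx' _; lra)).
  have h2 : `|f x - f y| < e / 2.
    apply: B => //; rewrite (_ : x - y = (x - x') + (x' - y)); last by ring.
    apply: (le_lt_trans (ler_normD _ _)); move: xx'; rewrite /ball /= => xx'; lra.
  rewrite (_ : f x' - f y = (f x - f y) - (f x - f x')); last by ring.
  by apply: (le_trans (ler_normB _ _)); lra.
have [d [/= d0 Hd]] : exists d : R, 0 < d /\ `[r, 1]%classic `<=` P d.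
  have := filter_ex (filterI (nbhs_right_gt (0 : R)) H).
  by move=> [d [d0 Hd]]; exists d.
exists (d / 2); first lra.
move=> x y xr yr xy; apply: (Hd x) => //=; lra.
Qed.

(** Agreement of [mu j] with [nu] is needed only on the j-th grid: both integrals are then close to
    the same Riemann sum, and the error is bounded through the mass of [nu] on [e / 4, 1], so no
    bound on [mu j] is required. *)
Lemma vague_cvg_grid (mu : {measure set R -> \bar R} ^nat) (nu : {measure set R -> \bar R}) :
  (forall j, loc_fin_01 (mu j)) -> loc_fin_01 nu ->
  (forall j (i : 'I_j.+1), mu j (grid_cell j i) = nu (grid_cell j i)) -> vague_cvg mu nu.
Proof.
move=> lmu ln eqc f [cf [e0' e0'0 fe0']]; have lnu := proj2 ln.
pose e : R := Num.min e0' 1.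
have e0 : 0 < e by rewrite /e lt_min e0'0 ltr01.
have e1 : e <= 1 by rewrite /e ge_min lexx orbT.
have ee : e <= e0' by rewrite /e ge_min lexx.
have fe x : x < e -> f x = 0.
  by move=> xe; apply: fe0'; rewrite /= in_itv /= => /andP[h _]; lra.
have D01 := measurable_itv `]0%R, 1%R]%R : measurable (`]0%R, 1%R]%classic : set R).
have mf : measurable_fun (`]0%R, 1%R]%classic : set R) f.
  by apply: subspace_continuous_measurable_fun.
have e40 : 0 < e / 4 by lra.
have e20 : 0 < e / 2 by lra.
(* On fine grids the integral of [f] is a Riemann sum up to the modulus of continuity. *)
have approx (eta d : R) : 0 < eta -> (forall x y, e / 2 <= x <= 1 -> e / 2 <= y <= 1 ->
    `|x - y| <= d -> `|f x - f y| <= eta) -> forall M, 1 / M.+2%:R <= d -> 1 / M.+2%:R <= e / 4 ->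
    forall la : {measure set R -> \bar R}, loc_fin_01 la ->
    exists2 I : R, (\int[la]_(x in `]0%R, 1%R]) (f x)%:E = I%:E)%E &
    `|I - \sum_(i < M.+1) f (i.+2%:R / M.+2%:R) * fine (la (grid_cell M i))| <=
      eta * \sum_(i < M.+1 | e / 4 <= i.+1%:R / M.+2%:R) fine (la (grid_cell M i)).
  move=> eta0 Hd M Md Me la lla'; have lla := proj2 lla'.
  have M0 : 0 < (M.+2%:R : R) by [].
  pose t (i : nat) : R := i.+2%:R / M.+2%:R.
  have tE (i : nat) : t i = i.+1%:R / M.+2%:R + 1 / M.+2%:R.
    by rewrite /t -natr1; field; rewrite gt_eqF.
  pose A (i : 'I_M.+1) := grid_cell M i.
  have mA i : measurable (A i) by exact: measurable_grid_cell.
  have AD (i : 'I_M.+1) : A i `<=` `]0, 1] by exact: grid_cell_sub.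
  have fA i : (la (A i) < +oo)%E.
    apply: (le_lt_trans _ (lla (i.+1%:R / M.+2%:R) _)); last by rewrite divr_gt0.
    apply: le_measure; rewrite ?inE//.
    move=> x Ax; have := AD i x Ax; move: Ax; rewrite /A /grid_cell /= !in_itv /=.
    by move=> /andP[/ltW -> _] /andP[_ ->].
  (* With mesh at most e / 4, a point x >= e / 2 lies in such a cell. For x < e / 2 the right end of
     its cell is still below e, so f vanishes at both. *)
  pose S (i : 'I_M.+1) := e / 4 <= i.+1%:R / M.+2%:R.
  have [ig Ig] := integral_step_comb (fun i : 'I_M.+1 => f (t i)) D01 mA AD fA.
  have [ih Ih] := integral_step_comb (fun i : 'I_M.+1 => if S i then eta else 0) D01 mA AD fA.
  pose g (x : R) : R := \sum_(i < M.+1) f (t i) * \1_(A i) x.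
  pose h (x : R) : R := \sum_(i < M.+1) (if S i then eta else 0) * \1_(A i) x.
  have sel (a : 'I_M.+1 -> R) (i : 'I_M.+1) x : A i x -> \sum_j a j * \1_(A j) x = a i.
    move=> Aix; rewrite (bigD1 i)//= indicE mem_set// mulr1 big1 ?addr0// => j ji.
    rewrite indicE memNset ?mulr0// => Ajx; case/eqP: ji; apply/val_inj.
    exact: grid_cell_disj Ajx Aix.
  have fgh x : `]0%R, 1%R]%classic x -> `|f x - g x| <= h x.
    rewrite /= in_itv /= => /andP[x0 x1].
    case: (ltP (1 / M.+2%:R) x) => xM; last first.
      have xe : x < e by apply: (le_lt_trans xM); apply: (le_lt_trans Me); lra.
      rewrite fe//.
      rewrite /g big1 ?subrr ?normr0; last first.
        move=> i _; rewrite indicE memNset ?mulr0// /A /grid_cell /= in_itv /= => /andP[h1 _].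
        have : 1 / M.+2%:R <= i.+1%:R / M.+2%:R :> R by rewrite ler_pM2r ?invr_gt0// ler1n.
        by rewrite leNgt (lt_le_trans h1 xM).
      by rewrite /h sumr_ge0// => i _; rewrite mulr_ge0//; case: ifP => // _; exact: ltW.
    have [i Ai] := grid_cell_ex xM x1.
    rewrite /g /h !(sel _ i)//.
    have := Ai; rewrite /grid_cell /= in_itv /= -/(t i) => /andP[xi1 xi2].
    have ti := tE i.
    have t1 : t i <= 1 by rewrite /t ler_pdivrMr// mul1r ler_nat !ltnS -ltnS.
    move: ti xi1 Me Md; rewrite /S.
    set a := (i.+1%:R / M.+2%:R); set b := (1 / M.+2%:R); clearbody a b => ti xi1 Me Md.
    case: (ltP x (e / 2)) => xe.
      rewrite !fe ?subrr ?normr0; [|lra|lra].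
      by case: ifP => // _; exact: ltW.
    have -> : e / 4 <= a by lra.
    apply: Hd; [by rewrite xe x1|by rewrite t1 andbT; lra|].
    by rewrite distrC ger0_norm; lra.
  have fint : la.-integrable `]0%R, 1%R] (EFin \o f).
    have igh := integrableD D01 (integrable_abse ig) ih.
    apply: (le_integrable D01 _ _ igh); first exact/measurable_EFinP.
    move=> x x01; rewrite /= lee_fin.
    have := fgh x x01; have := ler_normD (f x - g x) (g x); rewrite subrK -/(g x) -/(h x) => h1 h2.
    by rewrite [leRHS]ger0_norm; [lra|have := normr_ge0 (g x); have := normr_ge0 (f x - g x); lra].
  have Ifin := integrable_fin_num D01 fint.
  exists (fine (\int[la]_(x in `]0%R, 1%R]) (f x)%:E)%E); first by rewrite fineK.
  rewrite -lee_fin -abse_EFin EFinB fineK// -Ig -integralB//.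
  apply: (le_trans (le_abse_integral _ D01 _)).
    by have := integrableB D01 fint ig => /integrableP[].
  have -> : (eta * \sum_(i < M.+1 | e / 4 <= i.+1%:R / M.+2%:R) fine (la (grid_cell M i)))%:E =
     (\int[la]_(x in `]0%R, 1%R]) (h x)%:E)%E.
    rewrite Ih big_distrr big_mkcond /=; congr (_%:E); apply: eq_bigr => i _.
    by rewrite /S; case: ifP => _; rewrite ?mul0r.
  apply: ge0_le_integral => //.
  - by apply: measurableT_comp => //; have := integrableB D01 fint ig => /integrableP[].
  - by have /integrableP[] := ih.
have e41 : e / 4 <= 1 by lra.
have nfin : (nu `[(e / 4)%R, 1%R]%classic < +oo)%E by exact: lnu.
pose m := fine (nu `[(e / 4)%R, 1%R]%classic).
have mE : nu `[(e / 4)%R, 1%R]%classic = m%:E by rewrite fineK// ge0_fin_numE.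
have m0 : 0 <= m by rewrite /m fine_ge0.
have Sm M : \sum_(i < M.+1 | e / 4 <= i.+1%:R / M.+2%:R) fine (nu (grid_cell M i)) <= m.
  rewrite -lee_fin -mE -sumEFin.
  pose S (i : 'I_M.+1) : bool := e / 4 <= i.+1%:R / M.+2%:R.
  have -> : (\sum_(i < M.+1 | S i) (fine (nu (grid_cell M i)))%:E =
     \sum_(i < M.+1 | S i) nu (grid_cell M i))%E.
    apply: eq_bigr => i ie; rewrite fineK// ge0_fin_numE//; apply: le_lt_trans nfin.
    apply: le_measure; rewrite ?inE//; first exact: measurable_grid_cell.
    move=> x xc; have := grid_cell_sub xc; move: xc; rewrite /grid_cell /= !in_itv /=.
    by move=> /andP[a _] /andP[_ ->]; rewrite andbT; apply/ltW/(le_lt_trans ie).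
  rewrite -measure_bigsetU_ord_cond; last 2 first.
  - by move=> i _; exact: measurable_grid_cell.
  - by move=> i j _ _ [x [xi xj]]; apply/val_inj; exact: grid_cell_disj xi xj.
  apply: le_measure; rewrite ?inE//.
    by apply: bigsetU_measurable => i _; exact: measurable_grid_cell.
  apply: (big_ind (fun A : set R => A `<=` `[(e / 4)%R, 1%R])) => [//|A B hA hB x [/hA|/hB]//|i ie x xc].
  have := grid_cell_sub xc; move: xc; rewrite /grid_cell /= !in_itv /=.
  by move=> /andP[a _] /andP[_ ->]; rewrite andbT; apply/ltW/(le_lt_trans ie).
have small (d : R) : 0 < d -> \forall M \near \oo, 1 / M.+2%:R <= d.
  move=> d0; exists (Num.truncn d^-1) => // M /= HM.
  rewrite div1r -[leRHS]invrK lef_pV2 ?posrE ?invr_gt0//.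
  apply/ltW/(lt_le_trans (truncnS_gt _)); rewrite ler_nat ltnS; exact: leq_trans HM _.
(* A first pass with tolerance 1 serves only to show that the integrals are eventually finite. *)
have [d1 d10 Hd1] := cc01_uniform cf e20 ltr01.
have [M0 _ HM0] := filterI (small _ d10) (small _ e40).
have [In InE _] := approx 1 d1 ltr01 Hd1 M0 (proj1 (HM0 M0 (leqnn _))) (proj2 (HM0 M0 (leqnn _))) nu ln.
rewrite InE.
apply/fine_cvgP; split.
  exists M0 => // j jM; have [ja jb] := HM0 j jM.
  have [Ij IjE _] := approx 1 d1 ltr01 Hd1 j ja jb (mu j) (lmu j).
  by rewrite IjE.
apply/cvgrPdist_le => eps eps0.
(* Each of the two Riemann sum errors then stays below eps / 2; the + 1 covers m = 0. *)
pose eta := eps / (2 * (m + 1)).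
have eta0 : 0 < eta by rewrite divr_gt0//; lra.
have [d d0 Hd] := cc01_uniform cf e20 eta0.
near=> j.
have jd : 1 / j.+2%:R <= d by near: j; exact: small.
have je : 1 / j.+2%:R <= e / 4 by near: j; exact: small.
have [Ij IjE Bj] := approx eta d eta0 Hd j jd je (mu j) (lmu j).
have [In' InE' Bn] := approx eta d eta0 Hd j jd je nu ln.
have {InE'} InIn : In' = In by apply: EFin_inj; rewrite -InE'.
rewrite InIn in Bn; rewrite /comp IjE /=.
have eqm (i : 'I_j.+1) : fine (mu j (grid_cell j i)) = fine (nu (grid_cell j i)) by rewrite eqc.
pose T := \sum_(i < j.+1) f (i.+2%:R / j.+2%:R) * fine (nu (grid_cell j i)).
pose s := \sum_(i < j.+1 | e / 4 <= i.+1%:R / j.+2%:R) fine (nu (grid_cell j i)).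
have TE : \sum_(i < j.+1) f (i.+2%:R / j.+2%:R) * fine (mu j (grid_cell j i)) = T.
  by apply: eq_bigr => i _; rewrite eqm.
have sE : \sum_(i < j.+1 | e / 4 <= i.+1%:R / j.+2%:R) fine (mu j (grid_cell j i)) = s.
  by apply: eq_bigr => i _; rewrite eqm.
rewrite TE sE in Bj; rewrite -/T -/s in Bn; have sm : s <= m := Sm j.
clearbody T s.
have es : eta * s <= eps / 2.
  apply: (@le_trans _ _ (eta * (m + 1))); first by apply: ler_wpM2l; [exact: ltW|lra].
  by apply: ler_of_eq; rewrite /eta; field; lra.
rewrite (_ : In - Ij = (In - T) - (Ij - T)); last by ring.
by apply: (le_trans (ler_normB _ _)); lra.
Unshelve. all: by end_near. Qed.

End VagueGrid.

(** * Point measures of logarithmic part sizes *)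

Section PointMeasures.
Variable R : realType.

Lemma point_measureE (s : seq R) (A : set R) :
  point_measure s A = (count (mem A) s)%:R%:E.
Proof.
rewrite /point_measure /= /msum; elim: s => [|x s IH] /=; first by rewrite big_ord0.
by rewrite big_ord_recl /= diracE IH natrD EFinD.
Qed.

Definition log_cell (A : set R) (n : nat) : pred nat :=
  fun K => (1 < K)%N && (ln (K%:R : R) / ln n%:R \in A).

Lemma point_measure_gibbs (n : nat) (s : seq nat) (A : set R) :
  point_measure (gibbs_points R n s) A =
  (count (log_cell A n) (behead (sort geq s)))%:R%:E.
Proof.
rewrite point_measureE /gibbs_points count_map count_filter.
by congr (_%:R%:E); apply: eq_count => K /=; rewrite andbC.
Qed.

Lemma loc_fin_point_gibbs (n : nat) (s : seq nat) : (1 < n)%N ->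
  (forall K, K \in s -> (K <= n)%N) -> loc_fin_01 (point_measure (gibbs_points R n s)).
Proof.
move=> n1 sn; split; last by move=> e e0; rewrite point_measure_gibbs ltry.
rewrite point_measure_gibbs (_ : count _ _ = 0%N)//.
rewrite -(count_pred0 (behead (sort geq s))); apply: eq_in_count => K /mem_behead.
rewrite mem_sort => /sn Kn; rewrite /log_cell; case K1 : (1 < K)%N => //=.
have ln0 : 0 < ln (n%:R : R) by rewrite ln_gt0// ltr1n.
apply: memNset => /=; apply; rewrite in_itv /=; apply/andP; split.
  by rewrite divr_gt0// ln_gt0// ltr1n.
by rewrite ler_pdivrMr// mul1r ler_ln ?posrE ?ltr0n ?ler_nat//; lia.
Qed.

(** The condition ln K / ln n in (a, b] means n^a < K <= n^b, and the restriction 1 < K is automatic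
    because n^a > 1. *)
Lemma log_cell_itv (n K : nat) (a b : R) : (1 < n)%N -> 0 < a ->
  log_cell `]a, b] n K = (Num.truncn (n%:R `^ a : R) < K <= Num.truncn (n%:R `^ b : R))%N.
Proof.
move=> n1 a0; rewrite /log_cell.
have ln0 : 0 < ln (n%:R : R) by rewrite ln_gt0// ltr1n.
have n0 : 0 < (n%:R : R) by rewrite ltr0n; lia.
have lnE (t : R) : ln (n%:R `^ t) = t * ln n%:R by rewrite ln_powR.
have p0 (t : R) : 0 < n%:R `^ t by rewrite powR_gt0.
have p1 : 1 < n%:R `^ a.
  by rewrite -ltr_ln ?posrE// ln1 lnE mulr_gt0.
rewrite truncn_lt_nat ?(ltW (p0 a))// truncn_ge_nat ?(ltW (p0 b))//.
case: (ltnP 1 K) => K1 /=; last first.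
  symmetry; apply/negbTE; rewrite negb_and -leNgt; apply/orP; left.
  by apply: le_trans (ltW p1); rewrite lern1.
have K0 : 0 < (K%:R : R) by rewrite ltr0n; lia.
apply/idP/idP; rewrite inE /= in_itv /= ltr_pdivlMr// ler_pdivrMr//.
  by rewrite -!lnE ltr_ln ?ler_ln ?posrE.
by rewrite -!lnE ltr_ln ?ler_ln ?posrE.
Qed.

Lemma cell_mass_log (q : nat -> R) (m : nat) (A : 'I_m -> set R) (i : 'I_m) (n : nat) (a b : R) :
  (1 < n)%N -> 0 < a -> a <= b -> b <= 1 -> A i = `]a, b]%classic ->
  cell_mass q (fun n i => log_cell (A i) n) n i =
  ptail q (Num.truncn (n%:R `^ a : R)) - ptail q (Num.truncn (n%:R `^ b : R)).
Proof.
move=> n1 a0 ab b1 AE; rewrite /cell_mass AE.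
have n1R : 1 <= n%:R :> R by rewrite ler1n; lia.
set s := Num.truncn (n%:R `^ a); set t := Num.truncn (n%:R `^ b).
have st : (s <= t)%N by apply: le_truncn; exact: ler_powR.
have tn : (t <= n)%N.
  rewrite -(ler_nat R) (@le_trans _ _ (n%:R `^ b))// ?truncn_le ?powR_ge0//.
  by rewrite -[leRHS]powRr1//; exact: ler_powR.
rewrite ptail_sub//.
rewrite -(big_mkord xpredT (fun x => (log_cell `]a, b] n x)%:R * q x)).
under eq_bigr => x _ do rewrite log_cell_itv// -/s -/t.
rewrite (@big_cat_nat _ _ _ s.+1 0 n.+1)//= ?ltnS ?(leq_trans st)//.
rewrite (@big_cat_nat _ _ _ t.+1 s.+1 n.+1)//=.
rewrite big_nat big1 ?add0r; last first.
  by move=> x /andP[_ xs]; rewrite ltnNge -ltnS xs mul0r.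
rewrite [X in _ + X]big_nat [X in _ + X]big1 ?addr0; last first.
  by move=> x /andP[tx _]; rewrite [(x <= t)%N]leqNgt tx andbF mul0r.
rewrite big_nat [RHS]big_nat; apply: eq_bigr => x /andP[sx xt].
by rewrite sx -ltnS xt mul1r.
Qed.

Lemma cell_mass_log_cvg (q : nat -> R) (gamma : R) (m : nat) (A : 'I_m -> set R) (i : 'I_m)
    (a b : R) : (\forall n \near \oo, 0 < ptail q n) ->
  (forall t, 0 < t < 1 ->
     ptail q (Num.truncn (n%:R `^ t : R)) / ptail q n @[n --> \oo] --> t `^ (- gamma)) ->
  0 < a -> a <= b -> b <= 1 -> A i = `]a, b]%classic ->
  cell_mass q (fun n i => log_cell (A i) n) n i / ptail q n @[n --> \oo] -->
    a `^ (- gamma) - b `^ (- gamma).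
Proof.
move=> q0 H a0 ab b1 AE.
have H1 t : 0 < t -> t <= 1 ->
    ptail q (Num.truncn (n%:R `^ t : R)) / ptail q n @[n --> \oo] --> t `^ (- gamma).
  (* The tail hypothesis stops short of t = 1, where the ratio is eventually identically 1. *)
  move=> t0; rewrite le_eqVlt => /predU1P[->|t1]; last by apply: H; rewrite t0.
  rewrite powR1; apply: cvg_near_cst; apply: filterS q0 => n qn.
  by rewrite powRr1// natrK divff// gt_eqF.
apply: cvg_trans (cvgB (H1 a a0 (le_trans ab b1)) (H1 b (lt_le_trans a0 ab) b1)).
apply: near_eq_cvg; exists 2%N => // n /= n2.
by rewrite /= (cell_mass_log _ n2 a0 ab b1 AE) mulrBl.
Qed.

(** The point a carries no mass: it lies in [x, a], whose measure tends to 0 as x increases to a by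
    continuity of the power. *)
Lemma measure_half_open (gamma : R) (Lambda : {measure set R -> \bar R}) :
  (forall a b, 0 < a -> a < b -> b <= 1 ->
     Lambda `[a, b]%classic = (a `^ (- gamma) - b `^ (- gamma))%:E) ->
  forall a b, 0 < a -> a < b -> b <= 1 ->
     Lambda `]a, b]%classic = (a `^ (- gamma) - b `^ (- gamma))%:E.
Proof.
move=> H a b a0 ab b1.
have a1 : a <= 1 by lra.
have z : Lambda [set a] = 0%E.
  apply/eqP; rewrite eq_le measure_ge0 andbT; apply/lee_addgt0Pr => e e0.
  rewrite add0e.
  have [x [x0 xa xe]] : exists x, [/\ 0 < x, x < a & x `^ (- gamma) - a `^ (- gamma) <= e].
    have : {for a, continuous (fun x : R => x `^ (- gamma))} by exact: is_derive_continuous (is_derive1_powR _ a0).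
    move=> /cvgrPdist_le /(_ _ e0) Hn.
    have Hl : \forall x \near a^'-, `|a `^ (- gamma) - x `^ (- gamma)| <= e.
      by apply: filterS Hn => x hx _.
    have [x [[h1 h2] h3]] := filter_ex (filterI (filterI (nbhs_left_lt a) (nbhs_left_gt a0)) Hl).
    by exists x; split => //; rewrite (le_trans (ler_norm _))// distrC.
  apply: (@le_trans _ _ (Lambda `[x, a]%classic)).
    apply: le_measure; rewrite ?inE//.
    by move=> y /= ->; rewrite in_itv /= lexx ltW.
  by rewrite H// lee_fin.
rewrite -H// -[LHS]add0e -{1}z -measureU//.
- by rewrite setU1itv// bnd_simp ltW.
- by apply/seteqP; split => // y [/= ->]; rewrite in_itv /= ltxx.
Qed.

End PointMeasures.

Lemma sum_pois (R : realType) (r : R) : 0 <= r -> (\sum_(k <oo) (pois r k)%:E = 1)%E.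
Proof.
move=> r0.
have E : series (pois r) = expR (- r) *: series (exp_coeff r).
  rewrite -seriesZ; congr series; apply/funext => k /=.
  by rewrite /pois /exp_coeff /= mulrC.
have c := is_cvg_series_exp_coeff r.
rewrite nneseries_EFin; last by rewrite E; exact: is_cvgZr.
rewrite E limZr// -[limn _]/(expR r).
by congr (_%:E); rewrite /GRing.scale /= -expRD addNr expR0.
Qed.

(** * The Cox process *)

Section CoxProcess.
Variables (R : realType) (d : measure_display) (Omega : measurableType d).
Variables (P : probability Omega R) (xi : Omega -> {measure set R -> \bar R}) (Z : Omega -> R).
Variables (Lambda : {measure set R -> \bar R}) (alpha : R).
Hypothesis coxP : cox_gamma P xi Z Lambda alpha.
Local Notation mu := (@lebesgue_measure R).
Local Notation Gam := (gamma_const alpha).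

Lemma measurable_gamma_pois (m : nat) (l : 'I_m -> R) (k : 'I_m -> nat) (D : set R) :
  measurable_fun D (fun z => (gamma_dens alpha z * \prod_i pois (z * l i) (k i))%:E).
Proof.
apply/measurable_EFinP; apply: measurable_funTS; apply: measurable_funM.
  apply: measurable_funM => //; apply: measurable_funM; first exact: measurable_powR.
  by apply: measurableT_comp => //; exact: measurableT_comp.
apply: measurable_prod => i _; apply: measurable_funM.
  by apply: measurable_funM => //; apply: measurable_funX; exact: measurable_funM.
apply: measurableT_comp => //; apply: measurableT_comp => //; exact: measurable_funM.
Qed.

(** Read off the Cox hypothesis with no sets and B the whole line: the density integrates to 1. This
    excludes a zero constant, and with it a divergent integral, on which [fine] would return 0. *)
Lemma gamma_const_gt0 : 0 < Gam /\
  (\int[mu]_(z in `]0%R, +oo[) (z `^ alpha * expR (- z))%:E = Gam%:E)%E.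
Proof.
have [_ [_ [_ /(_ 0%N (fun=> set0) (fun=> 0%N) setT measurableT)]]] := coxP.
move=> /(_ (ltac:(by case))) /(_ (ltac:(by exists 1 => // -[]))) /(_ (ltac:(by case))).
rewrite preimage_setT !setTI (_ : [set w | _] = setT); last by apply/seteqP; split => // w _ [].
rewrite probability_setT => H.
have I0 : (0 <= \int[mu]_(z in `]0%R, +oo[) (z `^ alpha * expR (- z))%:E)%E.
  by apply: integral_ge0 => z _; rewrite lee_fin mulr_ge0 ?powR_ge0 ?expR_ge0.
have G0 : Gam != 0.
  apply/eqP => G0; move: H; under eq_integral => z _ do rewrite /gamma_dens G0 invr0 mulr0 mul0r.
  by rewrite integral0 => /eqP; rewrite onee_eq0.
have I1 : (\int[mu]_(z in `]0%R, +oo[) (z `^ alpha * expR (- z))%:E = Gam%:E)%E.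
  move: G0 I0; rewrite /gamma_const; case: integral => [r| |] //=; by rewrite eqxx.
by split => //; rewrite lt_neqAle eq_sym G0 -lee_fin -I1.
Qed.

Lemma gamma_dens_ge0 z : 0 <= gamma_dens alpha z.
Proof.
have [G0 _] := gamma_const_gt0.
by rewrite /gamma_dens divr_ge0 ?(ltW G0)// mulr_ge0 ?powR_ge0 ?expR_ge0.
Qed.

Lemma pois_ge0 (r : R) k : 0 <= r -> 0 <= pois r k.
Proof. by move=> r0; rewrite /pois mulr_ge0 ?expR_ge0// divr_ge0 ?exprn_ge0. Qed.

Lemma cox_cells_prob (m : nat) (A : 'I_m -> set R) (k : 'I_m -> nat) :
  (forall i, measurable (A i)) -> (exists2 e, 0 < e & forall i, A i `<=` `[e, 1]%classic) ->
  (forall i j, i != j -> A i `&` A j = set0) ->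
  P [set w | forall i, xi w (A i) = ((k i)%:R)%:E] =
  (\int[mu]_(z in `]0%R, +oo[)
     (gamma_dens alpha z * \prod_i pois (z * fine (Lambda (A i))) (k i))%:E)%E.
Proof.
move=> mA sA dA; have [_ [_ [_ H]]] := coxP.
by have := H m A k setT measurableT mA sA dA; rewrite preimage_setT !setTI.
Qed.

Lemma measurable_cox_cells (m : nat) (A : 'I_m -> set R) (k : 'I_m -> nat) :
  (forall i, measurable (A i)) -> measurable [set w | forall i, xi w (A i) = ((k i)%:R)%:E].
Proof.
move=> mA; have [_ [mxi _]] := coxP.
rewrite (_ : [set w | _] = \bigcap_(i in [set: 'I_m]) ((xi ^~ (A i)) @^-1` [set ((k i)%:R)%:E])).
  apply: fin_bigcap_measurable => // i _; rewrite -[X in measurable X]setTI; exact: mxi.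
by apply/seteqP; split => w /= h i; [move=> _|]; apply: h.
Qed.

Lemma cox_cells_integral (m : nat) (A : 'I_m -> set R) (k : 'I_m -> nat) :
  (forall i, measurable (A i)) -> (exists2 e, 0 < e & forall i, A i `<=` `[e, 1]%classic) ->
  (forall i j, i != j -> A i `&` A j = set0) ->
  (\int[mu]_(z in `]0%R, +oo[)
     (z `^ alpha * (expR (- z) * \prod_i pois (z * fine (Lambda (A i))) (k i)))%:E)%E =
  (Gam * fine (P [set w | forall i, xi w (A i) = ((k i)%:R)%:E]))%:E.
Proof.
move=> mA sA dA; have [G0 _] := gamma_const_gt0.
rewrite EFinM [(fine (P _))%:E]fineK ?fin_num_measure//; last exact: measurable_cox_cells.
rewrite cox_cells_prob// -ge0_integralZl//.
- apply: eq_integral => z _; rewrite -EFinM; congr (_%:E); rewrite /gamma_dens.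
  by have algE (a b p : R) : a * (b * p) = Gam * (a * b / Gam * p);
    [field; rewrite gt_eqF|exact: algE].
- exact: measurable_gamma_pois.
- move=> z /=; rewrite in_itv/= andbT => z0; rewrite lee_fin mulr_ge0 ?gamma_dens_ge0//.
  by apply: prodr_ge0 => i _; apply: pois_ge0; rewrite mulr_ge0 ?(ltW z0)// fine_ge0.
- by rewrite lee_fin ltW.
Qed.

(** [cox_gamma] does not state that counts are integers, while [has_cells] needs natural numbers;
    hence this event. *)
Definition integral_valued (A : set R) : set Omega :=
  [set w | exists k : nat, xi w A = k%:R%:E].

Lemma measurable_integral_valued (A : set R) : measurable A -> measurable (integral_valued A).
Proof.
move=> mA; have [_ [mxi _]] := coxP.
rewrite (_ : integral_valued A = \bigcup_k ((xi ^~ A) @^-1` [set (k%:R)%:E])).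
  apply: bigcupT_measurable => k; rewrite -[X in measurable X]setTI; exact: mxi.
by apply/seteqP; split => w /= [k]; [exists k|exists k].
Qed.

(** Summing the prescribed probabilities over all k, the Poisson weights add up to 1 for each z and
    the Gamma density integrates to 1. *)
Lemma integral_valued_ae (A : set R) : measurable A ->
  (exists2 e, 0 < e & A `<=` `[e, 1]%classic) -> P (~` integral_valued A) = 0%E.
Proof.
move=> mA [e e0 sA]; rewrite probability_setC; last exact: measurable_integral_valued.
have [_ [mxi _]] := coxP.
have [G0 GI] := gamma_const_gt0.
suff -> : P (integral_valued A) = 1%E by rewrite subee.
rewrite (_ : integral_valued A = \bigcup_k ((xi ^~ A) @^-1` [set (k%:R)%:E])); last first.
  by apply/seteqP; split => w /= [k]; [exists k|exists k].
rewrite measure_bigcup//; last 2 first.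
- by move=> k _; rewrite -[X in measurable X]setTI; exact: mxi.
- apply/trivIsetP => i j _ _ ij; apply/seteqP; split => // w [/= -> [/eqP]].
  by rewrite eqr_nat (negbTE ij).
have pk k : P ((xi ^~ A) @^-1` [set (k%:R)%:E]) =
    (\int[mu]_(z in `]0%R, +oo[) ((gamma_dens alpha z)%:E * (pois (z * fine (Lambda A)) k)%:E))%E.
  have := @cox_cells_prob 1 (fun=> A) (fun=> k) (fun=> mA).
  rewrite (_ : [set w | _] = (xi ^~ A) @^-1` [set (k%:R)%:E]); last first.
    by apply/seteqP; split => w /=; [apply; exact: ord0|].
  move=> ->; [|by exists e|by move=> i j; rewrite !ord1].
  by apply: eq_integral => z _; rewrite big_ord1 EFinM.
have m1 k : measurable_fun (`]0%R, +oo[%classic : set R)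
    (fun z => ((gamma_dens alpha z)%:E * (pois (z * fine (Lambda A)) k)%:E)%E).
  have := @measurable_gamma_pois 1 (fun=> fine (Lambda A)) (fun=> k) (`]0%R, +oo[%classic : set R).
  by apply: eq_measurable_fun => z _; rewrite big_ord1 EFinM.
under eq_eseriesl => k do rewrite in_setT.
rewrite (eq_eseriesr (fun k _ => pk k)).
rewrite -integral_nneseries//; last first.
  move=> k z /=; rewrite in_itv/= andbT => z0.
  by rewrite mule_ge0 ?lee_fin ?gamma_dens_ge0// pois_ge0// mulr_ge0 ?fine_ge0// ltW.
under eq_integral => z.
  rewrite inE /= in_itv/= andbT => z0.
  rewrite nneseriesZl; last by move=> k _; rewrite lee_fin pois_ge0// mulr_ge0 ?fine_ge0// ltW.
  rewrite sum_pois ?mule1; last by rewrite mulr_ge0 ?fine_ge0// ltW.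
  over.
have : (Gam%:E * \int[mu]_(z in `]0%R, +oo[) (gamma_dens alpha z)%:E = Gam%:E)%E.
  rewrite -ge0_integralZl//.
  - rewrite -[RHS]GI; apply: eq_integral => z _; rewrite -EFinM; congr (_%:E).
    by rewrite /gamma_dens mulrC divfK// gt_eqF.
  - have := @measurable_gamma_pois 0 (fun=> 0) (fun=> 0%N) (`]0%R, +oo[%classic : set R).
    by apply: eq_measurable_fun => z _; rewrite big_ord0 mulr1.
  - by move=> z _; rewrite lee_fin gamma_dens_ge0.
  - by rewrite lee_fin ltW.
case: integral => [r /eqP| |]/=.
- rewrite -EFinM eqe => /eqP h; congr (_%:E).
  by apply: (mulfI (lt0r_neq0 G0)); rewrite mulr1.
- by rewrite gt0_muley ?lte_fin.
- by rewrite gt0_muleNy ?lte_fin.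
Qed.

End CoxProcess.

(** * Integrals of possibly non-measurable functions and null sets *)

Section NonMeasurableIntegral.
Import HBNNSimple.
Variables (R : realType) (d : measure_display) (T : measurableType d).
Variables (mu : {measure set T -> \bar R}) (E : set T).
Hypotheses (mE : measurable E) (E0 : mu (~` E) = 0%E).

Let ge0_integral_le (f g : T -> \bar R) : (forall x, 0 <= f x)%E -> (forall x, 0 <= g x)%E ->
  (forall x, E x -> f x = g x) -> (\int[mu]_x f x <= \int[mu]_x g x)%E.
Proof.
move=> f0 g0 fg; rewrite ge0_integralTE// [leRHS]ge0_integralTE//.
apply: ub_ereal_sup => _ [h hf <-].
have pE x : proj_nnsfun h mE x = h x * (x \in E)%:R by [].
apply: ereal_sup_ubound.
exists (proj_nnsfun h mE).
  move=> x; rewrite pE; case: (pselect (E x)) => Ex.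
    by rewrite mem_set// mulr1 -fg.
  by rewrite memNset// mulr0.
rewrite -!integralT_nnsfun; apply: ae_eq_integral => //.
- by apply/measurable_EFinP.
- by apply/measurable_EFinP.
exists (~` E); split => //; first exact: measurableC.
by move=> x nEq Ex; apply: nEq => _; have := pE x; rewrite mem_set// mulr1 => pEx; congr EFin.
Qed.

(* The library's integral of a possibly non-measurable function is a supremum over simple functions
   below it; restricting these to [E] shows that it does not see the null set [~` E]. *)
Lemma integral_eq_off_null (f g : T -> \bar R) : (forall x, E x -> f x = g x) ->
  (\int[mu]_x f x = \int[mu]_x g x)%E.
Proof.
move=> fg; rewrite [LHS]integralE [RHS]integralE.
by congr (_ - _)%E; apply/eqP; rewrite eq_le; apply/andP; split; apply: ge0_integral_le => //
  x Ex; rewrite unlock fg.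
Qed.

End NonMeasurableIntegral.

Lemma measurable_fun_limn_einf (R : realType) (d : measure_display) (T : measurableType d) (D : set T)
  (f : (T -> \bar R) ^nat) : (forall n, measurable_fun D (f n)) ->
  measurable_fun D (fun x => limn_einf (f ^~ x)).
Proof.
move=> mf; apply: measurableT_comp => //; apply: (@measurable_fun_limn_esup _ _ _ _ (fun n x => - f n x)%E) => n.
exact: measurableT_comp.
Qed.


(** * Approximation of functionals from below by functions of the cell counts *)

Section CellFunctionals.
Variable R : realType.

Definition has_cells (M : nat) (K : 'I_M.+1 -> nat) (nu : {measure set R -> \bar R}) : Prop :=
  loc_fin_01 nu /\ forall i : 'I_M.+1, nu (grid_cell M i) = (K i)%:R%:E.

(** The best lower approximation of a nonnegative [G] by a function of the counts. If no measure
    realizes the counts, the infimum of the empty set is 0, which preserves nonnegativity. *)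
Definition cell_inf (G : {measure set R -> \bar R} -> R) (M : nat) (K : 'I_M.+1 -> nat) : R :=
  inf [set G nu | nu in [set nu | has_cells K nu]].

Variable G : {measure set R -> \bar R} -> R.
Hypothesis G0 : forall nu, 0 <= G nu.

Lemma cell_inf_ge0 M (K : 'I_M.+1 -> nat) : 0 <= cell_inf G K.
Proof. rewrite /cell_inf; set S := [set G nu | nu in _].
have [->|S0] := eqVneq S set0; first by rewrite inf0.
by apply: lb_le_inf => [|_ [nu _ <-]//]; exact/set0P. Qed.

Lemma cell_inf_le M (K : 'I_M.+1 -> nat) nu : has_cells K nu -> cell_inf G K <= G nu.
Proof.
by move=> h; apply: ge_inf; [exists 0 => _ [la _ <-]|exists nu].
Qed.

Hypothesis Gcont : forall (mu : {measure set R -> \bar R} ^nat) nu,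
  (forall j, loc_fin_01 (mu j)) -> loc_fin_01 nu -> vague_cvg mu nu -> G (mu j) @[j --> \oo] --> G nu.

(** Near-minimizers share the grid counts of [nu], so they converge vaguely to it by
    [vague_cvg_grid], and continuity of [G] carries their values to [G nu]. *)
Lemma cell_inf_cvg (nu : {measure set R -> \bar R}) (K : forall M, 'I_M.+1 -> nat) :
  (forall M, has_cells (K M) nu) -> cell_inf G (K M) @[M --> \oo] --> G nu.
Proof.
move=> hK.
have ex M : exists la, has_cells (K M) la /\ G la < cell_inf G (K M) + M.+1%:R^-1.
  have hi : has_inf [set G la | la in [set la | has_cells (K M) la]].
    by split; [exists (G nu); exists nu => //; exact: hK|exists 0 => _ [la _ <-]].
  by have [] := @inf_adherent _ _ M.+1%:R^-1 _ hi => // _ [la hla <-] lt; exists la.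
have [la hla] := choice ex.
have cG : G (la M) @[M --> \oo] --> G nu.
  apply: Gcont; [by move=> j; have [[]] := hla j|by have [] := hK 0%N|].
  apply: vague_cvg_grid; [by move=> j; have [[]] := hla j|by have [] := hK 0%N|].
  by move=> j i; have [[_ ->] _] := hla j; have [_ ->] := hK j.
apply: (@squeeze_cvgr _ _ _ _ (fun M => G (la M) - M.+1%:R^-1) (fun=> G nu)).
- by apply: nearW => M; rewrite lerBlDr (ltW (proj2 (hla M)))/= cell_inf_le.
- by rewrite -[X in _ --> X]subr0; apply: cvgB => //; exact: cvg_harmonic.
- exact: cvg_cst.
Qed.

Lemma cell_sum_pointwise (M B : nat) (nu : {measure set R -> \bar R}) (n : 'I_M.+1 -> nat) :
  has_cells n nu ->
  \sum_(K : {ffun 'I_M.+1 -> 'I_B}) @cell_inf G M (fun i => K i) * [forall i, n i == K i :> nat]%:R =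
  if [forall i, (n i < B)%N] then cell_inf G n else 0.
Proof.
move=> hn; case: ifPn => [/forallP nB|nB].
  pose K0 : {ffun 'I_M.+1 -> 'I_B} := [ffun i => Ordinal (nB i)].
  have K0E : (fun i => K0 i : nat) = n by apply/funext => i; rewrite ffunE.
  rewrite (bigD1 K0)//= big1 ?addr0; last first.
    move=> K KK0; rewrite (_ : [forall i, _] = false) ?mulr0//.
    apply/negP => /forallP h; case/eqP: KK0; apply/ffunP => i; apply/val_inj.
    by rewrite ffunE /=; apply/esym/eqP/h.
  rewrite (_ : [forall i, _] = true) ?mulr1 ?K0E//.
  by apply/forallP => i; rewrite ffunE.
rewrite big1// => K _; rewrite (_ : [forall i, _] = false) ?mulr0//.
apply/negP => /forallP h; case/negP: nB; apply/forallP => i.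
by rewrite (eqP (h i)).
Qed.

End CellFunctionals.

Lemma limn_einf_ge0 (R : realType) (u : (\bar R) ^nat) :
  (forall n, 0 <= u n)%E -> (0 <= limn_einf u)%E.
Proof.
move=> u0; rewrite limn_einf_lim; apply: lime_ge; first exact: is_cvg_einfs.
by apply: nearW => n; apply: le_ereal_inf_tmp => _ [k _ <-].
Qed.

(** * Convergence *)

Section GibbsLimit.
Variables (R : realType) (q V : nat -> R) (alpha gamma : R).
Hypothesis qp : is_pmf q.
Hypothesis pl : potter_seq (fun j => j%:R * q j).
Hypothesis alpha1 : -1 < alpha.
Hypothesis V0 : forall k, 0 <= V k.
Hypothesis pV : potter_seq (sv_part alpha V).
Hypothesis ratio : forall t, 0 < t < 1 ->
  ptail q (Num.truncn (n%:R `^ t : R)) / ptail q n @[n --> \oo] --> t `^ (- gamma).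
Variables (d : measure_display) (Omega : measurableType d) (P : probability Omega R).
Variables (xi : Omega -> {measure set R -> \bar R}) (Z : Omega -> R).
Variable Lambda : {measure set R -> \bar R}.
Hypothesis LambdaE : forall a b, 0 < a -> a < b -> b <= 1 ->
  Lambda `[a, b]%classic = (a `^ (- gamma) - b `^ (- gamma))%:E.
Hypothesis coxP : cox_gamma P xi Z Lambda alpha.

Local Notation gibbs_mean G := (fun n => gexp q V n (fun s => G (point_measure (gibbs_points R n s)))).

Let q0 j : 0 <= q j. Proof. by case: qp. Qed.

Let good : \forall n \near \oo, cvgn (series (gibbs_term q V n (fun=> 1))) /\
  0 < limn (series (gibbs_term q V n (fun=> 1))).
Proof.
have [G0 GE] := gamma_const_gt0 coxP.
exact: gibbs_normalizer_gt0 qp pl alpha1 V0 pV G0 GE.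
Qed.

Lemma has_cells_gibbs (M n : nat) (s : seq nat) : (1 < n)%N -> sumn s = n ->
  has_cells (fun i : 'I_M.+1 => count (log_cell (grid_cell M i : set R) n) (behead (sort geq s)))
    (point_measure (gibbs_points R n s)).
Proof.
move=> n1 sn; split; last by move=> i; exact: point_measure_gibbs.
by apply: loc_fin_point_gibbs => // K /mem_le_sumn; rewrite sn.
Qed.

Definition cells_event (M : nat) (K : 'I_M.+1 -> nat) : set Omega :=
  [set w | forall i : 'I_M.+1, xi w (grid_cell M i) = (K i)%:R%:E].

Let cell_bounds M : exists2 e : R, 0 < e & forall i : 'I_M.+1, grid_cell M i `<=` `[e, 1]%classic.
Proof.
exists (1 / M.+2%:R); first by rewrite divr_gt0.
move=> i x xc; have := grid_cell_sub xc; move: xc; rewrite /grid_cell /= !in_itv /=.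
move=> /andP[a _] /andP[_ ->]; rewrite andbT; apply/ltW/(le_lt_trans _ a).
by rewrite ler_pM2r ?invr_gt0// ler1n.
Qed.

Let cell_disj M (i j : 'I_M.+1) : i != j -> grid_cell M i `&` grid_cell M j = set0 :> set R.
Proof.
move=> ij; apply/seteqP; split => // x [xi1 xj]; case/eqP: ij; apply/val_inj.
exact: grid_cell_disj xi1 xj.
Qed.

Let measurable_cells_event M (K : 'I_M.+1 -> nat) : measurable (cells_event K).
Proof. by apply: (measurable_cox_cells coxP) => i; exact: measurable_grid_cell. Qed.

Lemma gexp_cells_event (M : nat) (K : 'I_M.+1 -> nat) (y : R) : y < fine (P (cells_event K)) ->
  \forall n \near \oo, y <= gexp q V n (fun s =>
    [forall i : 'I_M.+1, count (log_cell (grid_cell M i : set R) n) (behead (sort geq s)) == K i]%:R).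
Proof.
move=> yp; have [G0 GE] := gamma_const_gt0 coxP.
have mc (i : 'I_M.+1) : measurable (grid_cell M i : set R) by exact: measurable_grid_cell.
have M0 : 0 < (M.+2%:R : R) by [].
have ab (i : 'I_M.+1) : (i.+1%:R / M.+2%:R : R) < i.+2%:R / M.+2%:R.
  by rewrite ltr_pM2r ?invr_gt0// ltr_nat.
have a0 (i : 'I_M.+1) : 0 < (i.+1%:R / M.+2%:R : R) by rewrite divr_gt0.
have b1 (i : 'I_M.+1) : (i.+2%:R / M.+2%:R : R) <= 1.
  by rewrite ler_pdivrMr// mul1r ler_nat !ltnS -ltnS.
apply: (gexp_cells_lower qp pl alpha1 V0 pV G0 GE (c := fun n (i : 'I_M.+1) => log_cell (grid_cell M i : set R) n)
  (Lam := fun i : 'I_M.+1 => fine (Lambda (grid_cell M i))) _ _ _ yp).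
- move=> n i j x /andP[_ /set_mem h1] /andP[_ /set_mem h2]; apply/val_inj.
  exact: grid_cell_disj h1 h2.
- move=> i; rewrite (measure_half_open LambdaE)//=.
  apply: (@cell_mass_log_cvg _ _ _ _ (fun i : 'I_M.+1 => grid_cell M i)) => //; last exact: ltW.
  by apply: nearW => n; apply: ptail_gt0 => //; exact: pmf_near_gt0.
- exact: (cox_cells_integral coxP K mc (cell_bounds M) (@cell_disj M)).
Qed.

Definition integral_event : set Omega :=
  [set w | forall M (i : 'I_M.+1), integral_valued xi (grid_cell M i) w].

(** Indexed by all naturals, with empty sets beyond the grid, so that the exceptional event is a
    countable union. *)
Let bad M i : set Omega := if (i < M.+1)%N then ~` integral_valued xi (grid_cell M i) else set0.

Let integral_eventC : ~` integral_event = \bigcup_M \bigcup_i bad M i.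
Proof.
apply/seteqP; split => w.
  move=> /existsNP[M /existsNP[i hi]]; exists M => //; exists i => //.
  by rewrite /bad ltn_ord.
move=> [M _ [i _]]; rewrite /bad; case: ifPn => // iM hi H.
by apply: hi; exact: (H M (Ordinal iM)).
Qed.

Let measurable_bad M i : measurable (bad M i).
Proof.
rewrite /bad; case: ifPn => // iM; apply: measurableC.
by apply: (measurable_integral_valued coxP); exact: measurable_grid_cell.
Qed.

Lemma measurable_integral_event : measurable integral_event.
Proof.
rewrite -[integral_event]setCK integral_eventC; apply: measurableC.
by apply: bigcupT_measurable => M; apply: bigcupT_measurable => i.
Qed.

Lemma integral_event_ae : P (~` integral_event) = 0%E.
Proof.
apply: measure_negligible; first exact/measurableC/measurable_integral_event.
rewrite integral_eventC; apply: negligible_bigcup => M; apply: negligible_bigcup => i.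
apply/negligibleP => //; rewrite /bad; case: ifPn => // iM.
apply: (integral_valued_ae coxP); first exact: measurable_grid_cell.
have [e e0 h] := cell_bounds M; exists e => //; exact: (h (Ordinal iM)).
Qed.

Section LowerBound.
Variables (G : {measure set R -> \bar R} -> R) (C : R).
Hypothesis G0 : forall nu, 0 <= G nu.
Hypothesis GC : forall nu, G nu <= C.

Lemma gexp_cell_inf_lower (M B : nat) (y : R) :
  y < \sum_(K : {ffun 'I_M.+1 -> 'I_B})
        @cell_inf R G M (fun i => K i) * fine (P (@cells_event M (fun i => K i))) ->
  \forall n \near \oo, y <= gibbs_mean G n.
Proof.
set g := fun K : {ffun 'I_M.+1 -> 'I_B} => @cell_inf R G M (fun i => K i).
set p := fun K : {ffun 'I_M.+1 -> 'I_B} => fine (P (@cells_event M (fun i => K i))).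
rewrite -/(\sum_K g K * p K) => yS.
have g0 K : 0 <= g K by exact: cell_inf_ge0.
have s0 : 0 < \sum_K g K + 1 by rewrite ltr_wpDl// sumr_ge0.
(* Lowering every probability by [eta] costs eta times the sum of the g K, which is less than the
   available gap; the + 1 avoids a zero denominator. *)
pose eta := (\sum_K g K * p K - y) / (\sum_K g K + 1).
have eta0 : 0 < eta by rewrite divr_gt0// subr_gt0.
pose I n (K : {ffun 'I_M.+1 -> 'I_B}) (s : seq nat) : R :=
  [forall i : 'I_M.+1, count (log_cell (grid_cell M i : set R) n) (behead (sort geq s)) == K i :> nat]%:R.
have bI n K : gbounded (I n K).
  by exists 1 => s; rewrite /I; case: [forall _, _]; rewrite ?normr1 ?normr0.
have near1 : \forall n \near \oo, forall K, p K - eta <= gexp q V n (I n K).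
  apply: filter_forall => K; apply: gexp_cells_event.
  by rewrite -/(p K); lra.
have near2 := good.
near=> n.
have [cU U0] : cvgn (series (gibbs_term q V n (fun=> 1))) /\
  0 < limn (series (gibbs_term q V n (fun=> 1))) by near: n.
have pI : forall K, p K - eta <= gexp q V n (I n K) by near: n.
have n1 : (1 < n)%N by near: n; exists 2%N.
have bZ K : gbounded (fun s => g K * I n K s) by apply: gboundedZ.
have [bS gS] := gexp_sum q0 V0 cU (index_enum _) xpredT bZ.
have bG : gbounded (fun s => G (point_measure (gibbs_points R n s))).
  by exists C => s; rewrite ger0_norm.
apply: (le_trans _ (gexp_le q0 V0 cU U0 bS bG _)); last first.
  move=> s sn; have hc := has_cells_gibbs M n1 sn.
  rewrite /g /I (cell_sum_pointwise _ _ hc).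
  by case: ifP => _; [exact: cell_inf_le|].
rewrite gS; apply: (@le_trans _ _ (\sum_K g K * (p K - eta))); last first.
  by apply: ler_sum => K _; rewrite gexpZ// ler_wpM2l.
have -> : \sum_K g K * (p K - eta) = \sum_K g K * p K - eta * \sum_K g K.
  by rewrite mulr_sumr -sumrB; apply: eq_bigr => K _; ring.
have : eta * (\sum_K g K + 1) = \sum_K g K * p K - y by rewrite /eta divfK// gt_eqF.
by lra.
Unshelve. all: by end_near. Qed.

Hypothesis Gcont : forall (mu : {measure set R -> \bar R} ^nat) nu,
  (forall j, loc_fin_01 (mu j)) -> loc_fin_01 nu -> vague_cvg mu nu -> G (mu j) @[j --> \oo] --> G nu.

(* [H] is the limit, over grids and truncation levels, of simple functions of the cell counts of
   [xi]; it replaces [G \o xi], which need not be measurable. *)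
Lemma cox_mean_lower : exists H : Omega -> \bar R,
  [/\ measurable_fun [set: Omega] H,
      (forall w, integral_event w -> H w = (G (xi w))%:E) &
      forall y : R, (y%:E < \int[P]_w H w)%E -> \forall n \near \oo, y <= gibbs_mean G n].
Proof.
have [_ [_ [lfxi _]]] := coxP.
pose g M B (K : {ffun 'I_M.+1 -> 'I_B}) := @cell_inf R G M (fun i => K i).
pose S M B (K : {ffun 'I_M.+1 -> 'I_B}) := @cells_event M (fun i => K i).
have g0 M B (K : {ffun 'I_M.+1 -> 'I_B}) : 0 <= g M B K by exact: cell_inf_ge0.
pose h M B w : \bar R := (\sum_(K : {ffun 'I_M.+1 -> 'I_B}) g M B K * \1_(S M B K) w)%:E.
have h0 M B w : (0 <= h M B w)%E.
  by rewrite lee_fin sumr_ge0// => K _; rewrite mulr_ge0.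
have hI M B := @integral_step_comb R _ Omega P setT _ (S M B) (g M B) measurableT
  (fun K => @measurable_cells_event M _) (fun K => @subsetT _ _)
  (fun K => le_lt_trans (probability_le1 P (@measurable_cells_event M _)) (ltry 1)).
have mh M B : measurable_fun setT (h M B) by have [/integrableP[]] := hI M B.
pose L M w := limn_einf (fun B => h M B w).
have mL M : measurable_fun setT (L M) by exact: measurable_fun_limn_einf.
have L0 M w : (0 <= L M w)%E by apply: limn_einf_ge0 => B.
exists (fun w => limn_einf (fun M => L M w)); split.
- exact: measurable_fun_limn_einf.
- move=> w Ew; pose n M (i : 'I_M.+1) := Num.truncn (fine (xi w (grid_cell M i))).
  have nE M (i : 'I_M.+1) : xi w (grid_cell M i) = (n M i)%:R%:E.
    by rewrite /n; have [k ->] := Ew M i; rewrite /= natrK.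
  have hc M : has_cells (n M) (xi w) by split => //.
  have hE M B : h M B w = (if [forall i, (n M i < B)%N] then cell_inf G (n M) else 0)%:E.
    rewrite /h -(cell_sum_pointwise G B (hc M)); congr (_%:E); apply: eq_bigr => K _.
    congr (_ * _); rewrite indicE; congr (_%:R); congr nat_of_bool.
    apply/idP/forallP => [/set_mem wK i|nK].
      by have := wK i; rewrite nE => -[/eqP]; rewrite eqr_nat.
    by apply/mem_set => i; rewrite nE (eqP (nK i)).
  have LE M : L M w = (cell_inf G (n M))%:E.
    apply: (fst (cvg_limn_einf_sup _)); apply: cvg_near_cst.
    exists (\max_i n M i).+1 => // B /= nB; rewrite hE ifT//; apply/forallP => i.
    by apply: leq_ltn_trans nB; exact: leq_bigmax.
  apply: (fst (cvg_limn_einf_sup _)).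
  rewrite (_ : L^~ w = fun M => (cell_inf G (n M))%:E); last exact/funext.
  apply: cvg_EFin; first exact: nearW.
  exact: cell_inf_cvg.
(* Fatou's lemma twice, over the grid and then over the truncation level, yields one M and one B
   whose simple function already has integral above y. *)
- move=> y /lt_le_trans/(_ (fatou _ measurableT mL (fun M w _ => L0 M w))) /limn_einf_gt/filter_ex[M].
  move=> /lt_le_trans/(_ (fatou _ measurableT (mh M) (fun B w _ => h0 M B w))) /limn_einf_gt/filter_ex[B].
  have [_ ->] := hI M B; rewrite lte_fin.
  exact: gexp_cell_inf_lower.
Qed.

End LowerBound.
Theorem gexp_cox_limit (F : {measure set R -> \bar R} -> R) : bdd_vague_cont F ->
  ((gibbs_mean F n)%:E @[n --> \oo] --> \int[P]_x (F (xi x))%:E)%E.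
Proof.
move=> [[C FC] Fcont].
have FC1 nu : - C <= F nu <= C by rewrite -ler_norml.
have [H1 [mH1 EH1 low1]] : exists H : Omega -> \bar R, [/\ measurable_fun [set: Omega] H,
    (forall w, integral_event w -> H w = (F (xi w) + C)%:E) &
    forall y : R, (y%:E < \int[P]_w H w)%E -> \forall n \near \oo, y <= gibbs_mean (fun nu => F nu + C) n].
  apply: (@cox_mean_lower (fun nu => F nu + C) (C + C)) => [nu|nu|la nu h1 h2 h3].
  - by have /andP[] := FC1 nu; lra.
  - by have /andP[] := FC1 nu; lra.
  - by apply: cvgD; [exact: Fcont|exact: cvg_cst].
have [H2 [mH2 EH2 low2]] : exists H : Omega -> \bar R, [/\ measurable_fun [set: Omega] H,
    (forall w, integral_event w -> H w = (- F (xi w) + C)%:E) &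
    forall y : R, (y%:E < \int[P]_w H w)%E -> \forall n \near \oo, y <= gibbs_mean (fun nu => - F nu + C) n].
  apply: (@cox_mean_lower (fun nu => - F nu + C) (C + C)) => [nu|nu|la nu h1 h2 h3].
  - by have /andP[] := FC1 nu; lra.
  - by have /andP[] := FC1 nu; lra.
  - by apply: cvgD; [apply: cvgN; exact: Fcont|exact: cvg_cst].
(* A bounded measurable version of F composed with [xi]: additivity of the integral, needed to
   relate the means of [H1] and [H2], is available for it. *)
pose F' w := (fine (H1 w) - C) * \1_integral_event w.
have F'E w : integral_event w -> F' w = F (xi w).
  by move=> Ew; rewrite /F' EH1//= indicE mem_set// mulr1 addrK.
have mE := measurable_integral_event.
have off := integral_eq_off_null mE integral_event_ae.
have iF' : P.-integrable setT (EFin \o F').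
  apply: measurable_bounded_integrable => //; first by rewrite fin_num_fun_lty// fin_num_measure.
  - apply: measurable_funM; last exact: measurable_indic.
    by apply: measurable_funB => //; exact: measurableT_comp.
  - exists C; split; first exact: num_real.
    move=> y Cy w _; apply: le_trans (ltW Cy); rewrite /=.
    case: (pselect (integral_event w)) => Ew; first by rewrite F'E.
    by rewrite /F' indicE memNset// mulr0 normr0 (le_trans _ (FC (xi w))).
have [r rE] : exists r, (\int[P]_w (F' w)%:E = r%:E)%E.
  by exists (fine (\int[P]_w (F' w)%:E)%E); rewrite fineK//; exact: integrable_fin_num iF'.
have FE : (\int[P]_x (F (xi x))%:E = r%:E)%E.
  by rewrite -rE; apply: off => w Ew; rewrite F'E.
have iC : P.-integrable setT (fun=> C%:E).
  by apply: finite_measure_integrable_cst.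
have IC : (\int[P]_w C%:E = C%:E)%E by have := expectation_cst P C; rewrite unlock.
have I1 : (\int[P]_w H1 w = (r + C)%:E)%E.
  rewrite (off _ (fun w => (F' w)%:E + C%:E)%E); last by move=> w Ew; rewrite EH1// F'E// EFinD.
  by rewrite integralD// rE IC.
have I2 : (\int[P]_w H2 w = (- r + C)%:E)%E.
  rewrite (off _ (fun w => - (F' w)%:E + C%:E)%E); last by move=> w Ew; rewrite EH2// F'E// EFinD.
  rewrite integralD//; last by apply: integrableN.
  by rewrite integralN ?rE ?IC//; exact: integrable_add_def.
rewrite FE; apply: cvg_EFin; first exact: nearW.
apply/cvgrPdist_le => e e0.
have near1 := low1 (r + C - e); rewrite I1 lte_fin in near1.
have {}near1 := near1 (ltac:(lra)).
have near2 := low2 (- r + C - e); rewrite I2 lte_fin in near2.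
have {}near2 := near2 (ltac:(lra)).
have near3 := good.
near=> n.
have [cU U0] : cvgn (series (gibbs_term q V n (fun=> 1))) /\
  0 < limn (series (gibbs_term q V n (fun=> 1))) by near: n.
have bF : gbounded (fun s => F (point_measure (gibbs_points R n s))) by exists C => s.
have gC : gexp q V n (fun=> C) = C.
  rewrite -[RHS]mulr1 -(gexp1 U0) -gexpZ//; last exact: gbounded_cst.
  by congr gexp; apply/funext => s; rewrite mulr1.
have h1 : r + C - e <= gibbs_mean (fun nu => F nu + C) n by near: n.
have h2 : - r + C - e <= gibbs_mean (fun nu => - F nu + C) n by near: n.
rewrite gexpD// ?gC in h1; last exact: gbounded_cst.
have gN : gexp q V n (fun s => - F (point_measure (gibbs_points R n s))) = - gibbs_mean F n.
  rewrite -mulN1r -gexpZ//; congr gexp; apply/funext => s; exact: esym (mulN1r _).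
have bN : gbounded (fun s => - F (point_measure (gibbs_points R n s))).
  by exists C => s; rewrite normrN.
rewrite gexpD// ?gC ?gN in h2; last exact: gbounded_cst.
by rewrite ler_norml; apply/andP; split; rewrite /=; lra.
Unshelve. all: by end_near. Qed.

End GibbsLimit.

(** * From the original weights to the tilted ones *)

Section Normalization.
Variable R : realType.

Lemma slowly_varying_scale (L : R -> R) (c : R) : 0 < c -> slowly_varying L ->
  slowly_varying (fun x => L x / c).
Proof.
move=> c0 [L0 [mL Lr]]; split; [|split].
- by move=> x x0; rewrite divr_gt0// L0.
- exact: measurable_funM.
- move=> a a0; have -> : (fun x => L (a * x) / c / (L x / c)) = (fun x => L (a * x) / L x).
    by apply/funext => x; rewrite invfM invrK mulrACA [c^-1 * c]mulVf ?mulr1// gt_eqF.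
  exact: Lr.
Qed.

Lemma rseries_tail (q : nat -> R) (x : R) : is_pmf q -> 0 <= x ->
  rseries (fun k => if x < k%:R then q k else 0) = ptail q (Num.truncn x).
Proof.
move=> [_ qs] x0; rewrite ptail_series; apply: cvg_lim => //.
set t := Num.truncn x.
apply: cvg_trans (cvgB qs (cvg_cst (series q t.+1))).
apply: near_eq_cvg; exists t.+1 => // n /= tn.
have spl f : series f n = series f t.+1 + \sum_(t.+1 <= k < n) f k :> R.
  by rewrite -sub_series_geq// addrC subrK.
rewrite -[LHS]/(series q n - series q t.+1) [RHS]spl spl addrAC subrr add0r.
rewrite [X in _ = X + _]/series /= [X in _ = X + _]big_nat [X in _ = X + _]big1 ?add0r.
  by rewrite big_nat [RHS]big_nat; apply: eq_bigr => k /andP[tk _]; rewrite -truncn_lt_nat// tk.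
by move=> k /andP[_ kt]; rewrite -truncn_lt_nat// ltnNge -ltnS kt.
Qed.

End Normalization.

Theorem theorem1p4 (R : realType) (w v : R ^nat) (rho alpha gamma : R)
    (Lw Lv : R -> R) (Lambda : {measure set R -> \bar R}) :
  (forall n, 0 <= w n) -> (forall k, 0 <= v k) ->
  0 < rho -> -1 < alpha ->
  slowly_varying Lw -> slowly_varying Lv ->
  cvgn (series (fun n => w n * rho ^+ n)) -> 0 < Wgen w rho ->
  asym_eq w (fun n => Lw n%:R * n%:R^-1 * rho ^- n) ->
  asym_eq v (fun n => Lv n%:R * n%:R `^ (alpha - 1) * (Wgen w rho) ^- n) ->
  0 <= gamma ->
  (forall t, 0 < t < 1 ->
     (tailX w rho (n%:R `^ t) / tailX w rho n%:R) @[n --> \oo] --> t `^ (- gamma)) ->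
  (forall a b, 0 < a -> a < b -> b <= 1 ->
     Lambda `[a, b]%classic = (a `^ (- gamma) - b `^ (- gamma))%:E) ->
  forall d (Omega : measurableType d) (P : probability Omega R)
         (xi : Omega -> {measure set R -> \bar R}) (Z : Omega -> R),
  cox_gamma P xi Z Lambda alpha ->
  forall F : {measure set R -> \bar R} -> R, bdd_vague_cont F ->
    ((gibbs_E w v n (fun s => F (point_measure (gibbs_points R n s))))%:E)
      @[n --> \oo] --> (\int[P]_x (F (xi x))%:E)%E.
Proof.
move=> w0 v0 rho0 alpha1 svw svv cw W0 aw av _ ratio LambdaE d Omega P xi Z coxP F bF.
set W := Wgen w rho in W0 av ratio *.
pose q j := w j * rho ^+ j / W; pose V k := v k * W ^+ k.
have rn0 n : rho ^+ n != 0 by rewrite expf_neq0// gt_eqF.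
have Wn0 n : W ^+ n != 0 by rewrite expf_neq0// gt_eqF.
have Wne : W != 0 by rewrite gt_eqF.
have qp : is_pmf q.
  split; first by move=> j; rewrite divr_ge0 ?(ltW W0)// mulr_ge0// exprn_ge0// ltW.
  have -> : series q = W^-1 *: series (fun n => w n * rho ^+ n).
    by rewrite -seriesZ; congr series; apply/funext => j; rewrite /q mulrC.
  rewrite -[X in _ --> X](mulVf Wne); apply: cvgZr; exact: cw.
have pl : potter_seq (fun j => j%:R * q j).
  apply: (slowly_varying_potter_seq (slowly_varying_scale W0 svw)).
  apply: cvg_trans aw; apply: near_eq_cvg; exists 1%N => // j /= j1.
  have j0 : (j%:R : R) != 0 by rewrite pnatr_eq0; lia.
  have L0 : Lw j%:R != 0 by rewrite gt_eqF//; apply: (proj1 svw); rewrite ltr0n.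
  by rewrite /q; field; rewrite j0 L0 Wne rn0.
have V0 k : 0 <= V k by rewrite mulr_ge0// exprn_ge0// ltW.
have pV : potter_seq (sv_part alpha V).
  apply: (slowly_varying_potter_seq svv).
  apply: cvg_trans av; apply: near_eq_cvg; exists 1%N => // j /= j1.
  have j0 : 0 < (j%:R : R) by rewrite ltr0n.
  have L0 : Lv j%:R != 0 by rewrite gt_eqF//; exact: (proj1 svv).
  have p0 : (j%:R : R) `^ (alpha - 1) != 0 by rewrite gt_eqF// powR_gt0.
  rewrite /sv_part /V -(opprB alpha) powRN; field; by rewrite L0 p0 Wn0.
have tailE x : 0 <= x -> tailX w rho x = ptail q (Num.truncn x) by exact: rseries_tail.
have ratio' t : 0 < t < 1 ->
    ptail q (Num.truncn (n%:R `^ t : R)) / ptail q n @[n --> \oo] --> t `^ (- gamma).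
  move=> /ratio; apply: cvg_trans; apply: near_eq_cvg; apply: nearW => n.
  by rewrite !tailE ?powR_ge0// natrK.
apply: cvg_trans (gexp_cox_limit qp pl alpha1 V0 pV ratio' LambdaE coxP bF).
have [G0 GE] := gamma_const_gt0 coxP.
have := gibbs_normalizer_gt0 qp pl alpha1 V0 pV G0 GE.
move=> near1; apply: near_eq_cvg; apply: filterS near1 => n [cU U0].
have sumE G : gbounded G -> gibbs_sum w v n G = rho ^- n * limn (series (gibbs_term q V n G)).
  move=> bG; rewrite gibbs_sumE /rseries.
  have -> : series (gibbs_term w v n G) = rho ^- n *: series (gibbs_term q V n G).
    rewrite -seriesZ; congr series; apply/funext => k.
    by apply: gibbs_term_rescale => //; rewrite gt_eqF.
  by rewrite limZr//; apply: gibbs_term_cvg => //; case: qp.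
rewrite /gibbs_E /gibbs_u !sumE; last 2 first.
- by exists `|1| => s.
- by have [[C FC] _] := bF; exists C => s.
by rewrite /gexp -mulf_div divff ?mul1r// invr_neq0.
Qed.
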